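(* Suppose that, for both choices $[u]^{1/2}=|u|^{1/2}$ and $[u]^{1/2}=\mathrm{sign}(u)|u|^{1/2}$, the operators $\mathfrak{C}^R$ are bounded in $L^p(\mathbb{R})$ for all $1<p<+\infty$, independently of $R>0$; that is, for every $p\in(1,+\infty)$ there is $C_p<\infty$ with $\|\mathfrak{C}^Rf\|_p\le C_p\|f\|_p$ for all $R>0$ and all $f$. Then $$\sup_{a\in\mathbb{R}\cup\{+\infty\}}\ \Big\|\sup_{b\in\mathbb{R}}\mathcal{C}_{a,b}\Big\|_{p\to p}<+\infty\qquad\text{for all }p\in(1,+\infty).$$
   Context: For $R>0$, $$\mathfrak{C}^Rf(x)=\sup_{N,b\in\mathbb{R}}\left|\mathrm{p.v.}\int_{-R}^{R}f(x-t)\,e^{iNt}\,e^{ib[t+1]^{1/2}}\,\frac{dt}{t}\right|,$$ where $[u]^{1/2}$ denotes either $|u|^{1/2}$ or $\mathrm{sign}(u)|u|^{1/2}$, and the principal value is taken at $t=0$. Fourier transform on $\mathbb{R}$: $\mathcal{F}f(\xi)=\widehat f(\xi)=\int_{\mathbb{R}} f(y)e^{-2\pi i \xi y}\,dy$, with inverse $\mathcal{F}^{-1}$. For $(\xi,\eta)\in\mathbb{R}^2$ let $$m_2(\xi,\eta)=\mathrm{p.v.}\int_{\mathbb{R}}e^{i(\xi t+\eta t^2)}\,\frac{dt}{t}$$ (principal value at $t=0$ and at infinity, i.e. the limit of the integrals over $\epsilon<|t|<1/\epsilon$ as $\epsilon\to0$). For $a,b\in\mathbb{R}$ put $m_{a,b}(\eta)=m_2(a\eta+b,\eta)$,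 and put $m_{+\infty,b}(\eta)=m_2(\eta,b)$. Define $T_{a,b}f(x)=\mathcal{F}^{-1}(m_{a,b}\widehat f)(x)$ and $$\mathcal{C}_{a,b}f(x)=\sup_{N\in\mathbb{R}}\big|T_{a,b}(e^{iN\cdot}f)(x)\big|,$$ where $e^{iN\cdot}f$ denotes $y\mapsto e^{iNy}f(y)$. $\|\cdot\|_{p\to p}$ is the best constant in the $L^p(\mathbb{R})\to L^p(\mathbb{R})$ bound. Convention: functions are taken in the Schwartz class $\mathcal{S}(\mathbb{R})$ and bounds are extended by density. *)

(* Defs.v *)
From HB Require Import structures.
From mathcomp Require Import all_boot all_order all_algebra.
From mathcomp Require Import all_classical all_reals all_analysis.
From mathcomp Require Import complex.

Set Implicit Arguments.
Unset Strict Implicit.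
Unset Printing Implicit Defensive.

Import Order.TTheory GRing.Theory Num.Theory.
Import numFieldNormedType.Exports.

Local Open Scope classical_set_scope.
Local Open Scope ring_scope.

Section Definitions.
Context {R : realType}.

Local Notation mu := (@lebesgue_measure R).
Local Notation Re := (@complex.Re R).
Local Notation Im := (@complex.Im R).

Definition cabs (z : R[i]) : R := ComplexField.Normc.normc z.

Definition expi (x : R) : R[i] := Complex (cos x) (sin x).

Definition cintegral (D : set R) (F : R -> R[i]) : R[i] :=
  Complex (\int[mu]_(t in D) Re (F t)) (\int[mu]_(t in D) Im (F t)).

Definition clim0 (G : R -> R[i]) : R[i] :=
  Complex (lim (Re (G e) @[e --> 0^'+])) (lim (Im (G e) @[e --> 0^'+])).

Definition real_schwartz (g : R -> R) : Prop :=
  (forall (n : nat) (x : R), derivable (derive1n n g) x 1) /\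
  (forall m n : nat, exists K : R, forall x : R, `|x| ^+ m * `|(derive1n n g) x| <= K).

Definition schwartz (f : R -> R[i]) : Prop :=
  real_schwartz (Re \o f) /\ real_schwartz (Im \o f).

Definition normLp (p : R) (g : R -> \bar R) : \bar R := ('N[mu]_(p%:E)[g])%E.

Definition abs_fun (f : R -> R[i]) (x : R) : \bar R := (cabs (f x))%:E.

(* The best constant in the L^p bound, with T tested on Schwartz functions
   only (bounds extend by density). *)
Definition opnorm (p : R) (T : (R -> R[i]) -> R -> \bar R) : \bar R :=
  ereal_inf [set c%:E | c in [set c : R | 0 <= c /\
    forall f : R -> R[i], schwartz f ->
      (normLp p (T f) <= c%:E * normLp p (abs_fun f))%E]].

Definition bracket_sqrt (signed : bool) (u : R) : R :=
  if signed then Num.sg u * Num.sqrt `|u| else Num.sqrt `|u|.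

(* The supremum is over pairs (N, b); the kernel integral over [-r, r] is a
   principal value at t = 0, which exists for Schwartz f, so that the total
   operator [lim] in [clim0] returns a genuine limit. *)
Definition frakC (signed : bool) (r : R) (f : R -> R[i]) (x : R) : \bar R :=
  ereal_sup (range (fun Nb : R * R =>
    (cabs (clim0 (fun e => cintegral [set t | e < `|t| <= r]
      (fun t => f (x - t) * expi (Nb.1 * t)
                * expi (Nb.2 * bracket_sqrt signed (t + 1)) / t%:C%C))))%:E)).

Definition fourier (f : R -> R[i]) (xi : R) : R[i] :=
  cintegral setT (fun y => f y * expi (- (2 * pi * xi * y))).

Definition inv_fourier (g : R -> R[i]) (x : R) : R[i] :=
  cintegral setT (fun xi => g xi * expi (2 * pi * x * xi)).

(* Principal value at 0 and at infinity; the limit exists for all xi, eta. *)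
Definition m2 (xi eta : R) : R[i] :=
  clim0 (fun e => cintegral [set t | e < `|t| < e^-1]
    (fun t => expi (xi * t + eta * t ^+ 2) / t%:C%C)).

(* The index a ranges over the reals and +oo; the value at -oo is junk. *)
Definition mult (a : \bar R) (b eta : R) : R[i] :=
  match a with
  | a'%:E => m2 (a' * eta + b) eta
  | +oo%E => m2 eta b
  | -oo%E => 0
  end.

Definition multop (a : \bar R) (b : R) (f : R -> R[i]) : R -> R[i] :=
  inv_fourier (fun eta => mult a b eta * fourier f eta).

Definition calC (a : \bar R) (b : R) (f : R -> R[i]) (x : R) : \bar R :=
  ereal_sup (range (fun N : R =>
    (cabs (multop a b (fun y => expi (N * y) * f y) x))%:E)).

Definition sup_calC (a : \bar R) (f : R -> R[i]) (x : R) : \bar R :=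
  ereal_sup (range (fun b : R => calC a b f x)).

End Definitions.

(* Main.v *)
(** By Fourier inversion T_{a,b}(e^{iN.} f)(x) is the principal value of the integral
   of e^{ibt} F(x + (a t + t^2) / (2 pi)) dt / t with F = e^{iN.} f (for a = +oo: of
   e^{ibt^2} F(x + t / (2 pi)) dt / t).  For a <> 0 the substitution t = a s and a
   dilation of f by a^2 / (8 pi) turn the argument into v = 4 (s + s^2).  Since
   v + 1 = (1 + 2 s)^2, the linear phase becomes +-beta sqrt (v + 1) on the two branches
   s > -1/2 and s < -1/2, and dv / v = (1 / s + 1 / (1 + s)) ds.  Up to a kernel of size
   1 / (1 + s^2) in s, the operator is therefore the truncation to |v| < 1 of the
   operator defining C^1, plus half the difference over v > 1 of the two branches;
   adding the two choices of the bracket cancels the contribution of v < -1, so this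
   difference is a combination of C^R and C^1, up to a tail that vanishes as R grows.
   The error kernel is bounded on L^p by Jensen's inequality, uniformly in a because all
   norms scale in the same way under dilation.  The slopes 0 and +oo are limits: the
   former of small slopes, the latter of C^r with r -> 0, where sqrt (1 + v) is replaced
   by its quadratic Taylor polynomial; Fatou's lemma concludes. *)
From HB Require Import structures.
Require Import Defs.
From mathcomp Require Import all_boot all_order all_algebra.
From mathcomp Require Import all_classical all_reals all_analysis.
From mathcomp Require Import measurable_realfun complex ring lra.

Set Implicit Arguments.
Unset Strict Implicit.
Unset Printing Implicit Defensive.

Import Order.TTheory GRing.Theory Num.Theory.
Import numFieldNormedType.Exports.
Local Open Scope classical_set_scope.
Local Open Scope ring_scope.

(** * Complex-valued integrals *)

(** The obstacle is that the multiplier is itself only conditionally convergent and that the suprema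
    over $b$ and $N$ are taken before any norm. Hence every comparison is made pointwise, at fixed
    $x$, $b$, $N$, for integrals truncated to $e \le |t| \le M$. The truncated multipliers are
    bounded by one absolute constant, so that dominated convergence moves the truncation outside the
    Fourier integral, while Fubini and inversion apply to each truncated kernel. The truncation is
    removed first, at a fixed radius $r$ of $\mathfrak{C}^r$; what is left is an error of order
    $\|f\|_1/r$. Error terms may depend on $x$, $b$ and $N$ in any way, provided that they vanish
    along a sequence whose main terms do not involve $b$ and $N$: the lower limit of the main terms
    then bounds the whole supremum. This supremum is not shown to be measurable, so Fatou's lemma is
    applied to the majorants, which are measurable because $\mathfrak{C}^r f$ is lower
    semicontinuous. *)

Section ComplexNorm.
Context {R : realType}.
Local Notation C := R[i].
Local Notation Re := (@complex.Re R).
Local Notation Im := (@complex.Im R).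
Implicit Types (z w : C) (x y : R).

Lemma ReM z w : Re (z * w) = Re z * Re w - Im z * Im w.
Proof. by case: z w => [a b] [c d]. Qed.

Lemma ImM z w : Im (z * w) = Re z * Im w + Im z * Re w.
Proof. by case: z w => [a b] [c d]. Qed.

Lemma ReD z w : Re (z + w) = Re z + Re w.
Proof. by case: z w => [a b] [c d]. Qed.

Lemma ImD z w : Im (z + w) = Im z + Im w.
Proof. by case: z w => [a b] [c d]. Qed.

Lemma ReN z : Re (- z) = - Re z.
Proof. by case: z. Qed.

Lemma ImN z : Im (- z) = - Im z.
Proof. by case: z. Qed.

Lemma cdivr z x : z / x%:C%C = Complex (Re z / x) (Im z / x).
Proof. by rewrite -(@fmorphV _ _ (real_complex R)); case: z => a b; congr Complex; rewrite /= ?mulr0 ?subr0 ?add0r. Qed.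

Lemma cabs_ge0 z : 0 <= cabs z.
Proof. by case: z => a b; exact: sqrtr_ge0. Qed.

Lemma cabsM z w : cabs (z * w) = cabs z * cabs w.
Proof. exact: ComplexField.Normc.normcM. Qed.

Lemma cabsD z w : cabs (z + w) <= cabs z + cabs w.
Proof. exact: le_normcD. Qed.

Lemma cabsN z : cabs (- z) = cabs z.
Proof. exact: normcN. Qed.

Lemma cabs0 : cabs (0 : C) = 0.
Proof. exact: ComplexField.Normc.normc0. Qed.

Lemma cabsB z w : cabs (z - w) <= cabs z + cabs w.
Proof. by rewrite -(cabsN w) cabsD. Qed.

Lemma cabs_distl z w : cabs z <= cabs w + cabs (z - w).
Proof. by rewrite -[X in cabs X <= _](subrKC w) cabsD. Qed.

Lemma cabs_real x : cabs (x%:C%C) = `|x|.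
Proof. by rewrite /cabs/= expr0n/= addr0 sqrtr_sqr. Qed.

Lemma cabs_expi x : cabs (expi x) = 1.
Proof. by rewrite /cabs/= cos2Dsin2 sqrtr1. Qed.

Lemma cabs_div z x : cabs (z / x%:C%C) = cabs z / `|x|.
Proof. by rewrite cabsM -(@fmorphV _ _ (real_complex R)) cabs_real normfV. Qed.

Lemma cabs_half z : cabs (z / 2) = cabs z / 2.
Proof.
have -> : (2 : C) = (2%:R)%:C%C by rewrite rmorph_nat.
by rewrite cabs_div ger0_norm.
Qed.

Lemma Re_le_cabs z : `|Re z| <= cabs z.
Proof.
case: z => a b; rewrite /cabs/= -sqrtr_sqr ler_wsqrtr// lerDl sqr_ge0//.
Qed.

Lemma Im_le_cabs z : `|Im z| <= cabs z.
Proof.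
case: z => a b; rewrite /cabs/= -sqrtr_sqr ler_wsqrtr// lerDr sqr_ge0//.
Qed.

Lemma cabs_le_ReIm z : cabs z <= `|Re z| + `|Im z|.
Proof.
case: z => a b; rewrite /cabs/= -(ger0_norm (addr_ge0 (normr_ge0 a) (normr_ge0 b))).
rewrite -sqrtr_sqr ler_wsqrtr// sqrrD !real_normK ?num_real// lerD2r lerDl.
by rewrite mulrn_wge0// mulr_ge0.
Qed.

Lemma expiD x y : expi (x + y) = expi x * expi y :> C.
Proof. by rewrite /expi cosD sinD; congr Complex; rewrite addrC (mulrC (cos x)). Qed.

Lemma sin_le_norm x : `|sin x| <= `|x|.
Proof.
have H y : 0 <= y -> `|sin y| <= y.
  move=> y0; have [<-|ny0] := eqVneq 0 y; first by rewrite sin0 normr0.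
  have [|c _] := @MVT_segment R sin cos 0 y y0.
    by apply: continuous_subspaceT => z; exact: continuous_sin.
  rewrite sin0 !subr0 => ->; rewrite normrM (ger0_norm y0) ler_piMl//.
  by rewrite ler_norml cos_geN1 cos_le1.
have [x0|/ltW x0] := leP 0 x; first by rewrite (ger0_norm x0) H.
by rewrite -normrN -sinN (ler0_norm x0) H// oppr_ge0.
Qed.

(** Half-angle factorization $e^{ix} - 1 = 2 \sin(x/2) \cdot i e^{ix/2}$; the second factor has
    modulus 1. The bound $|\sin(x/2)| \le |x/2|$ is relaxed to $|x|$, sharp constants being of no
    use later. *)
Lemma cabs_expi1 x : cabs (expi x - 1) <= 2 * `|x|.
Proof.
have e : expi x - 1 = (2 * sin (x / 2))%:C%C * Complex (- sin (x / 2)) (cos (x / 2)) :> C.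
  have x2 : x = x / 2 + x / 2 by rewrite -splitr.
  rewrite {1}x2 /expi cosD sinD.
  have := cos2Dsin2 (x / 2); set c := cos _; set s := sin _ => cs.
  apply/eqP; rewrite eq_complex/=; apply/andP; split; apply/eqP; last ring.
  by rewrite -[X in _ + - X = _]cs; ring.
rewrite e cabsM cabs_real [cabs (Complex _ _)]/cabs/= sqrrN addrC cos2Dsin2 sqrtr1 mulr1.
rewrite normrM (ger0_norm (ltW _))// ler_wpM2l//.
rewrite (le_trans (sin_le_norm _))// normrM ler_piMr// ger0_norm ?invr_ge0//.
by rewrite invf_le1// ler1n.
Qed.

Lemma cabs_expiB x y : cabs (expi x - expi y) <= 2 * `|x - y|.
Proof.
have -> : expi x - expi y = expi y * (expi (x - y) - 1) :> C.
  by rewrite mulrBr mulr1 -expiD subrKC.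
by rewrite cabsM cabs_expi mul1r cabs_expi1.
Qed.
End ComplexNorm.

(** * Measurability of complex-valued functions, tested on real and imaginary parts *)

Section ComplexMeasurable.
Context {R : realType} d {T : measurableType d}.
Local Notation C := R[i].
Local Notation Re := (@complex.Re R).
Local Notation Im := (@complex.Im R).
Implicit Types (F G : T -> C) (f : T -> R).

Definition cmeas F := measurable_fun setT (fun t => Re (F t)) /\ measurable_fun setT (fun t => Im (F t)).

Lemma cmeas_cst z : cmeas (fun=> z).
Proof. by split; exact: measurable_cst. Qed.

Lemma cmeasM F G : cmeas F -> cmeas G -> cmeas (fun t => F t * G t).
Proof.
move=> [F1 F2] [G1 G2]; split.
  under eq_fun do rewrite ReM.
  by apply: measurable_funB; apply: measurable_funM.
under eq_fun do rewrite ImM.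
by apply: measurable_funD; apply: measurable_funM.
Qed.

Lemma cmeasD F G : cmeas F -> cmeas G -> cmeas (fun t => F t + G t).
Proof.
move=> [F1 F2] [G1 G2]; split.
  by under eq_fun do rewrite ReD; exact: measurable_funD.
by under eq_fun do rewrite ImD; exact: measurable_funD.
Qed.

Lemma cmeasN F : cmeas F -> cmeas (fun t => - F t).
Proof.
move=> [F1 F2]; split.
  by under eq_fun do rewrite ReN; exact: measurableT_comp.
by under eq_fun do rewrite ImN; exact: measurableT_comp.
Qed.

Lemma cmeasB F G : cmeas F -> cmeas G -> cmeas (fun t => F t - G t).
Proof. by move=> mF mG; apply: cmeasD => //; exact: cmeasN. Qed.

Lemma cmeas_real f : measurable_fun setT f -> cmeas (fun t => (f t)%:C%C).
Proof. by split => //; exact: measurable_cst. Qed.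

Lemma cmeas_expi f : measurable_fun setT f -> cmeas (fun t => expi (f t)).
Proof.
move=> mf; split.
  apply: (@measurableT_comp _ _ _ _ _ _ cos) => //.
  by apply: continuous_measurable_fun; exact: continuous_cos.
apply: (@measurableT_comp _ _ _ _ _ _ sin) => //.
by apply: continuous_measurable_fun; exact: continuous_sin.
Qed.

Lemma cmeas_comp d' (T' : measurableType d') (phi : T' -> T) F :
  measurable_fun setT phi -> cmeas F ->
  measurable_fun setT (fun t => Re (F (phi t))) /\ measurable_fun setT (fun t => Im (F (phi t))).
Proof.
move=> mp [F1 F2]; split.
  exact: (@measurableT_comp _ _ _ _ _ _ (fun t => Re (F t))).
exact: (@measurableT_comp _ _ _ _ _ _ (fun t => Im (F t))).
Qed.

Lemma measurable_cabs F : cmeas F -> measurable_fun setT (fun t => cabs (F t)).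
Proof.
move=> [F1 F2].
have -> : (fun t => cabs (F t)) = (fun t => Num.sqrt (Re (F t) ^+ 2 + Im (F t) ^+ 2)).
  by apply/funext => t; rewrite /cabs; case: (F t).
apply: (@measurableT_comp _ _ _ _ _ _ (@Num.sqrt R)) => //.
  by apply: continuous_measurable_fun; exact: sqrt_continuous.
by apply: measurable_funD; apply: measurable_funX.
Qed.
End ComplexMeasurable.

Section RealMeasurable.
Context {R : realType}.

(** Writing $x^{-1} = x \cdot (x^2)^{-1}$ moves the reciprocal to nonnegative arguments, where it is
    a measurable real power; at 0 both sides are 0 by convention. *)
Lemma measurable_inv : measurable_fun setT (fun x : R => x^-1).
Proof.
have -> : (fun x : R => x^-1) = (fun x => x * ((x ^+ 2) `^ (- 1))).
  apply/funext => x; have [->|x0] := eqVneq x 0; first by rewrite invr0 mul0r.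
  rewrite powR_inv1 ?sqr_ge0// expr2 invfM mulrA divff// mul1r//.
apply: measurable_funM => //.
apply: (@measurableT_comp _ _ _ _ _ _ (fun x : R => x `^ (- 1))) => //.
Qed.

Lemma measurable_pair_comp d (T : measurableType d) (f : R -> R) (g : T -> R) :
  continuous f -> measurable_fun setT g -> measurable_fun setT (fun t => f (g t)).
Proof.
move=> cf mg; apply: (@measurableT_comp _ _ _ _ _ _ f) => //.
exact: continuous_measurable_fun.
Qed.

Lemma measurable_funV d (T : measurableType d) (g : T -> R) :
  measurable_fun setT g -> measurable_fun setT (fun t => (g t)^-1).
Proof. by move=> mg; apply: (@measurableT_comp _ _ _ _ _ _ (fun x : R => x^-1)) => //; exact: measurable_inv. Qed.

Lemma cmeas_div d (T : measurableType d) (F : T -> R[i]) (g : T -> R) :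
  cmeas F -> measurable_fun setT g -> cmeas (fun t => F t / (g t)%:C%C).
Proof.
move=> [F1 F2] mg; split; under eq_fun do rewrite cdivr/=.
  by apply: measurable_funM => //; exact: measurable_funV.
by apply: measurable_funM => //; exact: measurable_funV.
Qed.
End RealMeasurable.

Section ComplexIntegral.
Context {R : realType}.
Local Notation C := R[i].
Local Notation Re := (@complex.Re R).
Local Notation Im := (@complex.Im R).
Local Notation mu := (@lebesgue_measure R).
Implicit Types (F G : R -> C) (D : set R) (k : R -> R).

Definition cintg D F := mu.-integrable D (fun t => (Re (F t))%:E) /\ mu.-integrable D (fun t => (Im (F t))%:E).

Lemma cintg_le D F k : measurable D -> cmeas F ->
  (forall t, D t -> cabs (F t) <= k t) -> mu.-integrable D (EFin \o k) -> cintg D F.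
Proof.
move=> mD [F1 F2] Fk ik; split; apply: le_integrable ik => //.
- by apply/measurable_EFinP; exact: measurable_funTS.
- move=> t Dt; rewrite /= lee_fin (le_trans (Re_le_cabs _))// (le_trans (Fk _ Dt))//.
  exact: ler_norm.
- by apply/measurable_EFinP; exact: measurable_funTS.
- move=> t Dt; rewrite /= lee_fin (le_trans (Im_le_cabs _))// (le_trans (Fk _ Dt))//.
  exact: ler_norm.
Qed.

Lemma integrable_cst_itv D a b B : measurable D -> D `<=` `[a, b] ->
  mu.-integrable D (EFin \o (fun=> B : R)).
Proof.
move=> mD Dab; apply: measurable_bounded_integrable => //.
- apply: (@le_lt_trans _ _ (mu `[a, b])); first by apply: le_measure => //; rewrite inE//.
  by rewrite lebesgue_measure_itv/=; case: ifPn => _; rewrite ?ltry// -EFinB ltry.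
- by exists `|B|; split => // x Bx t _ /=; exact: ltW.
Qed.

Lemma cintg_bnd D F a b B : measurable D -> D `<=` `[a, b] -> cmeas F ->
  (forall t, D t -> cabs (F t) <= B) -> cintg D F.
Proof.
move=> mD Dab mF FB; apply: (@cintg_le _ _ (fun=> B)) => //.
exact: integrable_cst_itv Dab.
Qed.

Lemma cintgS D D' F : measurable D -> measurable D' -> D' `<=` D -> cintg D F -> cintg D' F.
Proof. by move=> mD mD' s [i1 i2]; split; apply: integrableS i1 || apply: integrableS i2. Qed.

Lemma cintg_eq D F G : measurable D -> {in D, F =1 G} -> cintg D F -> cintg D G.
Proof.
move=> mD FG [i1 i2]; split.
  by apply: eq_integrable i1 => // x xD; rewrite FG.
by apply: eq_integrable i2 => // x xD; rewrite FG.
Qed.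

Lemma cint_eq D F G : {in D, F =1 G} -> cintegral D F = cintegral D G.
Proof. by move=> FG; congr Complex; apply: eq_Rintegral => x xD; rewrite FG. Qed.

Lemma cintgM D z F : measurable D -> cintg D F -> cintg D (fun t => z * F t).
Proof.
move=> mD [f1 f2]; split.
  under eq_fun do rewrite ReM EFinB !EFinM.
  by apply: integrableB => //; exact: integrableZl.
under eq_fun do rewrite ImM EFinD !EFinM.
by apply: integrableD => //; exact: integrableZl.
Qed.

Lemma cintD D F G : measurable D -> cintg D F -> cintg D G ->
  cintegral D (fun t => F t + G t) = cintegral D F + cintegral D G.
Proof.
move=> mD [f1 f2] [g1 g2]; rewrite /cintegral; congr Complex.
  by rewrite -RintegralD//; apply: eq_Rintegral => x _; rewrite ReD.
by rewrite -RintegralD//; apply: eq_Rintegral => x _; rewrite ImD.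
Qed.

Lemma cintM D z F : measurable D -> cintg D F ->
  cintegral D (fun t => z * F t) = z * cintegral D F.
Proof.
move=> mD [f1 f2]; have iZ c g : mu.-integrable D (fun t => (g t)%:E) -> mu.-integrable D (EFin \o (fun t => c * g t)).
  by move=> ig; rewrite /comp; under eq_fun do rewrite EFinM; exact: integrableZl.
apply/eqP; rewrite eq_complex ReM ImM/=; apply/andP; split; apply/eqP.
  rewrite -!RintegralZl// -RintegralB//; first by apply: eq_Rintegral => x _; rewrite ReM.
    exact: iZ.
  exact: iZ.
rewrite -!RintegralZl// -RintegralD//; first by apply: eq_Rintegral => x _; rewrite ImM.
  exact: iZ.
exact: iZ.
Qed.

Lemma cintB D F G : measurable D -> cintg D F -> cintg D G ->
  cintegral D (fun t => F t - G t) = cintegral D F - cintegral D G.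
Proof.
move=> mD iF iG; rewrite -[- cintegral D G]mulN1r -cintM// -cintD//.
  by apply: cint_eq => x _; rewrite mulN1r.
exact: cintgM.
Qed.

Lemma cintU D D' F : measurable D -> measurable D' -> cintg (D `|` D') F -> [disjoint D & D'] ->
  cintegral (D `|` D') F = cintegral D F + cintegral D' F.
Proof. by move=> mD mD' [f1 f2] dD; rewrite /cintegral !Rintegral_setU. Qed.

(** The factor 2 is the price of estimating real and imaginary parts separately. It recurs in all
    later constants. *)
Lemma cint_le D F k : measurable D -> cmeas F -> mu.-integrable D (EFin \o k) ->
  (forall t, D t -> cabs (F t) <= k t) ->
  cabs (cintegral D F) <= 2 * \int[mu]_(t in D) k t.
Proof.
move=> mD mF ik Fk; have [i1 i2] := cintg_le mD mF Fk ik.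
rewrite (le_trans (cabs_le_ReIm _))//= mulrDl mul1r lerD//.
  rewrite (le_trans (le_normr_Rintegral _ _))//.
  apply: le_Rintegral => //; first exact: (integrable_norm i1).
  by move=> t Dt /=; rewrite (le_trans (Re_le_cabs _))// Fk.
rewrite (le_trans (le_normr_Rintegral _ _))//.
apply: le_Rintegral => //; first exact: (integrable_norm i2).
by move=> t Dt /=; rewrite (le_trans (Im_le_cabs _))// Fk.
Qed.

Lemma cint_bnd D F a b B : measurable D -> D `<=` `[a, b] -> a <= b -> cmeas F -> 0 <= B ->
  (forall t, D t -> cabs (F t) <= B) -> cabs (cintegral D F) <= 2 * (B * (b - a)).
Proof.
move=> mD Dab ab mF B0 FB.
rewrite (le_trans (@cint_le _ _ (fun=> B) mD mF _ FB))//; first exact: integrable_cst_itv Dab.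
rewrite ler_wpM2l// Rintegral_cst// ler_wpM2l//.
have -> : b - a = fine (mu `[a, b]).
  by rewrite lebesgue_measure_itv/= lte_fin; move: ab; rewrite le_eqVlt => /predU1P[->|->//]; rewrite ltxx subrr.
have f1 : mu `[a, b] \is a fin_num by rewrite lebesgue_measure_itv/=; case: ifPn.
apply: fine_le => //; last by apply: le_measure => //; rewrite inE.
rewrite ge0_fin_numE//; apply: (@le_lt_trans _ _ (mu `[a, b])).
  by apply: le_measure => //; rewrite inE.
by rewrite -ge0_fin_numE.
Qed.

Lemma cint_mkcond D F : cintegral D F = cintegral setT (fun t => (\1_D t)%:C%C * F t).
Proof.
rewrite /cintegral; congr Complex; rewrite Rintegral_mkcond; apply: eq_Rintegral => x _.
  by rewrite patchE ReM/= mul0r subr0 indicE; case: ifPn => _; rewrite ?mul1r ?mul0r.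
by rewrite patchE ImM/= mul0r addr0 indicE; case: ifPn => _; rewrite ?mul1r ?mul0r.
Qed.

Lemma cintg_mkcond D F : measurable D -> cintg D F -> cintg setT (fun t => (\1_D t)%:C%C * F t).
Proof.
move=> mD [f1 f2]; have [+ _] := @integrable_mkcond _ _ _ mu _ (fun t => (Re (F t))%:E) mD => /(_ f1) {}f1; have [+ _] := @integrable_mkcond _ _ _ mu _ (fun t => (Im (F t))%:E) mD => /(_ f2) {}f2; split.
  apply: eq_integrable f1 => // x _.
  by rewrite patchE ReM/= mul0r subr0 indicE; case: ifPn => _; rewrite ?mul1r ?mul0r.
apply: eq_integrable f2 => // x _.
by rewrite patchE ImM/= mul0r addr0 indicE; case: ifPn => _; rewrite ?mul1r ?mul0r.
Qed.

Lemma cint_itv b0 b1 a b F : cintg `[a, b] F ->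
  cintegral [set` Interval (BSide b0 a) (BSide b1 b)] F = cintegral `[a, b] F.
Proof.
move=> [i1 i2].
have H f : mu.-integrable `[a, b] (fun t => (f t)%:E) ->
    \int[mu]_(t in [set` Interval (BSide b0 a) (BSide b1 b)]) f t = \int[mu]_(t in `[a, b]) f t.
  move=> i; have i0 : mu.-integrable [set` Interval (BSide b0 a) (BSide b1 b)] (EFin \o f).
    apply: integrableS i => //; apply: subset_itv; case: b0; case: b1 => //=; exact: lexx.
  have -> : \int[mu]_(t in [set` Interval (BSide b0 a) (BSide b1 b)]) f t = \int[mu]_(t in [set` Interval (BSide b0 a) (BRight b)]) f t.
    by case: b1 i0 => i0 //; rewrite Rintegral_itv_bndo_bndc.
  case: b0 {i0} => //; rewrite Rintegral_itv_obnd_cbnd//.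
  by apply: integrableS i => //; apply: subset_itv; rewrite ?bnd_simp.
by rewrite /cintegral !H.
Qed.

Lemma cint_chasles a b c F : a <= b -> b <= c -> cintg `[a, c] F ->
  cintegral `[a, c] F = cintegral `[a, b] F + cintegral `[b, c] F.
Proof.
move=> ab bc iF; have iab : cintg `[a, b] F.
  by apply: cintgS iF => //; apply: subset_itv; rewrite bnd_simp.
have ibc : cintg `[b, c] F.
  by apply: cintgS iF => //; apply: subset_itv; rewrite bnd_simp.
rewrite -(cint_itv false false ibc).
have e : `[a, c]%classic = `[a, b] `|` `]b, c] by rewrite -itv_bndbnd_setU// bnd_simp.
rewrite [in LHS]e; apply: cintU => //; first by rewrite -e.
by apply/disj_setPS => y [/=]; rewrite 2!in_itv/= => /andP[_ yx] /andP[by_ _]; move: yx; rewrite leNgt by_.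
Qed.
End ComplexIntegral.

(** * Affine changes of variable *)

Section LinearChange.
Context {R : realType}.
Local Notation C := R[i].
Local Notation Re := (@complex.Re R).
Local Notation Im := (@complex.Im R).
Local Notation mu := (@lebesgue_measure R).
Implicit Types (c d : R).

Let aff c d (x : R) : R := c * x + d.

Let maff c d : measurable_fun (T := measurableTypeR R) (U := measurableTypeR R) setT (aff c d).
Proof.
suff : measurable_fun setT (aff c d) by [].
by apply: measurable_funD => //; apply: measurable_funM.
Qed.

(** Uniqueness of Lebesgue measure: the pushforward of [mu] multiplied by $|c|$ agrees with [mu] on
    the half-open intervals. For negative $c$ the preimage is half-open on the other side, which
    does not change its length. *)
Lemma lebesgue_measure_preimage_affine c d (A : set R) : c != 0 -> measurable A ->
  mu A = (`|c|%:E * mu (aff c d @^-1` A))%E.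
Proof.
move=> c0 mA.
have cp : 0 <= `|c| by [].
pose pf : {measure set (measurableTypeR R) -> \bar R} := measure_function_pushforward__canonical__measure_function_Measure mu (maff c d).
pose nu : {measure set (measurableTypeR R) -> \bar R} := mscale (NngNum cp) pf.
have H : forall X, ocitv X -> mu X = nu X.
  move=> X [[a b] /= _ <-]; rewrite /nu /= /mscale/= /pushforward.
  have [cpos|cneg|c00] := ltgtP 0 c; last by rewrite c00 eqxx in c0.
    have -> : aff c d @^-1` `]a, b] = `](a - d) / c, (b - d) / c]%classic.
      by apply/seteqP; split => x /=; rewrite !in_itv/= /aff ltr_pdivrMr// ler_pdivlMr// ltrBlDr lerBrDr mulrC.
    rewrite !lebesgue_measure_itv/= !lte_fin ltr_pM2r ?invr_gt0// ltrD2r; case: ifPn => // _; last by rewrite mule0.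
    by rewrite -!EFinB -EFinM ger0_norm ?ltW//; congr EFin; field; rewrite gt_eqF.
  have -> : aff c d @^-1` `]a, b] = `[(b - d) / c, (a - d) / c[%classic.
    by apply/seteqP; split => x /=; rewrite !in_itv/= /aff ler_ndivrMr// ltr_ndivlMr// ltrBlDr lerBrDr mulrC andbC.
  rewrite !lebesgue_measure_itv/= !lte_fin ltr_nM2r ?invr_lt0// ltrD2r; case: ifPn => // _; last by rewrite mule0.
  by rewrite -!EFinB -EFinM ltr0_norm//; congr EFin; field; rewrite lt_eqF.
exact: (lebesgue_measure_unique H mA).
Qed.

Lemma ge0_integral_affine c d (f : R -> \bar R) : c != 0 -> measurable_fun setT f ->
  (forall x, 0 <= f x)%E -> (\int[mu]_x f (c * x + d)%R = (`|c|^-1)%:E * \int[mu]_x f x)%E.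
Proof.
move=> c0 mf f0.
have cp : 0 <= `|c| by [].
pose pf : {measure set (measurableTypeR R) -> \bar R} := measure_function_pushforward__canonical__measure_function_Measure mu (maff c d).
have -> : (\int[mu]_x f x = \int[mscale (NngNum cp) pf]_x f x)%E.
  by apply: eq_measure_integral => A mA _; exact: lebesgue_measure_preimage_affine.
rewrite ge0_integral_mscale// ge0_integral_pushforward// muleA -EFinM mulVf ?normr_eq0// mul1e.
by rewrite preimage_setT.
Qed.

Lemma integrable_affine c d (f : R -> \bar R) : c != 0 -> mu.-integrable setT f ->
  mu.-integrable setT (fun x => f (c * x + d)).
Proof.
move=> c0 /integrableP[mf fi]; apply/integrableP; split.
  exact: (measurableT_comp mf (maff c d)).
rewrite (@ge0_integral_affine c d (fun x => `|f x|%E))//; last exact: measurableT_comp.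
by rewrite lte_mul_pinfty// lee_fin invr_ge0.
Qed.

Lemma Rintegral_affine c d (f : R -> R) : c != 0 -> mu.-integrable setT (EFin \o f) ->
  \int[mu]_x f (c * x + d) = `|c|^-1 * \int[mu]_x f x.
Proof.
move=> c0 fi.
have H (g : R -> \bar R) : mu.-integrable setT g -> (\int[mu]_x g (c * x + d)%R = (`|c|^-1)%:E * \int[mu]_x g x)%E.
  move=> gi; rewrite integralE [in RHS]integralE.
  have -> : (fun x => g (c * x + d)%R) = g \o aff c d by [].
  rewrite (funepos_comp g) (funeneg_comp g).
  have mg := measurable_int _ gi.
  rewrite (@ge0_integral_affine c d (g^\+)%E)// ?(@ge0_integral_affine c d (g^\-)%E)//; last 2 first.
  - exact: measurable_funeneg.
  - exact: measurable_funepos.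
  rewrite [in RHS]muleBr//; apply: fin_num_adde_defl.
  by rewrite fin_numN; exact: integrable_neg_fin_num.
by rewrite /Rintegral (H (EFin \o f))// fineM//; exact: integrable_fin_num.
Qed.

Lemma cintg_affine c d (F : R -> C) : c != 0 -> cintg setT F -> cintg setT (fun x => F (c * x + d)).
Proof.
move=> c0 [i1 i2]; split.
  exact: (@integrable_affine c d (fun x => (Re (F x))%:E)).
exact: (@integrable_affine c d (fun x => (Im (F x))%:E)).
Qed.

Lemma cint_affine c d (F : R -> C) : c != 0 -> cintg setT F ->
  cintegral setT (fun x => F (c * x + d)) = (`|c|^-1)%:C%C * cintegral setT F.
Proof.
move=> c0 [i1 i2]; apply/eqP; rewrite eq_complex ReM ImM/= !mul0r subr0 addr0; apply/andP; split; apply/eqP.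
  exact: (@Rintegral_affine c d (fun x => Re (F x))).
exact: (@Rintegral_affine c d (fun x => Im (F x))).
Qed.

Lemma cint_affine_set c d (D : set R) (F : R -> C) : c != 0 -> measurable D -> cintg D F ->
  cintegral [set x | D (c * x + d)] (fun x => F (c * x + d)) = (`|c|^-1)%:C%C * cintegral D F.
Proof.
move=> c0 mD iF; rewrite cint_mkcond [in RHS]cint_mkcond.
rewrite -(@cint_affine c d (fun t => (\1_D t)%:C%C * F t))//; last exact: cintg_mkcond.
Qed.

Lemma cint_affine_itv c d a b (F : R -> C) : 0 < c -> cintg `[c * a + d, c * b + d] F ->
  cintegral `[a, b] (fun x => F (c * x + d)) = (c^-1)%:C%C * cintegral `[c * a + d, c * b + d] F.
Proof.
move=> c0 iF; have e : c^-1 = `|c|^-1 by rewrite gtr0_norm.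
rewrite e -(@cint_affine_set c d)// ?gt_eqF//; congr cintegral.
by apply/seteqP; split => x /=; rewrite !in_itv/= !lerD2r !ler_pM2l.
Qed.

Lemma cint_reflect d a b (F : R -> C) : cintg `[d - b, d - a] F ->
  cintegral `[a, b] (fun x => F (d - x)) = cintegral `[d - b, d - a] F.
Proof.
move=> iF; have := @cint_affine_set (-1) d _ F _ _ iF.
rewrite normrN1 invr1 mul1r => <- //.
have -> : [set x | `[d - b, d - a] (-1 * x + d)]%classic = `[a, b]%classic.
  by apply/seteqP; split => x /=; rewrite !in_itv/= mulN1r (addrC (- x)) !lerD2l !lerN2 andbC.
by apply: cint_eq => x _; rewrite mulN1r addrC.
Qed.
End LinearChange.

(** * Oscillatory integrals *)

Section Derivatives.
Context {R : realType}.
Implicit Types (f g u : R -> R) (x : R).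

Lemma is_derive_cont f x df : is_derive x (1 : R) f df -> {for x, continuous f}.
Proof. by move=> [d _]; exact/differentiable_continuous/derivable1_diffP. Qed.

Lemma der_mul f g x df dg : is_derive x (1 : R) f df -> is_derive x (1 : R) g dg ->
  is_derive x (1 : R) (fun y => f y * g y) (df * g x + f x * dg).
Proof.
move=> hf hg; apply: is_derive_eq.
by rewrite /GRing.scale/= addrC (mulrC (g x)).
Qed.

Lemma der_add f g x df dg : is_derive x (1 : R) f df -> is_derive x (1 : R) g dg ->
  is_derive x (1 : R) (fun y => f y + g y) (df + dg).
Proof. by move=> hf hg; exact: is_deriveD. Qed.

Lemma der_opp f x df : is_derive x (1 : R) f df -> is_derive x (1 : R) (fun y => - f y) (- df).
Proof. by move=> hf; exact: is_deriveN. Qed.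

Lemma der_cst k x : is_derive x (1 : R) (fun=> k : R) 0.
Proof. exact: is_derive_cst. Qed.

Lemma der_id x : is_derive x (1 : R) (fun y => y : R) 1.
Proof. exact: is_derive_id. Qed.

Lemma der_scale k f x df : is_derive x (1 : R) f df -> is_derive x (1 : R) (fun y => k * f y) (k * df).
Proof. by move=> hf; apply: is_derive_eq (der_mul (der_cst k x) hf) _; rewrite mul0r add0r. Qed.

Lemma der_comp f u x df du : is_derive (u x) (1 : R) f df -> is_derive x (1 : R) u du ->
  is_derive x (1 : R) (fun y => f (u y)) (df * du).
Proof. by move=> hf hu; exact: (@is_derive1_comp _ f u). Qed.

Lemma der_cos u x du : is_derive x (1 : R) u du -> is_derive x (1 : R) (fun y => cos (u y)) (- sin (u x) * du).
Proof. by move=> hu; apply: der_comp => //; exact: is_derive_cos. Qed.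

Lemma der_sin u x du : is_derive x (1 : R) u du -> is_derive x (1 : R) (fun y => sin (u y)) (cos (u x) * du).
Proof. by move=> hu; apply: der_comp => //; exact: is_derive_sin. Qed.

Lemma der_expR u x du : is_derive x (1 : R) u du -> is_derive x (1 : R) (fun y => expR (u y)) (expR (u x) * du).
Proof. by move=> hu; apply: der_comp => //; exact: is_derive_expR. Qed.

Lemma der_inv u x du : u x != 0 -> is_derive x (1 : R) u du ->
  is_derive x (1 : R) (fun y => (u y)^-1) (- (du / (u x) ^+ 2)).
Proof.
move=> u0 hu; apply: is_derive_eq.
by rewrite /GRing.scale/= mulNr mulrC.
Qed.

Lemma der_affine c d x : is_derive x (1 : R) (fun y => c * y + d) c.
Proof.
by apply: is_derive_eq (der_add (der_scale c (der_id x)) (der_cst d x)) _; rewrite mulr1 addr0.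
Qed.
End Derivatives.

(** * The fundamental theorem of calculus and a Cauchy criterion *)

Section FTC.
Context {R : realType}.
Local Notation mu := (@lebesgue_measure R).
Implicit Types (f g G : R -> R).

Lemma continuous_itv_within g a b : (forall x, a <= x <= b -> {for x, continuous g}) ->
  {within `[a, b], continuous g}.
Proof.
move=> cg; apply: continuous_in_subspaceT => x; rewrite inE/= in_itv/= => xab.
exact: cg.
Qed.

Lemma Rint_FTC G g (a b : R) : a <= b -> (forall x, a <= x <= b -> is_derive x (1 : R) G (g x)) ->
  (forall x, a <= x <= b -> {for x, continuous g}) ->
  \int[mu]_(x in `[a, b]) g x = G b - G a.
Proof.
rewrite le_eqVlt => /predU1P[<- _ _|ab dG cg].
  by rewrite set_itv1 Rintegral_set1 subrr.
rewrite /Rintegral (@continuous_FTC2 _ _ G)//.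
- exact: continuous_itv_within.
- split.
  + by move=> x; rewrite in_itv/= => /andP[/ltW ax /ltW xb]; case: (dG x _) => //; rewrite ax.
  + by apply: cvg_at_right_filter; apply: is_derive_cont; apply: dG; rewrite lexx ltW.
  + by apply: cvg_at_left_filter; apply: is_derive_cont; apply: dG; rewrite lexx ltW.
- move=> x; rewrite in_itv/= => /andP[/ltW ax /ltW xb].
  by rewrite derive1E; apply: derive_val; apply: dG; rewrite ax.
Qed.

Lemma integrable_cont_itv g (a b : R) : (forall x, a <= x <= b -> {for x, continuous g}) ->
  mu.-integrable `[a, b] (EFin \o g).
Proof.
move=> cg; apply: continuous_compact_integrable; first exact: segment_compact.
exact: continuous_itv_within.
Qed.

Lemma le_Rint_itv f k (a b : R) : mu.-integrable `[a, b] (EFin \o f) -> mu.-integrable `[a, b] (EFin \o k) ->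
  (forall x, a <= x <= b -> `|f x| <= k x) ->
  `|\int[mu]_(x in `[a, b]) f x| <= \int[mu]_(x in `[a, b]) k x.
Proof.
move=> fi ki fk; apply: (le_trans (le_normr_Rintegral _ fi)) => //.
apply: le_Rintegral => //; first exact: (integrable_norm fi).
Qed.

Lemma Rint_chasles f (a b c : R) : a <= b -> b <= c -> mu.-integrable `[a, c] (EFin \o f) ->
  \int[mu]_(x in `[a, c]) f x = \int[mu]_(x in `[a, b]) f x + \int[mu]_(x in `[b, c]) f x.
Proof.
move=> ab bc fi; have i0 : mu.-integrable `[a, c] (EFin \o (fun=> 0 : R)).
  by apply: integrable_cst_itv => //; exact: subset_refl.
have := @cint_chasles R a b c (fun t => (f t)%:C%C) ab bc (conj fi i0).
by move=> [].
Qed.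

Lemma Rint_cst_itv (a b r : R) : a <= b -> \int[mu]_(x in `[a, b]) r = r * (b - a).
Proof.
move=> ab; rewrite mulrBr; apply: (@Rint_FTC (fun x => r * x) (fun=> r)) => // x _.
  by apply: is_derive_eq (der_scale r (der_id x)) _; rewrite mulr1.
exact: is_derive_cont (der_cst r x).
Qed.

(** Cauchy criterion at $0^+$ with a modulus linear in the larger parameter. All principal values
    here converge at this rate; the lemma certifies that the total operator [lim] inside [clim0]
    returns a genuine limit. *)
Lemma cvg0_cauchy f (C s : R) : 0 < s ->
  (forall e e', 0 < e -> e <= e' -> e' < s -> `|f e - f e'| <= C * e') ->
  cvg (f e @[e --> 0^'+]).
Proof.
move=> s0 H; apply: cauchy_cvg; apply: cauchy_exP => eps eps0.
pose D := `|C| + 1; have D0 : 0 < D by rewrite /D ltr_wpDl.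
pose e0 := Num.min (s / 2) (eps / 2 / D).
have e00 : 0 < e0 by rewrite /e0 lt_min !divr_gt0.
have e0s : e0 < s by rewrite /e0 gt_min; apply/orP; left; lra.
exists (f e0); rewrite /= /nbhs/=.
near=> e.
rewrite /ball/= distrC.
have ee : e <= e0 by near: e; apply: nbhs_right_le.
apply: (le_lt_trans (H _ _ _ ee e0s)); first by near: e; exact: nbhs_right_gt.
apply: (@le_lt_trans _ _ (D * e0)); first by rewrite ler_pM2r// /D (le_trans (ler_norm _))// lerDl.
apply: (@le_lt_trans _ _ (D * (eps / 2 / D))); first by rewrite ler_pM2l// /e0 ge_min lexx orbT.
rewrite mulrC divfK ?gt_eqF//; lra.
Unshelve. all: by end_near.
Qed.

End FTC.

(** * Integrals of quadratic phases against $dt/t$, uniformly in the coefficients *)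

Section OscillatoryIntegral.
Context {R : realType}.
Local Notation mu := (@lebesgue_measure R).
Variables (xi eta th : R).

(** The offset [th] lets one cosine integral serve for both components of $e^{i(\xi t+\eta t^2)}$:
    [th] $= -\pi/2$ turns the cosine into the sine. *)
Let ph t := xi * t + eta * t ^+ 2 + th.
Let p t := xi + 2 * eta * t.

Let dph t : is_derive t (1 : R) ph (p t).
Proof.
apply: is_derive_eq.
rewrite /p /GRing.scale/=; ring.
Qed.

Let dp t : is_derive t (1 : R) p (2 * eta).
Proof.
apply: is_derive_eq (der_add (der_cst xi t) (der_scale (2 * eta) (der_id t))) _.
by rewrite mulr1 add0r.
Qed.

Let dtp t : is_derive t (1 : R) (fun t => t * p t) (p t + 2 * eta * t).
Proof. by apply: is_derive_eq (der_mul (der_id t) (dp t)) _; ring. Qed.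

Let integrable_osc a b : 0 < a -> mu.-integrable `[a, b] (EFin \o (fun t => cos (ph t) / t)).
Proof.
move=> a0; apply: integrable_cont_itv => x /andP[ax _].
have x0 : x != 0 by rewrite gt_eqF// (lt_le_trans a0).
exact: is_derive_cont (der_mul (der_cos (dph x)) (der_inv x0 (der_id x))).
Qed.

(** Integration by parts with $\cos(ph)/t = (\sin ph)' g$ and $g = 1/(t p)$. The first hypothesis
    gives $|g| \le 2/(m t)$ for the boundary terms. The second gives $|p + 2\eta t| \le 3|p|$, hence
    $|g'| \le 3/(t^2 |p|) \le 6/(m t^2)$, whose integral is $6/(m a) - 6/(m b)$. The sum is at most
    $(2 + 6)/(m a)$. *)
Lemma oscillatory_bound m a b : 0 < m -> 0 < a -> a <= b ->
  (forall t, a <= t <= b -> m <= 2 * `|xi + 2 * eta * t| /\ `|eta| * t <= `|xi + 2 * eta * t|) ->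
  `|\int[mu]_(t in `[a, b]) (cos (xi * t + eta * t ^+ 2 + th) / t)| <= 8 / (m * a).
Proof.
move=> m0 a0 ab H; rewrite -/ph.
have t0 t : a <= t <= b -> 0 < t by move=> /andP[at_ _]; exact: lt_le_trans at_.
have p0 t : a <= t <= b -> 0 < `|p t|.
  by move=> /H[H1 _]; rewrite -(pmulr_rgt0 _ (ltr0n _ 2)); exact: lt_le_trans H1.
have tp0 t : a <= t <= b -> t * p t != 0.
  by move=> tab; apply: mulf_neq0; [rewrite gt_eqF// t0|rewrite -normr_gt0 p0].
pose g t := (t * p t)^-1.
pose g' t := - ((p t + 2 * eta * t) / (t * p t) ^+ 2).
have dg t : a <= t <= b -> is_derive t (1 : R) g (g' t).
  by move=> tab; apply: der_inv (dtp t); exact: tp0.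
pose G t := sin (ph t) * g t.
have dG t : a <= t <= b -> is_derive t (1 : R) G (cos (ph t) / t + sin (ph t) * g' t).
  move=> tab; apply: is_derive_eq (der_mul (der_sin (dph t)) (dg t tab)) _.
  by congr (_ + _); rewrite -mulrA /g invfM [X in _ * X]mulrCA divff ?mulr1// -normr_gt0 p0.
have cg' t : a <= t <= b -> {for t, continuous (fun t => sin (ph t) * g' t)}.
  move=> tab; have n0 : (t * p t) * (t * p t) != 0 by rewrite mulf_neq0// tp0.
  have d1 := der_add (dp t) (der_scale (2 * eta) (der_id t)).
  have d2 := @der_inv _ (fun t => (t * p t) * (t * p t)) t _ n0 (der_mul (dtp t) (dtp t)).
  exact: is_derive_cont (der_mul (der_sin (dph t)) (der_opp (der_mul d1 d2))).
have := @Rint_FTC R G _ a b ab dG.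
have i1 := integrable_osc b a0.
have i2 := integrable_cont_itv cg'.
have -> : \int[mu]_(x in `[a, b]) (cos (ph x) / x + sin (ph x) * g' x) =
  \int[mu]_(x in `[a, b]) (cos (ph x) / x) + \int[mu]_(x in `[a, b]) (sin (ph x) * g' x).
  exact: RintegralD.
move=> /(_ _)/(canRL (addrK _)) ->; last first.
  move=> x xab; have x0 : x != 0 by rewrite gt_eqF// t0.
  apply: continuousD; last exact: cg'.
  exact: is_derive_cont (der_mul (der_cos (dph x)) (der_inv x0 (der_id x))).
have gle t : a <= t <= b -> `|G t| <= 2 / m * t^-1.
  move=> tab; rewrite normrM; apply: (@le_trans _ _ (1 * `|g t|)).
    by rewrite ler_wpM2r// ler_norml sin_geN1 sin_le1.
  rewrite mul1r /g normfV normrM (gtr0_norm (t0 _ tab)) invfM mulrC.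
  apply: ler_wpM2r; first by rewrite invr_ge0 ltW// t0.
  rewrite ler_pdivlMr// ler_pdivrMl ?p0// mulrC.
  by have [] := H _ tab.
have dinv t : a <= t <= b -> is_derive t (1 : R) (fun t => - (6 / m * t^-1)) (6 / m * (t ^+ 2)^-1).
  move=> tab; have x0 : t != 0 by rewrite gt_eqF// t0.
  by apply: is_derive_eq (der_opp (der_scale (6 / m) (der_inv x0 (der_id t)))) _; rewrite mulrN opprK mul1r.
have cinv t : a <= t <= b -> {for t, continuous (fun t : R => 6 / m * (t ^+ 2)^-1)}.
  move=> tab; have x0 : t != 0 by rewrite gt_eqF// t0.
  have n0 : t * t != 0 by rewrite mulf_neq0.
  exact: is_derive_cont (der_scale (6 / m) (@der_inv _ (fun t => t * t) t _ n0 (der_mul (der_id t) (der_id t)))).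
have B : `|\int[mu]_(x in `[a, b]) (sin (ph x) * g' x)| <= 6 / m * a^-1 - 6 / m * b^-1.
  have -> : 6 / m * a^-1 - 6 / m * b^-1 = \int[mu]_(x in `[a, b]) (6 / m * (x ^+ 2)^-1).
    by rewrite (@Rint_FTC _ (fun t => - (6 / m * t^-1)))//; ring.
  apply: le_Rint_itv => //; first exact: integrable_cont_itv.
  move=> t tab; rewrite normrM; apply: (@le_trans _ _ (1 * `|g' t|)).
    by rewrite ler_wpM2r// ler_norml sin_geN1 sin_le1.
  have [H1 H2] := H _ tab; have pt := p0 _ tab; have tt := t0 _ tab.
  rewrite mul1r /g' normrN normrM normfV normrX normrM (gtr0_norm tt) exprMn invfM.
  rewrite [X in _ * X]mulrC mulrA.
  apply: ler_wpM2r; first by rewrite invr_ge0 exprn_ge0 // ltW.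
  rewrite ler_pdivrMr ?exprn_gt0// [leRHS]mulrAC ler_pdivlMr//.
  apply: (@le_trans _ _ (3 * `|p t| * m)).
    rewrite ler_pM2r//; apply: (le_trans (ler_normD _ _)).
    by rewrite !normrM (gtr0_norm tt) ger0_norm// -mulrA; rewrite -/(p t) in H2; lra.
  by rewrite -/(p t) in H1; rewrite expr2; nra.
have aab : a <= a <= b by rewrite lexx.
have bab : a <= b <= b by rewrite lexx andbT.
have b0 : 0 <= b^-1 by rewrite invr_ge0 ltW// t0.
have ga := gle a aab; have gb := gle b bab.
apply: (le_trans (ler_normB _ _)).
apply: (le_trans (lerD (ler_normB _ _) B)).
apply: (le_trans (lerD (lerD gb ga) (lexx _))).
have -> : 8 / (m * a) = 2 / m * a^-1 + 6 / m * a^-1 by field; rewrite !gt_eqF.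
have : 0 <= m^-1 * b^-1 by rewrite mulr_ge0// invr_ge0 ltW.
have -> : 2 / m * b^-1 = 2 * (m^-1 * b^-1) by ring.
have -> : 6 / m * b^-1 = 6 * (m^-1 * b^-1) by ring.
move: (2 / m * a^-1) (6 / m * a^-1) (m^-1 * b^-1) => X Y Z; lra.
Qed.

Let J a b := \int[mu]_(t in `[a, b]) (cos (ph t) / t).

Let J_split s K1 K2 A : 0 < A -> 0 <= K1 -> 0 <= K2 ->
  (forall a b, A <= a -> a <= b -> b <= s -> `|J a b| <= K1) ->
  (forall a b, A <= a -> a <= b -> s <= a -> `|J a b| <= K2) ->
  forall a b, A <= a -> a <= b -> `|J a b| <= K1 + K2.
Proof.
move=> A0 K10 K20 H1 H2 a b Aa ab.
have [bs|sb] := leP b s; first by rewrite (le_trans (H1 _ _ Aa ab bs))// lerDl.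
have [as_|sa] := leP a s; last by rewrite (le_trans (H2 _ _ Aa ab (ltW sa)))// lerDr.
have -> : J a b = J a s + J s b.
  by apply: Rint_chasles => //; [exact: ltW|apply: integrable_osc; exact: lt_le_trans Aa].
rewrite (le_trans (ler_normD _ _))// lerD//; first exact: H1.
by apply: H2 => //; [exact: le_trans as_|exact: ltW].
Qed.

(** The phase can be stationary only at $t = ts/2$ with $ts = |\xi|/|\eta|$. For $t \le ts/4$ and
    for $t \ge ts$ the hypotheses of [oscillatory_bound] hold with $m = |\xi|$, and $m a \ge 1$
    gives 8 for each side. On $[ts/4, ts]$ no cancellation is used: the measure $dt/t$ is at most
    length over left end, which is 3. This explains $19 = 8 + 3 + 8$. *)
Lemma oscillatory_uniform a b : xi != 0 -> `|xi|^-1 <= a -> a <= b ->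
  `|\int[mu]_(t in `[a, b]) (cos (xi * t + eta * t ^+ 2 + th) / t)| <= 19.
Proof.
move=> xi0 xa ab; rewrite -/ph -/(J a b).
have x0 : 0 < `|xi| by rewrite normr_gt0.
have A0 : 0 < `|xi|^-1 by rewrite invr_gt0.
have outer a' b' : `|xi|^-1 <= a' -> a' <= b' ->
    (forall t, a' <= t <= b' -> `|xi| <= 2 * `|p t| /\ `|eta| * t <= `|p t|) -> `|J a' b'| <= 8.
  move=> Aa ab' H; apply: le_trans (oscillatory_bound x0 _ ab' H) _; first exact: lt_le_trans Aa.
  rewrite ler_pdivrMr ?mulr_gt0//; last exact: lt_le_trans Aa.
  by rewrite ler_peMr// -ler_pdivrMl// mulr1.
have [e0|e0] := eqVneq eta 0.
  apply: (@le_trans _ _ 8); last by lra.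
  apply: outer => // t _; rewrite /p e0 normr0 mulr0 !mul0r addr0; split => //; lra.
have en : 0 < `|eta| by rewrite normr_gt0.
pose ts := `|xi| / `|eta|.
have tsE : `|eta| * ts = `|xi| by rewrite /ts mulrC divfK ?gt_eqF.
have ts0 : 0 < ts by rewrite /ts divr_gt0.
have low t : `|xi| - 2 * `|eta| * `|t| <= `|p t|.
  have := lerB_normD xi (2 * eta * t); rewrite !normrM (ger0_norm (ltW _))//.
have upp t : 2 * `|eta| * `|t| - `|xi| <= `|p t|.
  have := lerB_normD (2 * eta * t) xi; rewrite !normrM (ger0_norm (ltW _))// addrC.
  by rewrite [X in _ <= `|X| -> _]addrC.
have -> : (19 : R) = 8 + (3 + 8) by ring.
apply: (@J_split (ts / 4) 8 (3 + 8) `|xi|^-1) => //.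
  move=> a' b' Aa ab' bs; apply: outer => // t /andP[at_ tb].
  have tp : 0 < t by rewrite (lt_le_trans A0)// (le_trans Aa).
  have := low t; rewrite (gtr0_norm tp) -tsE; have : `|eta| * t <= `|eta| * (ts / 4) by rewrite ler_pM2l//; lra.
  have u0 : 0 < `|eta| * t by rewrite mulr_gt0.
  have u0' : 0 < `|eta| * ts by rewrite mulr_gt0.
  rewrite (mulrA _ ts) -(mulrA 2); move: (`|eta| * t) (`|eta| * ts) u0 u0' => u u' ? ? h1 h2; split; lra.
move=> a1 b1 Aa1 ab1 sa1.
have H := @J_split ts 3 8 (Num.max `|xi|^-1 (ts / 4)) _ _ _ _ _ a1 b1 _ ab1.
apply: H => //.
- by rewrite lt_max A0.
- move=> a' b'; rewrite ge_max => /andP[Aa ta] ab' bs.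
  have a0 : 0 < a' by exact: lt_le_trans Aa.
  rewrite /J; apply: (@le_trans _ _ (\int[mu]_(t in `[a', b']) (a'^-1))).
    apply: le_Rint_itv => //; first exact: integrable_osc.
      by apply: integrable_cst_itv => //; exact: subset_refl.
    move=> t /andP[at_ _]; have tp : 0 < t by exact: lt_le_trans at_.
    rewrite normrM normfV (gtr0_norm tp) -[leRHS]mul1r; apply: ler_pM => //.
    - by rewrite invr_ge0 ltW.
    - by rewrite ler_norml cos_geN1 cos_le1.
    - by rewrite lef_pV2.
  rewrite Rint_cst_itv//.
  by rewrite ler_pdivrMl//; lra.
- move=> a' b'; rewrite ge_max => /andP[Aa ta] ab' sa; apply: outer => // t /andP[at_ tb].
  have tp : 0 < t by rewrite (lt_le_trans A0)// (le_trans Aa).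
  have := upp t; rewrite (gtr0_norm tp) -tsE; have : `|eta| * ts <= `|eta| * t by rewrite ler_pM2l//; lra.
  have u0 : 0 < `|eta| * t by rewrite mulr_gt0.
  have u0' : 0 < `|eta| * ts by rewrite mulr_gt0.
  rewrite -(mulrA 2); move: (`|eta| * t) (`|eta| * ts) u0 u0' => u u' ? ? h1 h2; split; lra.
- by rewrite ge_max Aa1.
Qed.
End OscillatoryIntegral.

(** * Fourier inversion *)

Section Weight.
Context {R : realType}.
Local Notation mu := (@lebesgue_measure R).
Implicit Types (f g : R -> R).

(** This weight, of total mass $\pi$, is the common integrable majorant: for the test functions and
    their Fourier transforms, for the tails of the kernels, and for the error kernel of the
    quadratic substitution. *)
Definition wgt (x : R) : R := (1 + x ^+ 2)^-1.

Lemma wgt_gt0 x : 0 < wgt x.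
Proof. by rewrite invr_gt0 ltr_wpDr// sqr_ge0. Qed.

Lemma wgt_ge0 x : 0 <= wgt x.
Proof. exact/ltW/wgt_gt0. Qed.

Lemma wgt_le1 x : wgt x <= 1.
Proof. by rewrite invf_le1 ?lerDl ?sqr_ge0// ltr_wpDr// sqr_ge0. Qed.

Lemma wgt_continuous : continuous wgt.
Proof. exact: continuous_oneDsqrV. Qed.

Lemma measurable_wgt : measurable_fun setT wgt.
Proof. exact: continuous_measurable_fun wgt_continuous. Qed.

Lemma integral_wgt : (\int[mu]_x (wgt x)%:E = pi%:E)%E.
Proof.
rewrite ge0_symfun_integralT.
- have -> : [set x : R | 0 <= x] = `[0, +oo[%classic.
    by apply/seteqP; split => x /=; rewrite in_itv/= andbT.
  rewrite -[wgt]/(fun x : R => (oneDsqr x)^-1) integral0y_oneDsqr -EFinM; congr EFin.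
  by field.
- exact: wgt_ge0.
- exact: wgt_continuous.
- by move=> x; rewrite /wgt /= sqrrN.
Qed.

Lemma integrable_wgt : mu.-integrable setT (EFin \o wgt).
Proof.
apply/integrableP; split; first by apply/measurable_EFinP; exact: measurable_wgt.
under eq_integral do rewrite /= ger0_norm ?wgt_ge0//.
by rewrite integral_wgt ltry.
Qed.

Lemma Rintegral_wgt : \int[mu]_x wgt x = pi.
Proof. by rewrite /Rintegral integral_wgt. Qed.

Lemma integrable_Zwgt k : mu.-integrable setT (EFin \o (fun x => k * wgt x)).
Proof.
rewrite /comp; under eq_fun do rewrite EFinM.
by apply: integrableZl => //; exact: integrable_wgt.
Qed.

Lemma Rintegral_Zwgt k : \int[mu]_x (k * wgt x) = k * pi.
Proof. by rewrite RintegralZl ?Rintegral_wgt//; exact: integrable_wgt. Qed.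

Lemma integrable_decay f k : measurable_fun setT f -> (forall x, `|f x| <= k * wgt x) ->
  mu.-integrable setT (EFin \o f).
Proof.
move=> mf fk; apply: le_integrable (integrable_Zwgt k) => //.
  exact/measurable_EFinP.
by move=> x _; rewrite /= lee_fin (le_trans (fk x))// ler_norm.
Qed.

Lemma Rint_decay f k : measurable_fun setT f -> (forall x, `|f x| <= k * wgt x) ->
  `|\int[mu]_x f x| <= k * pi.
Proof.
move=> mf fk; have fi := integrable_decay mf fk.
apply: (le_trans (le_normr_Rintegral _ fi)) => //.
rewrite -Rintegral_Zwgt; apply: le_Rintegral => //.
- exact: (integrable_norm fi).
- exact: integrable_Zwgt.
Qed.

Lemma Rdominated (F_ : nat -> R -> R) (F k : R -> R) :
  (forall n, measurable_fun setT (F_ n)) -> measurable_fun setT F ->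
  (forall x, F_ n x @[n --> \oo] --> F x) -> (forall n x, `|F_ n x| <= k x) ->
  mu.-integrable setT (EFin \o k) ->
  \int[mu]_x F_ n x @[n --> \oo] --> \int[mu]_x F x.
Proof.
move=> mF_ mF FF Fk ik.
have [] := @dominated_convergence _ _ _ mu setT measurableT (fun n => EFin \o F_ n) (EFin \o F) (EFin \o k).
- by move=> n; apply/measurable_EFinP; exact: mF_.
- by apply/measurable_EFinP; exact: mF.
- by apply: aeW => x _; apply: cvg_EFin; [exact: nearW|exact: FF].
- exact: ik.
- by apply: aeW => x n _; rewrite /= lee_fin.
move=> iF _ cF; apply: fine_cvg.
by rewrite fineK//; exact: integrable_fin_num.
Qed.

Lemma cvg_Rint_sym f : measurable_fun setT f -> mu.-integrable setT (EFin \o f) ->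
  \int[mu]_(x in `[- n%:R, n%:R]) f x @[n --> \oo] --> \int[mu]_x f x.
Proof.
move=> mf fi.
have -> : (fun n : nat => \int[mu]_(x in `[- n%:R, n%:R]) f x) =
    (fun n : nat => \int[mu]_x (f \_ `[- n%:R, n%:R]) x).
  by apply/funext => n; rewrite Rintegral_mkcond.
apply: (@Rdominated _ _ (fun x => `|f x|)) => //.
- move=> n; apply/(measurable_restrictT _ _).1 => //; exact: measurable_funTS.
- move=> x; apply: cvg_near_cst; near=> n.
  rewrite patchE mem_set//= in_itv/= -ler_norml.
  by near: n; exact: nbhs_infty_ger.
- by move=> n x; rewrite patchE; case: ifPn => _ //=; rewrite normr0.
- exact: (integrable_norm fi).
Unshelve. all: by end_near.
Qed.

Lemma cvgn_inv_bound (u : nat -> R) l K : (forall n, `|u n - l| <= K * n.+1%:R^-1) -> u n @[n --> \oo] --> l.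
Proof.
move=> H; apply/cvgrPdist_le => eps eps0.
have : K * harmonic n @[n --> \oo] --> K * 0 by apply: cvgM; [exact: cvg_cst|exact: cvg_harmonic].
rewrite mulr0 => /cvgrPdist_le/(_ _ eps0); apply: filterS => n.
by rewrite sub0r normrN distrC => /(le_trans (ler_norm _)); exact: le_trans (H n).
Qed.

(** The integral over $[-n, n]$ is $G(n) - G(-n)$, at most $2K/(1+n^2)$, and $n \le n^2$ for a
    natural number brings this to the rate $1/(n+1)$ of [cvgn_inv_bound]. *)
Lemma Rint_derive0 (G g : R -> R) K : (forall x, is_derive x (1 : R) G (g x)) -> continuous g ->
  (forall x, `|g x| <= K * wgt x) -> (forall x, `|G x| <= K * wgt x) -> \int[mu]_x g x = 0.
Proof.
move=> dG cg gK GK.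
have mg : measurable_fun setT g by exact: continuous_measurable_fun.
have gi := integrable_decay mg gK.
have K0 : 0 <= K.
  by have := GK 0; rewrite /wgt expr0n/= addr0 invr1 mulr1; exact: le_trans.
apply: (cvg_unique _ (cvg_Rint_sym mg gi)) => //.
apply: (@cvgn_inv_bound _ _ (2 * K)) => n.
have n0 : (- n%:R : R) <= n%:R by rewrite (@le_trans _ _ 0)// oppr_le0.
rewrite (Rint_FTC n0 (fun x _ => dG x)) => [|x _]; last exact: cg.
rewrite subr0 (le_trans (ler_normB _ _))//.
have W x : `|x| = n%:R -> `|G x| <= K * n.+1%:R^-1.
  move=> xn; apply: (le_trans (GK x)); apply: ler_wpM2l => //.
  rewrite /wgt lef_pV2 ?posrE ?ltr0n ?ltr_wpDr ?sqr_ge0// -[x ^+ 2]real_normK ?num_real// xn.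
  rewrite -natr1 addrC lerD2l -natrX ler_nat; case: n {n0 xn} => // n.
  by rewrite -{1}(expn1 n.+1); exact: leq_pexp2l.
have -> : 2 * K / n.+1%:R = K * n.+1%:R^-1 + K * n.+1%:R^-1 by ring.
by rewrite lerD// W// ?normrN normr_nat.
Qed.

Lemma norm_cos_le1 (x : R) : `|cos x| <= 1.
Proof. by rewrite ler_norml cos_geN1 cos_le1. Qed.

Lemma norm_sin_le1 (x : R) : `|sin x| <= 1.
Proof. by rewrite ler_norml sin_geN1 sin_le1. Qed.

Lemma integrable_exp_abs d : 0 < d -> mu.-integrable setT (EFin \o (fun x => expR (- (d * `|x|)))).
Proof.
move=> d0; apply: (@integrable_decay _ (1 + 2 / d ^+ 2)).
  apply: (@measurable_pair_comp _ _ _ expR (fun x : R => - (d * `|x|))); first exact: continuous_expR.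
  by apply: measurable_funN; apply: measurable_funM => //; exact: normr_measurable.
move=> x; rewrite ger0_norm ?expR_ge0// expRN /wgt.
have y0 : 0 <= d * `|x| by rewrite mulr_ge0// ltW.
(* The inequality $1 + y^2/2 \le e^y$ at $y = d|x|$; it is the origin of the constant $1 +
   2/d^2$. *)
have := expR_ge1Dxn 1 y0; rewrite exprMn real_normK ?num_real// -[2`!]/2%N.
have x20 := sqr_ge0 x; move: (x ^+ 2) x20 => X X0 h.
have d20 : 0 < d ^+ 2 by rewrite exprn_gt0.
rewrite ler_pdivlMr ?ltr_wpDr// ler_pdivrMl ?expR_gt0//.
apply: le_trans (ler_wpM2r _ h); last by rewrite addr_ge0// divr_ge0// ltW.
have -> : (1 + d ^+ 2 * X / 2) * (1 + 2 / d ^+ 2) = 1 + X + 2 / d ^+ 2 + d ^+ 2 * X / 2.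
  by field; rewrite gt_eqF.
by rewrite -addrA lerDl addr_ge0 ?divr_ge0 ?mulr_ge0// ltW.
Qed.

Lemma Rint_odd f : mu.-integrable setT (EFin \o f) -> (forall x, f (- x) = - f x) -> \int[mu]_x f x = 0.
Proof.
move=> fi fo; have := @Rintegral_affine R (-1) 0 f _ fi.
rewrite normrN1 invr1 mul1r => H.
have : \int[mu]_x f (-1 * x + 0) = - (\int[mu]_x f x).
  have -> : - (\int[mu]_x f x) = -1 * (\int[mu]_x f x) by rewrite mulN1r.
  rewrite -RintegralZl//; apply: eq_Rintegral => x _.
  by rewrite mulN1r addr0 fo mulN1r.
by rewrite H; [move=> h; lra|rewrite oppr_eq0 oner_eq0].
Qed.

Lemma Rint_exp_cos d c : 0 < d -> \int[mu]_x (expR (- (d * `|x|)) * cos (c * x)) = 2 * d / (d ^+ 2 + c ^+ 2).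
Proof.
move=> d0; pose D := d ^+ 2 + c ^+ 2.
have D0 : 0 < D by rewrite ltr_wpDr ?sqr_ge0// exprn_gt0.
have mf : measurable_fun setT (fun x : R => expR (- (d * `|x|)) * cos (c * x)).
  apply: measurable_funM.
    apply: (@measurable_pair_comp _ _ _ expR (fun x : R => - (d * `|x|))); first exact: continuous_expR.
    by apply: measurable_funN; apply: measurable_funM => //; exact: normr_measurable.
  by apply: (@measurable_pair_comp _ _ _ cos (fun x : R => c * x)); [exact: continuous_cos|exact: measurable_funM].
have fi : mu.-integrable setT (EFin \o (fun x : R => expR (- (d * `|x|)) * cos (c * x))).
  apply: le_integrable (integrable_exp_abs d0) => //; first exact/measurable_EFinP.
  move=> x _; rewrite /= lee_fin normrM ler_piMr// ler_norml cos_geN1 cos_le1//.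
apply: (cvg_unique _ (cvg_Rint_sym mf fi)) => //.
apply: (@cvgn_inv_bound _ _ (2 * (d + `|c|) / D * (1 + d^-1))) => n.
(* Explicit primitives of $e^{-dx}\cos(cx)$ and $e^{dx}\cos(cx)$, for the two half-lines; the terms
   [+ 0] give the arguments the shape of [der_affine]. *)
pose Gp x := expR (- d * x + 0) * (- d * cos (c * x + 0) + c * sin (c * x + 0)) / D.
pose Gm x := expR (d * x + 0) * (d * cos (c * x + 0) + c * sin (c * x + 0)) / D.
have dGp x : is_derive x (1 : R) Gp (expR (- d * x + 0) * cos (c * x + 0)).
  apply: is_derive_eq (der_mul (der_mul (der_expR (der_affine (- d) 0 x)) (der_add (der_scale (- d) (der_cos (der_affine c 0 x))) (der_scale c (der_sin (der_affine c 0 x))))) (der_cst D^-1 x)) _.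
  by rewrite /D; field; rewrite -/D gt_eqF.
have dGm x : is_derive x (1 : R) Gm (expR (d * x + 0) * cos (c * x + 0)).
  apply: is_derive_eq (der_mul (der_mul (der_expR (der_affine d 0 x)) (der_add (der_scale d (der_cos (der_affine c 0 x))) (der_scale c (der_sin (der_affine c 0 x))))) (der_cst D^-1 x)) _.
  by rewrite /D; field; rewrite -/D gt_eqF.
have cp x : {for x, continuous (fun x => expR (- d * x + 0) * cos (c * x + 0))}.
  exact: is_derive_cont (der_mul (der_expR (der_affine (- d) 0 x)) (der_cos (der_affine c 0 x))).
have cm x : {for x, continuous (fun x => expR (d * x + 0) * cos (c * x + 0))}.
  exact: is_derive_cont (der_mul (der_expR (der_affine d 0 x)) (der_cos (der_affine c 0 x))).
have n0 : (0 : R) <= n%:R by [].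
have n0' : (- n%:R : R) <= 0 by rewrite oppr_le0.
rewrite (@Rint_chasles _ _ _ 0)//; last by apply: integrableS fi.
have -> : \int[mu]_(x in `[- n%:R, 0]) (expR (- (d * `|x|)) * cos (c * x)) = Gm 0 - Gm (- n%:R).
  rewrite -(Rint_FTC n0' (fun x _ => dGm x) (fun x _ => cm x)).
  apply: eq_Rintegral => x; rewrite inE/= in_itv/= => /andP[_ x0].
  by rewrite !addr0 ler0_norm// mulrN opprK.
have -> : \int[mu]_(x in `[0, n%:R]) (expR (- (d * `|x|)) * cos (c * x)) = Gp n%:R - Gp 0.
  rewrite -(Rint_FTC n0 (fun x _ => dGp x) (fun x _ => cp x)).
  apply: eq_Rintegral => x; rewrite inE/= in_itv/= => /andP[x0 _].
  by rewrite !addr0 ger0_norm// mulNr.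
have -> : Gm 0 - Gm (- n%:R) + (Gp n%:R - Gp 0) - 2 * d / (d ^+ 2 + c ^+ 2) = Gp n%:R - Gm (- n%:R).
  by rewrite /Gp /Gm !mulr0 !addr0 expR0 cos0 sin0 -/D; ring.
have en : expR (- (d * n%:R)) <= (1 + d^-1) * n.+1%:R^-1.
  rewrite expRN -lef_pV2 ?posrE ?invr_gt0 ?expR_gt0 ?mulr_gt0 ?invr_gt0 ?addr_gt0 ?invr_gt0//.
  rewrite invrK; apply: le_trans (expR_ge1Dx _); rewrite invfM invrK.
  rewrite ler_pdivrMl ?addr_gt0 ?invr_gt0//.
  have -> : (1 + d^-1) * (1 + d * n%:R) = 1 + n%:R + d * n%:R + d^-1 by field; rewrite gt_eqF.
  by rewrite -natr1 [leLHS]addrC -addrA lerDl addr_ge0 ?invr_ge0 ?mulr_ge0// ltW.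
have B a y z : `|a| = d -> `|expR (- (d * n%:R)) * (a * cos y + c * sin z) / D| <= (1 + d^-1) * n.+1%:R^-1 * ((d + `|c|) / D).
  move=> ad; rewrite -mulrA normrM [X in X * _]ger0_norm ?expR_ge0//; apply: ler_pM => //.
  rewrite normrM normfV (gtr0_norm D0) ler_pM2r ?invr_gt0// (le_trans (ler_normD _ _))// !normrM ad.
  by apply: lerD; apply: ler_piMr => //; [exact: ltW|exact: norm_cos_le1|exact: norm_sin_le1].
have {}B1 : `|Gp n%:R| <= (1 + d^-1) * n.+1%:R^-1 * ((d + `|c|) / D).
  by rewrite /Gp addr0 mulNr; apply: B; rewrite normrN gtr0_norm.
have {}B2 : `|Gm (- n%:R)| <= (1 + d^-1) * n.+1%:R^-1 * ((d + `|c|) / D).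
  by rewrite /Gm [d * - n%:R + 0]addr0 mulrN; apply: B; rewrite gtr0_norm.
apply: (le_trans (ler_normB _ _)); apply: (le_trans (lerD B1 B2)).
by move: (d^-1) (n.+1%:R^-1) => u v; rewrite le_eqVlt; apply/orP; left; apply/eqP; ring.
Qed.
End Weight.

Section ComplexLimits.
Context {R : realType}.
Local Notation C := R[i].
Local Notation Re := (@complex.Re R).
Local Notation Im := (@complex.Im R).
Local Notation mu := (@lebesgue_measure R).

Definition ccvg (T : Type) (Fil : set_system T) (u : T -> C) (l : C) :=
  (Re (u t) @[t --> Fil] --> Re l) /\ (Im (u t) @[t --> Fil] --> Im l).

Lemma ccvg_unique (T : Type) (Fil : set_system T) (u : T -> C) (l l' : C) : ProperFilter Fil ->
  ccvg Fil u l -> ccvg Fil u l' -> l = l'.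
Proof.
move=> PF [h1 h2] [h3 h4]; apply/eqP; rewrite eq_complex; apply/andP; split; apply/eqP.
  exact: (cvg_unique _ h1 h3).
exact: (cvg_unique _ h2 h4).
Qed.

Lemma cint_dominated (F_ : nat -> R -> C) (F : R -> C) (k : R -> R) :
  (forall n, cmeas (F_ n)) -> cmeas F ->
  (forall x, ccvg \oo (F_ ^~ x) (F x)) -> (forall n x, cabs (F_ n x) <= k x) ->
  mu.-integrable setT (EFin \o k) ->
  ccvg \oo (fun n => cintegral setT (F_ n)) (cintegral setT F).
Proof.
move=> mF_ mF FF Fk ik; split.
  apply: (@Rdominated _ (fun n x => Re (F_ n x)) (fun x => Re (F x)) k) => //.
  - by move=> n; case: (mF_ n).
  - by case: mF.
  - by move=> x; case: (FF x).
  - by move=> n x; rewrite (le_trans (Re_le_cabs _)).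
apply: (@Rdominated _ (fun n x => Im (F_ n x)) (fun x => Im (F x)) k) => //.
- by move=> n; case: (mF_ n).
- by case: mF.
- by move=> x; case: (FF x).
- by move=> n x; rewrite (le_trans (Im_le_cabs _)).
Qed.

(** A majorant in product form makes $G$ integrable on the plane and all its sections integrable on
    the line; Fubini is then applied to the two components. *)
Lemma cfubini (G : R -> R -> C) (k1 k2 : R -> R) :
  cmeas (fun z : R * R => G z.1 z.2) ->
  mu.-integrable setT (EFin \o k1) -> mu.-integrable setT (EFin \o k2) ->
  (forall x, 0 <= k1 x) -> (forall x, 0 <= k2 x) ->
  (forall x y, cabs (G x y) <= k1 x * k2 y) ->
  cintegral setT (fun x => cintegral setT (fun y => G x y)) =
  cintegral setT (fun y => cintegral setT (fun x => G x y)).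
Proof.
move=> [m1 m2] i1 i2 k10 k20 Gk.
have H (g : R * R -> R) : measurable_fun setT g -> (forall x y, `|g (x, y)| <= k1 x * k2 y) ->
    \int[mu]_x (\int[mu]_y g (x, y)) = \int[mu]_y (\int[mu]_x g (x, y)).
  move=> mg gk.
  have gi : (mu \x mu)%E.-integrable setT (EFin \o g).
    apply/(@integrable12ltyP _ _ _ _ _ mu mu); first exact/measurable_EFinP.
    apply: (@le_lt_trans _ _ (\int[mu]_x ((k1 x)%:E * \int[mu]_y (k2 y)%:E))%E).
      apply: ge0_le_integral => //.
      - by move=> x _; apply: integral_ge0 => y _.
      - apply: (@measurable_fun_fubini_tonelli_F _ _ _ _ _ mu (fun z => `|(g z)%:E|%E)) => //.
        by apply/measurable_EFinP; apply: measurableT_comp => //; exact: normr_measurable.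
      - by apply: emeasurable_funM => //; exact: measurable_int i1.
      - move=> x _; rewrite -ge0_integralZl//; [|exact: measurable_int i2|by move=> y _; rewrite lee_fin|by rewrite lee_fin].
        apply: ge0_le_integral => //.
        * apply/measurable_EFinP; apply: measurableT_comp; first exact: normr_measurable.
          exact: measurableT_comp.
        * by apply: emeasurable_funM => //; exact: measurable_int i2.
        * by move=> y _; rewrite -EFinM lee_fin.
    rewrite ge0_integralZr//.
    - rewrite lte_mul_pinfty//.
      + by rewrite integral_ge0// => y _; rewrite lee_fin.
      + by rewrite integrable_fin_num.
      + by move: i2 => /integrable_lty; apply.
    - exact: measurable_int i1.
    - by move=> x _; rewrite lee_fin.
    - by rewrite integral_ge0// => y _; rewrite lee_fin.
  have fx x : mu.-integrable setT (fun y => (g (x, y))%:E).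
    apply: (@le_integrable _ _ _ mu _ _ _ (fun y => (k1 x * k2 y)%:E)) => //.
    - by apply/measurable_EFinP; exact: measurableT_comp.
    - by move=> y _; rewrite /= lee_fin (le_trans (gk _ _))// ler_norm.
    - by under eq_fun do rewrite EFinM; exact: integrableZl.
  have fy y : mu.-integrable setT (fun x => (g (x, y))%:E).
    apply: (@le_integrable _ _ _ mu _ _ _ (fun x => (k2 y * k1 x)%:E)) => //.
    - by apply/measurable_EFinP; exact: measurableT_comp.
    - by move=> x _; rewrite /= lee_fin (le_trans (gk _ _))// mulrC ler_norm.
    - by under eq_fun do rewrite EFinM; exact: integrableZl.
  rewrite /Rintegral; congr fine.
  under eq_integral => x _ do rewrite (fineK (integrable_fin_num measurableT (fx x))).
  under [in RHS]eq_integral => y _ do rewrite (fineK (integrable_fin_num measurableT (fy y))).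
  exact: (@Fubini _ _ _ _ _ mu mu (EFin \o g)).
have E1 : \int[mu]_x (\int[mu]_y Re (G x y)) = \int[mu]_y (\int[mu]_x Re (G x y)).
  by apply: (H (fun z => Re (G z.1 z.2))) => // x y; rewrite (le_trans (Re_le_cabs _)).
have E2 : \int[mu]_x (\int[mu]_y Im (G x y)) = \int[mu]_y (\int[mu]_x Im (G x y)).
  by apply: (H (fun z => Im (G z.1 z.2))) => // x y; rewrite (le_trans (Im_le_cabs _)).
by rewrite /cintegral/= E1 E2.
Qed.
End ComplexLimits.

(** * Quantitative smoothness and decay of test functions *)

Section Smooth.
Context {R : realType}.
Local Notation C := R[i].
Local Notation Re := (@complex.Re R).
Local Notation Im := (@complex.Im R).
Local Notation mu := (@lebesgue_measure R).
Implicit Types (g : R -> R) (f : R -> C) (K : R).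

(** All that is kept of the Schwartz class: two derivatives that decay like [wgt], with one
    constant. The second derivative yields an integrable Fourier transform and the second-order
    differences of [csmooth_lip2]. *)
Definition smooth2 g K := 0 < K /\ exists g1 g2 : R -> R,
  [/\ forall x, is_derive x (1 : R) g (g1 x), forall x, is_derive x (1 : R) g1 (g2 x),
      continuous g2, forall x, `|g x| <= K * wgt x &
      forall x, `|g1 x| <= K * wgt x /\ `|g2 x| <= K * wgt x].

Definition csmooth f K := smooth2 (Re \o f) K /\ smooth2 (Im \o f) K.

Lemma mvt_lip g (dg : R -> R) K x y : (forall x, is_derive x (1 : R) g (dg x)) ->
  (forall x, `|dg x| <= K) -> `|g x - g y| <= K * `|x - y|.
Proof.
move=> d dK; wlog xy : x y / y <= x => [H|].
  by case: (leP y x) => [/H//|/ltW/H]; rewrite distrC (distrC y).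
have cg : {within `[y, x], continuous g}.
  by apply: continuous_itv_within => z _; exact: is_derive_cont (d z).
have [c _ ->] := @MVT_segment R g dg y x xy (fun z _ => d z) cg.
by rewrite normrM ler_wpM2r.
Qed.

Lemma schwartz_bound g (n : nat) : real_schwartz g ->
  exists2 K, 0 < K & forall x, `|derive1n n g x| <= K * wgt x.
Proof.
move=> [_ H]; have [K0 h0] := H 0%N n; have [K2 h2] := H 2%N n.
exists (`|K0| + `|K2| + 1); first by rewrite ltr_wpDl// addr_ge0.
move=> x; rewrite /wgt ler_pdivlMr ?ltr_wpDr ?sqr_ge0//.
have := h0 x; have := h2 x; rewrite expr0 mul1r real_normK ?num_real// mulrDr mulr1 => a b.
rewrite (mulrC _ (x ^+ 2)) (le_trans (lerD b a))//.
rewrite -[leLHS]addr0 lerD// lerD// ler_norm//.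
Qed.

Lemma schwartz_smooth2 g : real_schwartz g -> exists K, smooth2 g K.
Proof.
move=> sg; have [d _] := sg.
have [K0 K00 h0] := schwartz_bound 0 sg; have [K1 K10 h1] := schwartz_bound 1 sg.
have [K2 K20 h2] := schwartz_bound 2 sg.
exists (K0 + K1 + K2); split; first by rewrite !addr_gt0.
have D n x : is_derive x (1 : R) (derive1n n g) (derive1n n.+1 g x).
  by rewrite derive1nS derive1E; apply: DeriveDef => //; exact: d.
have W x k k' : k <= k' -> k * wgt x <= k' * wgt x by move=> ?; apply: ler_wpM2r => //; exact: wgt_ge0.
exists (derive1n 1 g), (derive1n 2 g); split.
- exact: (D 0%N).
- exact: D.
- by move=> x; exact: is_derive_cont (D 2%N x).
- by move=> x; rewrite (le_trans (h0 x))// W//; lra.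
- by move=> x; split; [rewrite (le_trans (h1 x))// W//; lra|rewrite (le_trans (h2 x))// W//; lra].
Qed.

Lemma smooth2_le g K K' : K <= K' -> smooth2 g K -> smooth2 g K'.
Proof.
move=> KK [K0 [g1 [g2 [d1 d2 c b0 b]]]]; split; first exact: lt_le_trans KK.
have W x : K * wgt x <= K' * wgt x by apply: ler_wpM2r => //; exact: wgt_ge0.
exists g1, g2; split => // x; first exact: le_trans (W x).
by have [b1 b2] := b x; split; exact: le_trans (W x).
Qed.

Lemma schwartz_csmooth f : schwartz f -> exists K, csmooth f K.
Proof.
move=> [/schwartz_smooth2[K1 s1] /schwartz_smooth2[K2 s2]]; exists (K1 + K2).
have [? _] := s1; have [? _] := s2.
by split; [apply: smooth2_le s1|apply: smooth2_le s2]; lra.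
Qed.

Lemma smooth2_cont g K : smooth2 g K -> continuous g.
Proof. by move=> [_ [g1 [g2 [d _ _ _ _]]]] x; exact: is_derive_cont (d x). Qed.

Lemma smooth2_meas g K : smooth2 g K -> measurable_fun setT g.
Proof. by move=> /smooth2_cont; exact: continuous_measurable_fun. Qed.

Lemma csmooth_meas f K : csmooth f K -> cmeas f.
Proof. by move=> [/smooth2_meas ? /smooth2_meas]. Qed.

Lemma csmooth_gt0 f K : csmooth f K -> 0 < K.
Proof. by move=> [[]]. Qed.

Lemma csmooth_bound f K x : csmooth f K -> cabs (f x) <= 2 * K * wgt x.
Proof.
move=> [[_ [? [? [_ _ _ b1 _]]]] [_ [? [? [_ _ _ b2 _]]]]].
rewrite (le_trans (cabs_le_ReIm _))// -mulrA mulrDl mul1r lerD//; [exact: b1|exact: b2].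
Qed.

Lemma csmooth_bound1 f K x : csmooth f K -> cabs (f x) <= 2 * K.
Proof.
move=> s; rewrite (le_trans (csmooth_bound x s))// ler_piMr ?wgt_le1//.
by rewrite mulr_ge0// ltW// (csmooth_gt0 s).
Qed.

Lemma csmooth_lip f K x y : csmooth f K -> cabs (f x - f y) <= 2 * K * `|x - y|.
Proof.
move=> [[K0 [? [? [d1 _ _ _ b1]]]] [_ [? [? [d2 _ _ _ b2]]]]].
rewrite (le_trans (cabs_le_ReIm _))// -mulrA mulrDl mul1r ReD ImD ReN ImN.
have W t k : `|k| <= K * wgt t -> `|k| <= K by move=> /le_trans; apply; rewrite ler_piMr ?wgt_le1// ltW.
apply: lerD.
  by apply: (mvt_lip x y d1) => t; have [+ _] := b1 t; exact: W.
by apply: (mvt_lip x y d2) => t; have [+ _] := b2 t; exact: W.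
Qed.

(** Mean value theorem in $t$ for $g(x-t) - g(y-t)$, and then for $g'$. With $v = t$ and $v' = -t$
    it bounds the odd part of a difference of translates by $|x-y|\,t$, as needed for a principal
    value that is Lipschitz in $x$. *)
Lemma csmooth_lip2 f K x y v v' : csmooth f K ->
  cabs ((f (x - v) - f (y - v)) - (f (x - v') - f (y - v'))) <= 2 * K * `|x - y| * `|v - v'|.
Proof.
have H g : smooth2 g K -> `|(g (x - v) - g (y - v)) - (g (x - v') - g (y - v'))| <= K * `|x - y| * `|v - v'|.
  move=> [K0 [g1 [g2 [d1 d2 _ _ b]]]].
  have W t k : `|k| <= K * wgt t -> `|k| <= K by move=> /le_trans; apply; rewrite ler_piMr ?wgt_le1// ltW.
  pose D t := g (x - t) - g (y - t); pose D' t := g1 (x - t) * (-1) - g1 (y - t) * (-1).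
  apply: (@mvt_lip D D') => t.
    have da z : is_derive t (1 : R) (fun t => z - t) (-1).
      by apply: is_derive_eq (der_add (der_cst z t) (der_opp (der_id t))) _; rewrite add0r.
    exact: der_add (der_comp (d1 _) (da x)) (der_opp (der_comp (d1 _) (da y))).
  rewrite /D' -mulrBl mulrN1 normrN.
  have -> : x - y = (x - t) - (y - t) by ring.
  by apply: mvt_lip d2 _ => z; have [_] := b z; exact: W.
move=> [s1 s2]; rewrite (le_trans (cabs_le_ReIm _))// !(ReD, ImD, ReN, ImN).
have -> : 2 * K * `|x - y| * `|v - v'| = K * `|x - y| * `|v - v'| + K * `|x - y| * `|v - v'| by ring.
by apply: lerD; [exact: H s1|exact: H s2].
Qed.

Lemma csmooth_int f K : csmooth f K -> cintg setT f.
Proof.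
move=> s; apply: (@cintg_le _ _ _ (fun x => 2 * K * wgt x)) => //.
- exact: csmooth_meas s.
- by move=> x _; exact: csmooth_bound.
- exact: integrable_Zwgt.
Qed.

(** Two integrations by parts in one: $(g' \cos + c\, g \sin)' = g'' \cos + c^2 g \cos$ has integral
    0, so $c^2$ times the integral equals minus that of $g'' \cos$. Adding the trivial bound gives
    the factor $1 + c^2$. *)
Lemma smooth2_fourier g K c th : smooth2 g K -> `|\int[mu]_y (g y * cos (c * y + th))| <= 2 * K * pi * wgt c.
Proof.
move=> sg; have mg := smooth2_meas sg; have cg := smooth2_cont sg.
move: sg => [K0 [g1 [g2 [d1 d2 c2 b0 b]]]].
have mcos th' : measurable_fun setT (fun y : R => cos (c * y + th')).
  apply: (@measurable_pair_comp _ _ _ cos (fun y : R => c * y + th')); first exact: continuous_cos.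
  by apply: measurable_funD => //; exact: measurable_funM.
have bcos h y : `|h y| <= K * wgt y -> `|h y * cos (c * y + th)| <= K * wgt y.
  by move=> hb; rewrite normrM -[leRHS]mulr1; apply: ler_pM => //; exact: norm_cos_le1.
rewrite /wgt ler_pdivlMr ?ltr_wpDr ?sqr_ge0//.
set I := \int[mu]_y _.
have I1 : `|I| <= K * pi.
  by apply: Rint_decay; [exact: measurable_funM|move=> x; exact: bcos].
have i0 : mu.-integrable setT (EFin \o (fun y => g y * cos (c * y + th))).
  by apply: integrable_decay; [exact: measurable_funM|move=> x; exact: bcos].
have m2 : measurable_fun setT g2 by exact: continuous_measurable_fun.
have i2 : mu.-integrable setT (EFin \o (fun y => g2 y * cos (c * y + th))).
  by apply: integrable_decay; [exact: measurable_funM|move=> x; apply: bcos; case: (b x)].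
have I2 : `|\int[mu]_y (g2 y * cos (c * y + th))| <= K * pi.
  by apply: Rint_decay; [exact: measurable_funM|move=> x; apply: bcos; case: (b x)].
pose G y := g1 y * cos (c * y + th) + c * (g y * sin (c * y + th)).
pose G' y := g2 y * cos (c * y + th) + c ^+ 2 * (g y * cos (c * y + th)).
have dG y : is_derive y (1 : R) G (G' y).
  apply: is_derive_eq (der_add (der_mul (d2 y) (der_cos (der_affine c th y))) (der_scale c (der_mul (d1 y) (der_sin (der_affine c th y))))) _.
  by rewrite /G'; ring.
have z0 : \int[mu]_y G' y = 0.
  apply: (@Rint_derive0 _ G G' ((1 + `|c| + c ^+ 2) * K)) => //.
  - move=> y; have cc : {for y, continuous (fun y => cos (c * y + th))}.
      exact: is_derive_cont (der_cos (der_affine c th y)).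
    have c1 : {for y, continuous (fun y => g2 y * cos (c * y + th))} by apply: continuousM => //; exact: c2.
    have c3 : {for y, continuous (fun y => g y * cos (c * y + th))} by apply: continuousM => //; exact: cg.
    have c4 : {for y, continuous (fun y => c ^+ 2 * (g y * cos (c * y + th)))} by apply: continuousM => //; exact: cst_continuous.
    exact: (continuousD c1 c4).
  - move=> y; apply: (le_trans (ler_normD _ _)).
    have -> : (1 + `|c| + c ^+ 2) * K * wgt y = K * wgt y + `|c| * (K * wgt y) + c ^+ 2 * (K * wgt y) by ring.
    have [_ b2] := b y.
    have h1 := bcos g2 y b2; have h2 := bcos g y (b0 y).
    rewrite [`|c ^+ 2 * _|]normrM [`|c ^+ 2|]ger0_norm ?sqr_ge0//.
    have h3 : c ^+ 2 * `|g y * cos (c * y + th)| <= c ^+ 2 * (K * wgt y) by rewrite ler_wpM2l// sqr_ge0.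
    have h4 : 0 <= `|c| * (K * wgt y) by rewrite !mulr_ge0 ?wgt_ge0// ltW.
    lra.
  - move=> y; apply: (le_trans (ler_normD _ _)).
    have -> : (1 + `|c| + c ^+ 2) * K * wgt y = K * wgt y + `|c| * (K * wgt y) + c ^+ 2 * (K * wgt y) by ring.
    have [b1 _] := b y; have h1 := bcos g1 y b1.
    have h2 : `|g y * sin (c * y + th)| <= K * wgt y.
      by rewrite normrM -[leRHS]mulr1; apply: ler_pM => //; exact: norm_sin_le1.
    have h3 : `|c| * `|g y * sin (c * y + th)| <= `|c| * (K * wgt y) by rewrite ler_wpM2l.
    have h4 : 0 <= c ^+ 2 * (K * wgt y).
      by apply: mulr_ge0; [exact: sqr_ge0|rewrite mulr_ge0 ?wgt_ge0// ltW].
    by rewrite [`|c * _|]normrM; lra.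
have iZ : mu.-integrable setT (EFin \o (fun y => c ^+ 2 * (g y * cos (c * y + th)))).
  by rewrite /comp; under eq_fun do rewrite EFinM; exact: integrableZl.
have : \int[mu]_y G' y = \int[mu]_y (g2 y * cos (c * y + th)) + c ^+ 2 * I.
  by rewrite /G' RintegralD// RintegralZl.
rewrite z0 => e.
have {}e : c ^+ 2 * I = - (\int[mu]_y (g2 y * cos (c * y + th))) by lra.
rewrite -mulrA mulrDl mul1r mulrDr mulr1 lerD//.
by rewrite mulrC -[X in X * _]ger0_norm ?sqr_ge0// -normrM e normrN.
Qed.
End Smooth.

(** * Decay and measurability of the Fourier transform *)

Section FourierTransform.
Context {R : realType}.
Local Notation C := R[i].
Local Notation Re := (@complex.Re R).
Local Notation Im := (@complex.Im R).
Local Notation mu := (@lebesgue_measure R).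
Implicit Types (f : R -> C) (K : R).

Lemma measurable_affine c d : measurable_fun setT (fun x : R => c * x + d).
Proof. by apply: measurable_funD => //; exact: measurable_funM. Qed.

Lemma cintg_expi f (u : R -> R) D : measurable D -> cmeas f -> measurable_fun setT u -> cintg D f -> cintg D (fun y => f y * expi (u y)).
Proof.
move=> mD mf mu_ [f1 f2].
apply: (@cintg_le _ _ _ (fun x => `|Re (f x)| + `|Im (f x)|)) => //.
- by apply: cmeasM => //; exact: cmeas_expi.
- by move=> x _; rewrite cabsM cabs_expi mulr1 cabs_le_ReIm.
- rewrite /comp; under eq_fun do rewrite EFinD.
  by apply: integrableD => //; [exact: (integrable_norm f1)|exact: (integrable_norm f2)].
Qed.

(** The sines are written as cosines shifted by $\pi/2$, so that each of the four terms falls under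
    [smooth2_fourier]. *)
Lemma fourierE f K xi : csmooth f K -> fourier f xi =
  Complex (\int[mu]_y (Re (f y) * cos (- (2 * pi * xi) * y + 0)) - \int[mu]_y (Im (f y) * cos (- (2 * pi * xi) * y + - (pi / 2))))
          (\int[mu]_y (Re (f y) * cos (- (2 * pi * xi) * y + - (pi / 2))) + \int[mu]_y (Im (f y) * cos (- (2 * pi * xi) * y + 0))).
Proof.
move=> sf; have [mf1 mf2] := csmooth_meas sf.
have i h th : smooth2 h K -> mu.-integrable setT (EFin \o (fun y => h y * cos (- (2 * pi * xi) * y + th))).
  move=> sh; apply: (@integrable_decay _ _ K).
    apply: measurable_funM; first exact: smooth2_meas sh.
    apply: (@measurable_pair_comp _ _ _ cos (fun y : R => - (2 * pi * xi) * y + th)); first exact: continuous_cos.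
    exact: measurable_affine.
  move: sh => [K0 [? [? [_ _ _ b _]]]] y; rewrite normrM -[leRHS]mulr1.
  by apply: ler_pM => //; exact: norm_cos_le1.
have [s1 s2] := sf.
rewrite -RintegralB//; [|exact: (i (Re \o f))|exact: (i (Im \o f))].
rewrite -RintegralD//; [|exact: (i (Re \o f))|exact: (i (Im \o f))].
rewrite /fourier/cintegral; congr Complex; apply: eq_Rintegral => y _.
  by rewrite ReM /= cosBpihalf addr0 mulNr.
by rewrite ImM /= cosBpihalf addr0 mulNr.
Qed.

Lemma fourier_bound f K xi : csmooth f K -> cabs (fourier f xi) <= 8 * K * pi * wgt xi.
Proof.
move=> sf; rewrite (fourierE xi sf); have [s1 s2] := sf; have K0 := csmooth_gt0 sf.
rewrite (le_trans (cabs_le_ReIm _))//=.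
have W : wgt (- (2 * pi * xi)) <= wgt xi.
  rewrite /wgt lef_pV2 ?posrE ?ltr_wpDr ?sqr_ge0// lerD2l sqrrN exprMn ler_peMl ?sqr_ge0//.
  have h : 1 <= 2 * pi :> R by have := pi_ge2 R; lra.
  by rewrite exprn_ege1.
have H h th : smooth2 h K -> `|\int[mu]_y (h y * cos (- (2 * pi * xi) * y + th))| <= 2 * K * pi * wgt xi.
  move=> sh; apply: (le_trans (smooth2_fourier _ th sh)).
  by apply: ler_wpM2l => //; rewrite !mulr_ge0// ?pi_ge0// ltW.
have h1 := H _ 0 s1; have h2 := H _ 0 s2.
have h3 := H _ (- (pi / 2)) s1; have h4 := H _ (- (pi / 2)) s2.
have -> : 8 * K * pi * wgt xi = (2 * K * pi * wgt xi + 2 * K * pi * wgt xi) + (2 * K * pi * wgt xi + 2 * K * pi * wgt xi) by ring.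
by apply: lerD; [apply: (le_trans (ler_normB _ _))|apply: (le_trans (ler_normD _ _))]; apply: lerD.
Qed.

Lemma fourier_meas f K : csmooth f K -> cmeas (fourier f).
Proof.
move=> sf; have [s1 s2] := sf.
have H h th : smooth2 h K -> measurable_fun setT (fun xi : R => \int[mu]_y (h y * cos (- (2 * pi * xi) * y + th))).
  move=> sh; have mh := smooth2_meas sh; have [K0 [? [? [_ _ _ b _]]]] := sh.
  apply: continuous_measurable_fun => xi.
  have bb y t : `|h y * cos (- (2 * pi * t) * y + th)| <= K * wgt y.
    by rewrite normrM -[leRHS]mulr1; apply: ler_pM => //; exact: norm_cos_le1.
  apply: (@continuity_under_integral R _ _ mu (fun xi y => h y * cos (- (2 * pi * xi) * y + th)) setT measurableT (xi - 1) (xi + 1) _ _ (fun y => K * wgt y)).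
  - move=> t _; apply: (@integrable_decay _ _ K) => //.
    apply: measurable_funM => //.
    apply: (@measurable_pair_comp _ _ _ cos (fun y : R => - (2 * pi * t) * y + th)); first exact: continuous_cos.
    exact: measurable_affine.
  - apply: aeW => y _ t _; apply: continuousM; first exact: cst_continuous.
    exact: is_derive_cont (der_cos (der_add (der_mul (der_opp (der_scale (2 * pi) (der_id t))) (der_cst y t)) (der_cst th t))).
  - exact: integrable_Zwgt.
  - by move=> t _; apply: aeW => y _; exact: bb.
  - by rewrite inE/= in_itv/= ltrBlDr ltrDl ltr01.
have -> : fourier f = (fun xi => Complex (\int[mu]_y (Re (f y) * cos (- (2 * pi * xi) * y + 0)) - \int[mu]_y (Im (f y) * cos (- (2 * pi * xi) * y + - (pi / 2))))
          (\int[mu]_y (Re (f y) * cos (- (2 * pi * xi) * y + - (pi / 2))) + \int[mu]_y (Im (f y) * cos (- (2 * pi * xi) * y + 0)))).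
  by apply/funext => xi; exact: fourierE sf.
split => /=; [apply: measurable_funB|apply: measurable_funD].
- exact: H s1.
- exact: H s2.
- exact: H s1.
- exact: H s2.
Qed.

Lemma fourier_int f K : csmooth f K -> cintg setT (fourier f).
Proof.
move=> sf; apply: (@cintg_le _ _ _ (fun x => 8 * K * pi * wgt x)) => //.
- exact: fourier_meas sf.
- by move=> x _; exact: fourier_bound.
- exact: integrable_Zwgt.
Qed.
End FourierTransform.

(** * Fourier inversion by Abel summation *)

Section FourierInversion.
Context {R : realType}.
Local Notation C := R[i].
Local Notation Re := (@complex.Re R).
Local Notation Im := (@complex.Im R).
Local Notation mu := (@lebesgue_measure R).
Implicit Types (f : R -> C) (K : R).

Lemma ccvg_bound (u : nat -> C) l K : (forall n, cabs (u n - l) <= K * n.+1%:R^-1) -> ccvg \oo u l.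
Proof.
move=> H; split; apply: (@cvgn_inv_bound _ _ _ K) => n; apply: le_trans (H n).
  by rewrite -ReN -ReD Re_le_cabs.
by rewrite -ImN -ImD Im_le_cabs.
Qed.

Lemma expR_1B t : 0 <= t -> `|expR (- t) - 1| <= t :> R.
Proof.
move=> t0; have h := expR_ge1Dx (- t).
have h1 : expR (- t) <= 1 by rewrite -expR0 ler_expR oppr_le0.
by rewrite ler0_norm ?subr_le0// opprB; lra.
Qed.

Lemma cint_exp_expi d c : 0 < d ->
  cintegral setT (fun x => (expR (- (d * `|x|)))%:C%C * (expi (c * x) : C)) = (2 * d / (d ^+ 2 + c ^+ 2))%:C%C.
Proof.
move=> d0; rewrite /cintegral; apply/eqP; rewrite eq_complex/=; apply/andP; split; apply/eqP.
  by rewrite -Rint_exp_cos//; apply: eq_Rintegral => x _; rewrite mul0r subr0.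
have -> : \int[mu]_x (expR (- (d * `|x|)) * sin (c * x) + 0 * cos (c * x)) = \int[mu]_x (expR (- (d * `|x|)) * sin (c * x)).
  by apply: eq_Rintegral => x _; rewrite mul0r addr0.
apply: Rint_odd; last by move=> x; rewrite normrN mulrN sinN mulrN.
apply: le_integrable (integrable_exp_abs d0) => //.
  apply/measurable_EFinP; apply: measurable_funM.
    apply: (@measurable_pair_comp _ _ _ expR (fun x : R => - (d * `|x|))); first exact: continuous_expR.
    by apply: measurable_funN; apply: measurable_funM => //; exact: normr_measurable.
  by apply: (@measurable_pair_comp _ _ _ sin (fun x : R => c * x)); [exact: continuous_sin|exact: measurable_funM].
by move=> x _; rewrite /= lee_fin normrM ler_piMr// norm_sin_le1.
Qed.

Lemma measurable_exp_abs d : measurable_fun setT (fun x : R => expR (- (d * `|x|))).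
Proof.
apply: (@measurable_pair_comp _ _ _ expR (fun x : R => - (d * `|x|))); first exact: continuous_expR.
by apply: measurable_funN; apply: measurable_funM => //; exact: normr_measurable.
Qed.

Lemma cmeas_fst (F : R -> C) : cmeas F -> cmeas (fun z : R * R => F z.1).
Proof. by move=> mF; apply: cmeas_comp mF; exact: measurable_fst. Qed.

Lemma cmeas_snd (F : R -> C) : cmeas F -> cmeas (fun z : R * R => F z.2).
Proof. by move=> mF; apply: cmeas_comp mF; exact: measurable_snd. Qed.

Lemma mfst : measurable_fun setT (fun z : R * R => z.1).
Proof. exact: measurable_fst. Qed.

Lemma msnd : measurable_fun setT (fun z : R * R => z.2).
Proof. exact: measurable_snd. Qed.

Lemma cint_cst_factor (z : C) (h : R -> R) : mu.-integrable setT (EFin \o h) ->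
  cintegral setT (fun x => z * (h x)%:C%C) = z * (\int[mu]_x h x)%:C%C.
Proof.
move=> hi; rewrite cintM//.
  by congr (_ * _); rewrite /cintegral/=; congr Complex; rewrite Rintegral_cst// mul0r.
by split => //=; exact: integrable0.
Qed.

(** With the damping $e^{-d|\xi|}$ Fubini applies, and the inner integral over $\xi$ is the Poisson
    kernel $2d/(d^2 + 4\pi^2(x-y)^2)$. The substitution $y = x - d v/(2\pi)$ turns it into the fixed
    probability density [wgt v] over $\pi$, so that the parameter $d$ remains only in the argument
    of $f$. *)
Lemma abel_fourier f K d x : csmooth f K -> 0 < d ->
  cintegral setT (fun xi => (expR (- (d * `|xi|)))%:C%C * (fourier f xi * expi (2 * pi * x * xi))) =
  cintegral setT (fun v => f (- (d / (2 * pi)) * v + x) * (pi^-1 * wgt v)%:C%C).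
Proof.
move=> sf d0; have mf := csmooth_meas sf; have fi := csmooth_int sf.
have pi0 := pi_gt0 R.
pose G xi y := ((expR (- (d * `|xi|)))%:C%C * expi (2 * pi * x * xi)) * (f y * expi (- (2 * pi * xi * y))).
transitivity (cintegral setT (fun xi => cintegral setT (fun y => G xi y))).
  apply: cint_eq => xi _; rewrite cintM//; first by rewrite /fourier -[RHS]mulrA; congr (_ * _); rewrite mulrC.
  by apply: cintg_expi => //; apply: measurable_funN; exact: measurable_funM.
rewrite (@cfubini _ G (fun xi => expR (- (d * `|xi|))) (fun y => 2 * K * wgt y)); first last.
- move=> xi y; rewrite /G !cabsM !cabs_expi !mulr1 cabs_real ger0_norm ?expR_ge0//.
  by apply: ler_wpM2l; [exact: expR_ge0|exact: csmooth_bound].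
- by move=> y; rewrite !mulr_ge0 ?wgt_ge0// ltW// (csmooth_gt0 sf).
- by move=> xi; exact: expR_ge0.
- exact: integrable_Zwgt.
- exact: integrable_exp_abs.
- apply: cmeasM.
    apply: (@cmeas_fst (fun xi => (expR (- (d * `|xi|)))%:C%C * expi (2 * pi * x * xi))).
    apply: cmeasM; first by apply: cmeas_real; exact: measurable_exp_abs.
    by apply: cmeas_expi; exact: measurable_funM.
  apply: cmeasM; first exact: cmeas_snd.
  apply: cmeas_expi; apply: measurable_funN; apply: measurable_funM; last exact: msnd.
  by apply: measurable_funM => //; exact: mfst.
pose Phi y := f y * (2 * d / (d ^+ 2 + (2 * pi * (x - y)) ^+ 2))%:C%C.
have mPhi : cmeas Phi.
  apply: cmeasM => //; apply: cmeas_real; apply: measurable_funM => //.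
  apply: measurable_funV; apply: measurable_funD => //; apply: measurable_funX.
  by apply: measurable_funM => //; apply: measurable_funB.
have iPhi : cintg setT Phi.
  apply: (@cintg_le _ _ _ (fun y => (2 * K * (2 / d)) * wgt y)) => //; last exact: integrable_Zwgt.
  move=> y _; rewrite cabsM cabs_real [leRHS]mulrAC; apply: ler_pM => //; first exact: cabs_ge0.
    exact: csmooth_bound.
  have D0 : 0 < d ^+ 2 + (2 * pi * (x - y)) ^+ 2 by rewrite ltr_wpDr ?sqr_ge0// exprn_gt0.
  have Q0 : 0 <= 2 * d / (d ^+ 2 + (2 * pi * (x - y)) ^+ 2) by apply: divr_ge0; [rewrite mulr_ge0// ltW|exact: ltW].
  rewrite (ger0_norm Q0) ler_pdivrMr//.
  rewrite mulrDr -[X in X <= _]addr0; apply: lerD; last by rewrite mulr_ge0 ?sqr_ge0// divr_ge0// ltW.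
  by rewrite le_eqVlt; apply/orP; left; apply/eqP; field; rewrite gt_eqF.
transitivity (cintegral setT Phi).
  apply: cint_eq => y _; rewrite /Phi -(cint_exp_expi (2 * pi * (x - y)) d0) -cintM//.
    have e (xi : R) : 2 * pi * x * xi + - (2 * pi * xi * y) = 2 * pi * (x - y) * xi by ring.
    by apply: cint_eq => xi _; rewrite /G mulrCA; congr (f y * _); rewrite -[LHS]mulrA -expiD e.
  apply: (@cintg_le _ _ _ (fun xi => expR (- (d * `|xi|)))) => //.
  - apply: cmeasM; first by apply: cmeas_real; exact: measurable_exp_abs.
    by apply: cmeas_expi; exact: measurable_funM.
  - by move=> xi _; rewrite cabsM cabs_expi mulr1 cabs_real ger0_norm ?expR_ge0.
  - exact: integrable_exp_abs.
have c0 : - (d / (2 * pi)) != 0 by rewrite oppr_eq0 gt_eqF// divr_gt0// mulr_gt0.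
have := @cint_affine _ (- (d / (2 * pi))) x Phi c0 iPhi.
have ac : `|- (d / (2 * pi))| = d / (2 * pi) by rewrite normrN gtr0_norm// divr_gt0// mulr_gt0.
rewrite ac => H.
have -> : cintegral setT Phi = (d / (2 * pi))%:C%C * cintegral setT (fun v => Phi (- (d / (2 * pi)) * v + x)).
  rewrite H mulrA -rmorphM divff ?mul1r//.
  by rewrite gt_eqF// divr_gt0// mulr_gt0.
rewrite -cintM//; last exact: cintg_affine.
apply: cint_eq => v _; rewrite /Phi mulrCA -rmorphM; congr (f _ * _%:C%C).
rewrite /wgt; move: (@pi R) pi0 => P P0.
have P1 : P != 0 by rewrite gt_eqF.
have d1 : d != 0 by rewrite gt_eqF.
have -> : 2 * P * (x - (- (d / (2 * P)) * v + x)) = d * v by field.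
have v0 : 1 + v ^+ 2 != 0 by rewrite gt_eqF// ltr_wpDr// sqr_ge0.
have -> : d ^+ 2 + (d * v) ^+ 2 = d ^+ 2 * (1 + v ^+ 2) by ring.
by field; rewrite d1 v0 P1.
Qed.

(** The Abel means have two limits as $d \to 0$, both by dominated convergence: the undamped
    integral, thanks to the decay of the transform, and $f(x)$, thanks to the Lipschitz bound. *)
Lemma fourier_inversion f K x : csmooth f K -> inv_fourier (fourier f) x = f x.
Proof.
move=> sf; have K0 := csmooth_gt0 sf; have pi0 := pi_gt0 R.
pose d (n : nat) : R := n.+1%:R^-1; have d0 n : 0 < d n by rewrite invr_gt0.
pose A n := cintegral setT (fun xi => (expR (- (d n * `|xi|)))%:C%C * (fourier f xi * expi (2 * pi * x * xi))).
have mA : cmeas (fun xi => fourier f xi * expi (2 * pi * x * xi)).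
  by apply: cmeasM; [exact: fourier_meas sf|apply: cmeas_expi; exact: measurable_funM].
have A1 : ccvg \oo A (inv_fourier (fourier f) x).
  apply: (@cint_dominated _ _ _ (fun xi => 8 * K * pi * wgt xi)) => //.
  - by move=> n; apply: cmeasM => //; apply: cmeas_real; exact: measurable_exp_abs.
  - move=> xi; apply: (@ccvg_bound _ _ (`|xi| * cabs (fourier f xi))) => n.
    rewrite -[X in _ - X]mul1r -mulrBl -rmorphB !cabsM cabs_real cabs_expi mulr1 mulrAC.
    apply: ler_wpM2r; first exact: cabs_ge0.
    by rewrite mulrC; apply: expR_1B; rewrite mulr_ge0// ltW// d0.
  - move=> n xi; rewrite !cabsM cabs_expi mulr1 cabs_real ger0_norm ?expR_ge0//.
    rewrite -[leRHS]mul1r; apply: ler_pM => //; [exact: cabs_ge0| |exact: fourier_bound].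
    by rewrite -expR0 ler_expR oppr_le0 mulr_ge0// ltW// d0.
  - exact: integrable_Zwgt.
have A2 : ccvg \oo A (cintegral setT (fun v => f x * (pi^-1 * wgt v)%:C%C)).
  have -> : A = (fun n => cintegral setT (fun v => f (- (d n / (2 * pi)) * v + x) * (pi^-1 * wgt v)%:C%C)).
    by apply/funext => n; exact: (abel_fourier x sf (d0 n)).
  have mw : measurable_fun setT (fun v : R => pi^-1 * wgt v) by apply: measurable_funM => //; exact: measurable_wgt.
  have pw (v : R) : 0 <= pi^-1 * wgt v by apply: mulr_ge0; [rewrite invr_ge0; exact: pi_ge0|exact: wgt_ge0].
  apply: (@cint_dominated _ _ _ (fun v => (2 * K * pi^-1) * wgt v)) => //.
  - move=> n; apply: cmeasM; last exact: cmeas_real.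
    by apply: cmeas_comp (csmooth_meas sf); exact: measurable_affine.
  - by apply: cmeasM; [exact: cmeas_cst|exact: cmeas_real].
  - move=> v; apply: (@ccvg_bound _ _ (2 * K * `|v| / (2 * pi) * (pi^-1 * wgt v))) => n.
    rewrite -mulrBl cabsM cabs_real ger0_norm// [leRHS]mulrAC; apply: ler_wpM2r => //.
    apply: (le_trans (csmooth_lip _ _ sf)); rewrite addrK normrM normrN normrM [`|d n|]gtr0_norm// normfV (gtr0_norm (mulr_gt0 _ _))//.
    by rewrite le_eqVlt; apply/orP; left; apply/eqP; rewrite /d; move: (n.+1%:R^-1) => u; ring.
  - move=> n v; rewrite cabsM cabs_real ger0_norm// -[leRHS]mulrA; apply: ler_wpM2r => //.
    exact: csmooth_bound1.
  - exact: integrable_Zwgt.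
rewrite (ccvg_unique _ A1 A2) cint_cst_factor; last exact: integrable_Zwgt.
by rewrite Rintegral_Zwgt mulVf ?mulr1// gt_eqF.
Qed.

Lemma fourier_modulation f N eta : fourier (fun y => expi (N * y) * f y) eta = fourier f (eta - N / (2 * pi)).
Proof.
have pi0 := pi_gt0 R.
have e (y : R) : N * y + - (2 * pi * eta * y) = - (2 * pi * (eta - N / (2 * pi)) * y).
  have p2 : 2 * pi != 0 :> R by rewrite gt_eqF// mulr_gt0.
  by rewrite mulrBr [2 * pi * (N / _)]mulrC divfK//; ring.
by apply: cint_eq => y _; rewrite mulrAC mulrC; congr (_ * _); rewrite -expiD e.
Qed.

Lemma fourier_inversion_modulation f K N x : csmooth f K ->
  cintegral setT (fun eta => fourier f (eta - N / (2 * pi)) * expi (2 * pi * x * eta)) = expi (N * x) * f x.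
Proof.
move=> sf; have pi0 := pi_gt0 R.
pose Psi eta := expi (N * x) * (fourier f eta * expi (2 * pi * x * eta)).
have iF : cintg setT (fun eta => fourier f eta * expi (2 * pi * x * eta)).
  by apply: cintg_expi => //; [exact: fourier_meas sf|exact: fourier_int sf].
have i0 : cintg setT Psi by exact: cintgM.
have := @cint_affine _ 1 (- (N / (2 * pi))) Psi (oner_neq0 _) i0.
have e1 : cintegral setT Psi = expi (N * x) * f x by rewrite cintM// -(fourier_inversion x sf).
rewrite normr1 invr1 mul1r e1 => <-.
have e (eta : R) : N * x + 2 * pi * x * (eta + - (N / (2 * pi))) = 2 * pi * x * eta.
  have p2 : 2 * pi != 0 :> R by rewrite gt_eqF// mulr_gt0.
  have e2 : 2 * pi * x * (N / (2 * pi)) = N * x by rewrite (mulrC (2 * pi) x) -mulrA [2 * pi * (N / _)]mulrC divfK// mulrC.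
  by rewrite mulrDr mulrN e2; ring.
by apply: cint_eq => eta _; rewrite /Psi mul1r mulrCA -expiD e.
Qed.
End FourierInversion.

(** * Principal values and the multiplier *)

Section TruncatedPV.
Context {R : realType}.
Local Notation C := R[i].
Local Notation Re := (@complex.Re R).
Local Notation Im := (@complex.Im R).
Local Notation mu := (@lebesgue_measure R).
Implicit Types (H F : R -> C) (B e M : R).

Lemma Re_cint (D : set R) F : Re (cintegral D F) = \int[mu]_(t in D) Re (F t).
Proof. by []. Qed.

Lemma Im_cint (D : set R) F : Im (cintegral D F) = \int[mu]_(t in D) Im (F t).
Proof. by []. Qed.

(* The integral of H t / t over e <= |t| <= M, folded onto t > 0. *)
Definition pvint e M H := cintegral `[e, M] (fun t => (H t - H (- t)) / t%:C%C).

Lemma itv_bound_opp (b : bool) M t :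
  (BRight (- t) <= BSide b M)%O = (BSide (~~ b) (- M) <= BLeft t)%O.
Proof. by case: b => /=; rewrite !bnd_simp; [exact: ltrNl|exact: lerNl]. Qed.

Lemma cint_abs (b : bool) e M F : 0 < e -> e <= M -> cintg `[e, M] F -> cintg `[- M, - e] F ->
  cintg [set t | `|t| \in Interval (BRight e) (BSide b M)] F ->
  cintegral [set t | `|t| \in Interval (BRight e) (BSide b M)] F = cintegral `[e, M] F + cintegral `[- M, - e] F.
Proof.
move=> e0 eM i1 i2 i0.
have bb t := itv_bound_opp b M t.
pose A := [set` Interval (BRight e) (BSide b M)]; pose A' := [set` Interval (BSide (~~ b) (- M)) (BLeft (- e))].
have E : [set t | `|t| \in Interval (BRight e) (BSide b M)] = A `|` A'.
  apply/seteqP; split => t; rewrite /A /A' /= !itv_boundlr /= !bnd_simp.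
    move=> /andP[et tM]; have [t0|/ltW t0] := leP 0 t.
      by left; rewrite ger0_norm// in et tM *; rewrite et.
    by right; rewrite ler0_norm// in et tM; rewrite ltrNr et andbT -bb.
  move=> [/andP[et tM]|/andP[Mt te]].
    by rewrite ger0_norm ?et//; apply: ltW; exact: lt_trans et.
  have t0 : t <= 0 by apply: ltW; rewrite (lt_trans te)// oppr_lt0.
  by rewrite ler0_norm// ltrNr te/= bb.
have sA : A `<=` `[e, M].
  by apply: subset_itv; rewrite ?bnd_simp//; clear; case: b; rewrite bnd_simp.
have sA' : A' `<=` `[- M, - e].
  by apply: subset_itv; rewrite ?bnd_simp//; clear; case: b; rewrite bnd_simp.
have mA : measurable A by exact: measurable_itv.
have mA' : measurable A' by exact: measurable_itv.
rewrite E cintU//.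
- by rewrite cint_itv// cint_itv.
- by rewrite -E.
- by apply/disj_setPS => t [/sA + /sA']; rewrite /= !in_itv/= => /andP[h1 _] /andP[_ h2]; lra.
Qed.

Lemma cmeas_neg H : cmeas H -> cmeas (fun t : R => H (- t)).
Proof. by move=> mH; apply: cmeas_comp mH; exact: measurable_funN. Qed.

Lemma cmeas_divid H : cmeas H -> cmeas (fun t => H t / t%:C%C).
Proof. by move=> mH; exact: cmeas_div. Qed.

Lemma cmeas_fold H : cmeas H -> cmeas (fun t => (H t - H (- t)) / t%:C%C).
Proof. by move=> mH; apply: cmeas_divid; apply: cmeasB => //; exact: cmeas_neg. Qed.

Lemma cintg_div_pos H B e M : cmeas H -> (forall t, cabs (H t) <= B) -> 0 < e -> cintg `[e, M] (fun t => H t / t%:C%C).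
Proof.
move=> mH HB e0; apply: (@cintg_bnd _ _ _ e M (B / e)) => //; first exact: cmeas_divid.
move=> t; rewrite /= in_itv/= => /andP[et _]; rewrite cabs_div.
have t0 : 0 < t by exact: lt_le_trans et.
apply: ler_pM => //; first exact: cabs_ge0.
by rewrite gtr0_norm// lef_pV2.
Qed.

Lemma cintg_div_neg H B e M : cmeas H -> (forall t, cabs (H t) <= B) -> 0 < e -> cintg `[- M, - e] (fun t => H t / t%:C%C).
Proof.
move=> mH HB e0; apply: (@cintg_bnd _ _ _ (- M) (- e) (B / e)) => //; first exact: cmeas_divid.
move=> t; rewrite /= in_itv/= => /andP[_ te]; rewrite cabs_div.
have t0 : t < 0 by rewrite (le_lt_trans te)// oppr_lt0.
apply: ler_pM => //; first exact: cabs_ge0.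
by rewrite ltr0_norm// lef_pV2 ?posrE ?oppr_gt0// lerNr.
Qed.

Lemma cintg_fold H B e M : cmeas H -> (forall t, cabs (H t) <= B) -> 0 < e ->
  cintg `[e, M] (fun t => (H t - H (- t)) / t%:C%C).
Proof.
move=> mH HB e0; apply: (@cintg_div_pos (fun t => H t - H (- t)) (B + B)) => //.
  by apply: cmeasB => //; exact: cmeas_neg.
by move=> t; apply: (le_trans (cabsB _ _)); apply: lerD.
Qed.

Lemma pvint_split e M H B : cmeas H -> (forall t, cabs (H t) <= B) -> 0 < e ->
  pvint e M H = cintegral `[e, M] (fun t => H t / t%:C%C) + cintegral `[- M, - e] (fun t => H t / t%:C%C).
Proof.
move=> mH HB e0; have i1 := cintg_div_pos M mH HB e0; have i2 := cintg_div_neg M mH HB e0.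
rewrite -[in X in _ + X](sub0r M) -[in X in _ + X](sub0r e) -cint_reflect ?sub0r//.
rewrite -cintD//.
- apply: cint_eq => t _; rewrite sub0r rmorphN invrN mulrN.
  by rewrite mulrBl.
- apply: (@cintg_eq _ _ (fun t => - 1 * (H (- t) / t%:C%C))) => //.
    by move=> t _; rewrite sub0r rmorphN invrN mulrN mulN1r.
  apply: cintgM => //; apply: cintg_div_pos => //; exact: cmeas_neg.
Qed.

Lemma cint_pvint (b : bool) e M H B : cmeas H -> (forall t, cabs (H t) <= B) -> 0 < e -> e <= M ->
  cintegral [set t | `|t| \in Interval (BRight e) (BSide b M)] (fun t => H t / t%:C%C) = pvint e M H.
Proof.
move=> mH HB e0 eM; have i1 := cintg_div_pos M mH HB e0; have i2 := cintg_div_neg M mH HB e0.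
have i0 : cintg [set t | `|t| \in Interval (BRight e) (BSide b M)] (fun t => H t / t%:C%C).
  have tM t : `|t| \in Interval (BRight e) (BSide b M) -> e < `|t| <= M.
    rewrite itv_boundlr /= !bnd_simp => /andP[-> h] /=.
    by move: h; clear; case: b; rewrite bnd_simp// => /ltW.
  apply: (@cintg_bnd _ _ _ (- M) M (B / e)).
  - rewrite -[X in measurable X]setTI.
    exact: (@normr_measurable R setT measurableT _ (measurable_itv (Interval (BRight e) (BSide b M)))).
  - by move=> t /tM /andP[_]; rewrite ler_norml /= in_itv.
  - exact: cmeas_divid.
  - move=> t /tM /andP[et _]; rewrite cabs_div; apply: ler_pM => //; first exact: cabs_ge0.
    by rewrite lef_pV2 ?posrE ?(lt_trans e0 et)// ltW.
by rewrite cint_abs// (pvint_split M mH HB e0).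
Qed.

Lemma pvint_chasles a b c H B : cmeas H -> (forall t, cabs (H t) <= B) -> 0 < a -> a <= b -> b <= c ->
  pvint a c H = pvint a b H + pvint b c H.
Proof. by move=> mH HB a0 ab bc; apply: cint_chasles => //; exact: cintg_fold HB a0. Qed.

Lemma pvint_small a b H L : cmeas H -> 0 < a -> a <= b -> 0 <= L ->
  (forall t, 0 < t -> t <= b -> cabs (H t - H (- t)) <= L * t) -> cabs (pvint a b H) <= 2 * (L * (b - a)).
Proof.
move=> mH a0 ab L0 HL; apply: cint_bnd => //; first exact: cmeas_fold.
move=> t; rewrite /= in_itv/= => /andP[at_ tb]; have t0 : 0 < t by exact: lt_le_trans at_.
by rewrite cabs_div (gtr0_norm t0) ler_pdivrMr// HL.
Qed.
End TruncatedPV.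

(** * Uniform bounds and convergence for the multiplier $m_2$ *)

Section Multiplier.
Context {R : realType}.
Local Notation C := R[i].
Local Notation Re := (@complex.Re R).
Local Notation Im := (@complex.Im R).
Local Notation mu := (@lebesgue_measure R).
Implicit Types (xi eta e M : R).

Let E xi eta (t : R) : C := expi (xi * t + eta * t ^+ 2).

Let mphase xi eta : measurable_fun setT (fun t : R => xi * t + eta * t ^+ 2).
Proof. by apply: measurable_funD; apply: measurable_funM => //; exact: measurable_funX. Qed.

Let mE xi eta : cmeas (E xi eta).
Proof. by apply: cmeas_expi; exact: mphase. Qed.

Let bE xi eta t : cabs (E xi eta t) <= 1.
Proof. by rewrite cabs_expi. Qed.

Let E_fold xi eta t : cabs (E xi eta t - E xi eta (- t)) <= 4 * `|xi| * `|t|.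
Proof.
apply: (le_trans (cabs_expiB _ _)).
have -> : xi * t + eta * t ^+ 2 - (xi * - t + eta * (- t) ^+ 2) = 2 * (xi * t) by ring.
by rewrite !normrM (ger0_norm (ltW _))//; lra.
Qed.

(** Folding replaces $t$ by $-t$, that is $\xi$ by $-\xi$. Two phases with two components each make
    four cosine integrals, hence the factor 4. *)
Let pv_osc xi eta a b K : 0 < a -> a <= b ->
  (forall s th, s = 1 \/ s = -1 -> `|\int[mu]_(t in `[a, b]) (cos (s * xi * t + eta * t ^+ 2 + th) / t)| <= K) ->
  cabs (pvint a b (E xi eta)) <= 4 * K.
Proof.
move=> a0 ab HK.
have [i1 i1'] := cintg_div_pos b (mE xi eta) (bE xi eta) a0.
have [i2 i2'] := cintg_div_pos b (mE (- xi) eta) (bE (- xi) eta) a0.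
have -> : pvint a b (E xi eta) = cintegral `[a, b] (fun t => E xi eta t / t%:C%C) - cintegral `[a, b] (fun t => E (- xi) eta t / t%:C%C).
  rewrite -cintB//; apply: cint_eq => t _; rewrite mulrBl; congr (_ - _ / _).
  by rewrite /E sqrrN mulrN mulNr.
have H s : s = 1 \/ s = -1 -> cabs (cintegral `[a, b] (fun t => E (s * xi) eta t / t%:C%C)) <= K + K.
  move=> hs; apply: (le_trans (cabs_le_ReIm _)); rewrite Re_cint Im_cint; apply: lerD.
    have := HK s 0 hs; congr (`|_| <= _); apply: eq_Rintegral => t _.
    by rewrite cdivr/= addr0.
  have := HK s (- (pi / 2)) hs; congr (`|_| <= _); apply: eq_Rintegral => t _.
  by rewrite cdivr/= cosBpihalf.
have h1 := H 1 (or_introl erefl); have h2 := H (-1) (or_intror erefl).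
rewrite mul1r in h1; rewrite mulN1r in h2.
apply: (le_trans (cabsB _ _)); apply: (le_trans (lerD h1 h2)); lra.
Qed.

Let xi_sign xi s : s = 1 \/ s = -1 -> `|s * xi| = `|xi|.
Proof. by move=> [->|->]; rewrite ?mul1r// mulN1r normrN. Qed.

(** The split is at $|\xi|^{-1}$. Below it the even part of the phase cancels in the fold, which is
    $O(|\xi| t)$ and contributes 8; above it [oscillatory_uniform] contributes $4 \cdot 19 = 76$.
    For $\xi = 0$ the fold is identically 0. *)
Lemma pvint_expi_bound xi eta a b : 0 < a -> a <= b -> cabs (pvint a b (E xi eta)) <= 84.
Proof.
move=> a0 ab; have [->|xi0] := eqVneq xi 0.
  rewrite (_ : pvint _ _ _ = 0) ?cabs0//.
  have -> : pvint a b (E 0 eta) = cintegral `[a, b] (fun=> 0).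
    by apply: cint_eq => t _; rewrite /E !mul0r sqrrN subrr mul0r.
  by rewrite /cintegral /Rintegral/= !integral0.
have x0 : 0 < `|xi| by rewrite normr_gt0.
have big a' b' : `|xi|^-1 <= a' -> a' <= b' -> cabs (pvint a' b' (E xi eta)) <= 76.
  move=> xa ab'; have -> : (76 : R) = 4 * 19 by ring.
  apply: pv_osc => //; first by apply: lt_le_trans xa; rewrite invr_gt0.
  move=> s th hs; apply: oscillatory_uniform => //; first by rewrite -normr_gt0 xi_sign.
  by rewrite xi_sign.
have small a' b' : 0 < a' -> a' <= b' -> b' <= `|xi|^-1 -> cabs (pvint a' b' (E xi eta)) <= 8.
  move=> a0' ab' bx; apply: (@le_trans _ _ (2 * ((4 * `|xi|) * (b' - a')))).
    apply: pvint_small => //.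
    by move=> t t0 _; apply: (le_trans (E_fold _ _ _)); rewrite (gtr0_norm t0).
  have : `|xi| * (b' - a') <= 1.
    by rewrite -ler_pdivlMl// mulr1; lra.
  by rewrite -mulrA; move: (`|xi| * _) => u; lra.
have [bx|xb] := leP b `|xi|^-1; first by rewrite (le_trans (small _ _ a0 ab bx))//; lra.
have [ax|xa] := leP a `|xi|^-1; last by rewrite (le_trans (big _ _ (ltW xa) ab))//; lra.
rewrite (pvint_chasles (mE xi eta) (bE xi eta) a0 ax (ltW xb)).
apply: (le_trans (cabsD _ _)).
have h1 := small _ _ a0 ax (lexx _); have h2 := big _ _ (lexx _) (ltW xb); lra.
Qed.

(** Beyond $t = |\xi|/|\eta|$ the derivative of the phase is at least $|\xi|$, so integration by
    parts gives $O(1/a)$. The constants depend on $\xi$ and $\eta$, since only existence of the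
    limit is at stake. *)
Lemma pvint_expi_tail xi eta : xi != 0 -> exists C A, forall a b, A <= a -> a <= b ->
  cabs (pvint a b (E xi eta)) <= C / a.
Proof.
move=> xi0; have x0 : 0 < `|xi| by rewrite normr_gt0.
(* For $\eta = 0$ the quotient is 0 by convention; the summand 1 keeps the threshold positive. *)
exists (4 * (8 / `|xi|)), (`|xi| / `|eta| + 1) => a b Aa ab.
have a0 : 0 < a by apply: lt_le_trans Aa; rewrite ltr_wpDl// divr_ge0.
rewrite -mulrA -mulrA -invfM; apply: pv_osc => // s th hs.
rewrite -(xi_sign xi hs); apply: oscillatory_bound => //; first by rewrite xi_sign.
move=> t /andP[at_ _]; rewrite (xi_sign xi hs).
have t0 : 0 < t by exact: lt_le_trans at_.
have [->|e0] := eqVneq eta 0.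
  by rewrite normr0 mulr0 !mul0r addr0 (xi_sign xi hs); split => //; lra.
have en : 0 < `|eta| by rewrite normr_gt0.
have xt : `|xi| <= `|eta| * t.
  by rewrite -ler_pdivrMl// mulrC; apply: le_trans at_; lra.
have h := lerB_normD (2 * eta * t) (s * xi); rewrite (addrC (2 * eta * t)) (xi_sign xi hs) in h.
have e2 : `|2 * eta * t| = 2 * (`|eta| * t) by rewrite !normrM (gtr0_norm t0) (ger0_norm (ltW _))// mulrA.
move: h; rewrite e2; move: (`|eta| * t) xt => u xt h; split; lra.
Qed.

Definition m2t e xi eta : C :=
  cintegral [set t | e < `|t| < e^-1] (fun t => expi (xi * t + eta * t ^+ 2) / t%:C%C).

Lemma m2t_pvint e xi eta : 0 < e -> e <= 1 -> m2t e xi eta = pvint e e^-1 (E xi eta).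
Proof.
move=> e0 e1; rewrite -(@cint_pvint _ true _ _ _ 1)//; by rewrite (le_trans e1)// invf_ge1.
Qed.

Lemma m2t_bound e xi eta : 0 < e -> cabs (m2t e xi eta) <= 84.
Proof.
move=> e0; have [e1|e1] := leP e 1.
  by rewrite m2t_pvint//; apply: pvint_expi_bound => //; rewrite (le_trans e1)// invf_ge1.
(* For $e > 1$ the range $e < |t| < 1/e$ is empty. *)
rewrite /m2t (_ : [set t : R | e < `|t| < e^-1] = set0).
  by rewrite /cintegral !Rintegral_set0 cabs0.
apply/seteqP; split => // t /= /andP[h1 h2].
have : e^-1 < 1 by rewrite invf_lt1.
lra.
Qed.

(** Passing from $e'$ to $e$ adds the pieces $[e, e']$ and $[1/e', 1/e]$: the first is $O(e')$ by
    the fold, the second by the tail bound at $a = 1/e'$. *)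
Lemma m2_cvg xi eta : ccvg 0^'+ (fun e => m2t e xi eta) (m2 xi eta).
Proof.
suff [C1 [s [s0 H]]] : exists C1 s, 0 < s /\ forall e e', 0 < e -> e <= e' -> e' < s -> cabs (m2t e xi eta - m2t e' xi eta) <= C1 * e'.
  split.
    apply: (@cvg0_cauchy _ (fun e => Re (m2t e xi eta)) C1 s) => // e e' e0 ee' es.
    by rewrite -ReN -ReD (le_trans (Re_le_cabs _))// H.
  apply: (@cvg0_cauchy _ (fun e => Im (m2t e xi eta)) C1 s) => // e e' e0 ee' es.
  by rewrite -ImN -ImD (le_trans (Im_le_cabs _))// H.
have inv1 e : 0 < e -> e <= 1 -> 1 <= e^-1 by move=> e0 e1; rewrite invf_ge1.
have step e e' : 0 < e -> e <= e' -> e' <= 1 -> m2t e xi eta - m2t e' xi eta = pvint e e' (E xi eta) + pvint e'^-1 e^-1 (E xi eta).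
  move=> e0 ee' e1; have e0' : 0 < e' by exact: lt_le_trans ee'.
  have i1 := inv1 _ e0' e1.
  have i2 : e'^-1 <= e^-1 by rewrite lef_pV2.
  rewrite !m2t_pvint//; last exact: le_trans ee' e1.
  rewrite (pvint_chasles (mE xi eta) (bE xi eta) e0 ee' (le_trans (le_trans e1 i1) i2)).
  rewrite (pvint_chasles (mE xi eta) (bE xi eta) e0' (le_trans e1 i1) i2).
  by rewrite addrA addrAC [_ + pvint e' _ _]addrC; ring.
have [xi0|xi0] := eqVneq xi 0.
  exists 0, 1; split => // e e' e0 ee' e1; rewrite (step _ _ e0 ee' (ltW e1)).
  have Z a b : pvint a b (E xi eta) = 0.
    have -> : pvint a b (E xi eta) = cintegral `[a, b] (fun=> 0).
      by apply: cint_eq => t _; rewrite /E xi0 !mul0r sqrrN subrr mul0r.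
    by rewrite /cintegral /Rintegral/= !integral0.
  by rewrite !Z addr0 cabs0 mul0r.
have [C1 [A HA]] := pvint_expi_tail eta xi0.
(* For $e' < (|A|+1)^{-1}$ one has $1/e' \ge A$, the range of the tail bound. *)
exists (8 * `|xi| + C1), (Num.min 1 (`|A| + 1)^-1); split.
  by rewrite lt_min ltr01 invr_gt0 ltr_wpDl.
move=> e e' e0 ee'; rewrite lt_min => /andP[/ltW e1 eA].
have e0' : 0 < e' by exact: lt_le_trans ee'.
rewrite step//; apply: (le_trans (cabsD _ _)); rewrite mulrDl; apply: lerD.
  apply: (@le_trans _ _ (2 * ((4 * `|xi|) * (e' - e)))).
    apply: pvint_small => //.
    by move=> t t0 _; apply: (le_trans (E_fold _ _ _)); rewrite (gtr0_norm t0).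
  have -> : 8 * `|xi| * e' = 2 * ((4 * `|xi|) * e') by ring.
  by apply: ler_wpM2l => //; apply: ler_wpM2l; [rewrite mulr_ge0|lra].
rewrite -[X in _ * X]invrK; apply: HA; last by rewrite lef_pV2.
have : `|A| + 1 <= e'^-1 by rewrite -[leLHS]invrK lef_pV2 ?posrE ?invr_gt0 ?ltr_wpDl// ltW.
have := ler_norm A; lra.
Qed.
End Multiplier.

(** * The operators as principal values along the curve $x + (\alpha t + \delta t^2)/(2\pi)$ *)

Section KernelRepresentation.
Context {R : realType}.
Local Notation C := R[i].
Local Notation Re := (@complex.Re R).
Local Notation Im := (@complex.Im R).
Local Notation mu := (@lebesgue_measure R).

Lemma lip_continuous (g : R -> R) k : (forall x y, `|g x - g y| <= k * `|x - y|) -> continuous g.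
Proof.
move=> H x; apply/cvgrPdist_le => eps eps0.
pose k' := `|k| + 1; have k0 : 0 < k' by rewrite /k' ltr_wpDl.
near=> y; apply: (le_trans (H x y)).
apply: (@le_trans _ _ (k' * `|x - y|)).
  by apply: ler_wpM2r => //; rewrite /k' (le_trans (ler_norm _))// lerDl.
rewrite -ler_pdivlMl// mulrC; near: y.
by apply: cvgr_dist_le; [exact: cvg_id|rewrite divr_gt0].
Unshelve. all: by end_near.
Qed.

Lemma lip_cmeas (F : R -> C) k : (forall x y, cabs (F x - F y) <= k * `|x - y|) -> cmeas F.
Proof.
move=> H; split; apply: continuous_measurable_fun; apply: (@lip_continuous _ k) => x y.
  by rewrite -ReN -ReD (le_trans (Re_le_cabs _)).
by rewrite -ImN -ImD (le_trans (Im_le_cabs _)).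
Qed.

Lemma ccvgMr (T : Type) (Fil : set_system T) {PF : ProperFilter Fil} (u : T -> C) l z : ccvg Fil u l -> ccvg Fil (fun t => u t * z) (l * z).
Proof.
move=> [h1 h2]; split.
  under eq_fun do rewrite ReM; rewrite ReM.
  by apply: cvgB; apply: cvgMl.
under eq_fun do rewrite ImM; rewrite ImM.
by apply: cvgD; apply: cvgMl.
Qed.

Lemma cmeas_lim (F_ : nat -> R -> C) (F : R -> C) : (forall n, cmeas (F_ n)) ->
  (forall x, ccvg \oo (F_ ^~ x) (F x)) -> cmeas F.
Proof.
move=> mF FF; split.
  apply: (@measurable_fun_cvg _ _ _ setT (fun n x => Re (F_ n x))) => [n|x _].
    by case: (mF n).
  by case: (FF x).
apply: (@measurable_fun_cvg _ _ _ setT (fun n x => Im (F_ n x))) => [n|x _].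
  by case: (mF n).
by case: (FF x).
Qed.

(** This serves only to make the truncated multipliers, and hence their limit, measurable; the
    growth of the constant as $e \to 0$ is harmless. *)
Lemma m2t_lip (e xi eta xi' eta' : R) : 0 < e ->
  cabs (m2t e xi eta - m2t e xi' eta') <= 2 * (2 * (`|xi - xi'| + `|eta - eta'| * e^-1) * (e^-1 - - e^-1)).
Proof.
move=> e0; pose D := [set t : R | e < `|t| < e^-1].
have ei0 : 0 < e^-1 by rewrite invr_gt0.
have mD : measurable D.
  have -> : D = (fun t : R => `|t|) @^-1` `]e, e^-1[ by apply/seteqP; split => t /=; rewrite in_itv.
  by rewrite -[X in measurable X]setTI; apply: normr_measurable => //; exact: measurable_itv.
have sD : D `<=` `[- e^-1, e^-1] by move=> t /andP[_ /ltW]; rewrite ler_norml /= in_itv.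
have mph a b : measurable_fun setT (fun t : R => a * t + b * t ^+ 2).
  by apply: measurable_funD; apply: measurable_funM => //; exact: measurable_funX.
have mE a b : cmeas (fun t : R => expi (a * t + b * t ^+ 2) / t%:C%C : C).
  by apply: cmeas_div => //; exact: cmeas_expi.
have iE a b : cintg D (fun t : R => expi (a * t + b * t ^+ 2) / t%:C%C).
  apply: (@cintg_bnd _ _ _ (- e^-1) e^-1 e^-1) => // t /andP[et _].
  by rewrite cabs_div cabs_expi mul1r lef_pV2 ?posrE ?(lt_trans e0 et)// ltW.
rewrite /m2t -cintB//; apply: cint_bnd => //.
- by rewrite (le_trans _ (ltW ei0))// oppr_le0 ltW.
- exact: cmeasB.
- by rewrite mulr_ge0// addr_ge0// mulr_ge0// ltW.
- move=> t Dt; move: (Dt) => /andP[et te]; have t0 : 0 < `|t| by exact: lt_trans et.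
  rewrite -mulrBl cabs_div ler_pdivrMr//; apply: (le_trans (cabs_expiB _ _)).
  rewrite -mulrA; apply: ler_wpM2l => //.
  have -> : xi * t + eta * t ^+ 2 - (xi' * t + eta' * t ^+ 2) = (xi - xi') * t + (eta - eta') * t * t by ring.
  apply: (le_trans (ler_normD _ _)); rewrite !normrM mulrDl; apply: lerD => //.
  by apply: ler_wpM2r => //; apply: ler_wpM2l => //; exact: ltW.
Qed.

Variables (f : R -> C) (K N x al be de ga : R).
Hypothesis sf : csmooth f K.

Let c := N / (2 * pi).
Let y t := x + (al * t + de * t ^+ 2) / (2 * pi).
(* The parameters (al, be, de, ga) are (a, b, 1, 0) for a finite slope a and
   (1, 0, 0, b) for the slope +oo. *)
Definition kern (t : R) : C := expi (be * t + ga * t ^+ 2) * (expi (N * y t) * f (y t)).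
Let Z eta : C := fourier f (eta - c) * expi (2 * pi * x * eta).
Definition kern_mult : C := cintegral setT (fun eta => m2 (al * eta + be) (de * eta + ga) * Z eta).

Let my : measurable_fun setT y.
Proof.
apply: measurable_funD => //; apply: measurable_funM => //.
by apply: measurable_funD; apply: measurable_funM => //; exact: measurable_funX.
Qed.

Lemma kern_meas : cmeas kern.
Proof.
apply: cmeasM.
  by apply: cmeas_expi; apply: measurable_funD; apply: measurable_funM => //; exact: measurable_funX.
apply: cmeasM; first by apply: cmeas_expi; exact: measurable_funM.
by apply: cmeas_comp (csmooth_meas sf); exact: my.
Qed.

Lemma kern_bound t : cabs (kern t) <= 2 * K.
Proof. by rewrite /kern !cabsM !cabs_expi !mul1r; exact: csmooth_bound1. Qed.

Let mZ : cmeas Z.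
Proof.
apply: cmeasM; last by apply: cmeas_expi; exact: measurable_funM.
by apply: cmeas_comp (fourier_meas sf); exact: measurable_funB.
Qed.

(** The form [1 * eta + - c] is that of [integrable_affine]. *)
Let kZ eta := 8 * K * pi * wgt (1 * eta + - c).

Let kZ_ge0 eta : 0 <= kZ eta.
Proof. by rewrite /kZ !mulr_ge0 ?wgt_ge0 ?pi_ge0// ltW// (csmooth_gt0 sf). Qed.

Let Z_bound eta : cabs (Z eta) <= kZ eta.
Proof. by rewrite /Z /kZ cabsM cabs_expi mulr1 mul1r; exact: fourier_bound. Qed.

Let kZ_int : mu.-integrable setT (EFin \o kZ).
Proof.
exact: (@integrable_affine _ 1 (- c) (EFin \o (fun u => 8 * K * pi * wgt u)) (oner_neq0 _) (integrable_Zwgt _)).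
Qed.

Let m2t_meas e : 0 < e -> cmeas (fun eta => m2t e (al * eta + be) (de * eta + ga)).
Proof.
move=> e0; apply: (@lip_cmeas _ (2 * (2 * (`|al| + `|de| * e^-1) * (e^-1 - - e^-1)))) => u v.
apply: (le_trans (m2t_lip _ _ _ _ e0)).
have -> : al * u + be - (al * v + be) = al * (u - v) by ring.
have -> : de * u + ga - (de * v + ga) = de * (u - v) by ring.
by rewrite !normrM le_eqVlt; apply/orP; left; apply/eqP; ring.
Qed.

(** The total phase is affine in $\eta$: it equals $\beta t + \gamma t^2 + 2\pi\, y(t)\, \eta$.
    After Fubini, which the truncation makes legitimate, the integral over $\eta$ is Fourier
    inversion at the point $y(t)$ for the modulated function. *)
Let m2t_fubini e : 0 < e -> e <= 1 ->
  cintegral setT (fun eta => m2t e (al * eta + be) (de * eta + ga) * Z eta) = pvint e e^-1 kern.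
Proof.
move=> e0 e1; pose D := [set t : R | e < `|t| < e^-1].
have mD : measurable D.
  have -> : D = (fun t : R => `|t|) @^-1` `]e, e^-1[ by apply/seteqP; split => t /=; rewrite in_itv.
  by rewrite -[X in measurable X]setTI; apply: normr_measurable => //; exact: measurable_itv.
have sD : D `<=` `[- e^-1, e^-1] by move=> t /andP[_ /ltW]; rewrite ler_norml /= in_itv.
pose ph eta t : R := (al * eta + be) * t + (de * eta + ga) * t ^+ 2.
pose G eta t : C := ((\1_D t)%:C%C * (expi (ph eta t) / t%:C%C)) * Z eta.
have mph eta : measurable_fun setT (ph eta).
  by apply: measurable_funD; apply: measurable_funM => //; exact: measurable_funX.
have b1 t : cabs ((\1_D t)%:C%C / t%:C%C : C) <= \1_`[- e^-1, e^-1] t * e^-1.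
  rewrite cabs_div cabs_real !indicE; have [tD|tD] := boolP (t \in D); last first.
    by rewrite normr0 mul0r mulr_ge0// invr_ge0 ltW.
  rewrite mem_set ?mul1r; last by apply: sD; rewrite inE in tD.
  rewrite inE in tD; move: tD => /andP[et _]; rewrite normr1 mul1r lef_pV2 ?posrE ?(lt_trans e0 et)//.
  exact: ltW.
have iD eta : cintg D (fun t => expi (ph eta t) / t%:C%C : C).
  apply: (@cintg_bnd _ _ _ (- e^-1) e^-1 e^-1) => //.
    by apply: cmeas_div => //; exact: cmeas_expi.
  move=> t /andP[et _]; rewrite cabs_div cabs_expi mul1r lef_pV2 ?posrE ?(lt_trans e0 et)//.
  exact: ltW.
transitivity (cintegral setT (fun eta => cintegral setT (fun t => G eta t))).
  apply: cint_eq => eta _; rewrite /m2t cint_mkcond mulrC -cintM//; last exact: (cintg_mkcond mD (iD eta)).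
  by apply: cint_eq => t _; rewrite /G mulrC.
rewrite (@cfubini _ G kZ (fun t => \1_`[- e^-1, e^-1] t * e^-1)) //; first last.
- move=> eta t; rewrite /G cabsM mulrC; apply: ler_pM; [exact: cabs_ge0|exact: cabs_ge0|exact: Z_bound|].
  by rewrite mulrCA cabsM cabs_expi mul1r.
- by move=> t; rewrite mulr_ge0// invr_ge0 ltW.
- rewrite /comp; under eq_fun do rewrite EFinM muleC.
  by apply: integrableZl => //; exact: integrable_indic_itv.
- apply: cmeasM; last exact: cmeas_fst.
  apply: cmeasM.
    apply: (@cmeas_snd _ (fun t => (\1_D t)%:C%C)); apply: cmeas_real.
    exact: measurable_indic.
  apply: cmeas_div; last exact: msnd.
  have m1 := @mfst R; have m2 := @msnd R.
  apply: cmeas_expi; apply: measurable_funD; apply: measurable_funM => //.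
  + by apply: measurable_funD => //; exact: measurable_funM.
  + by apply: measurable_funD => //; exact: measurable_funM.
  + exact: measurable_funX.
transitivity (cintegral setT (fun t => (\1_D t)%:C%C * (kern t / t%:C%C))).
  apply: cint_eq => t _.
  have iF : cintg setT (fun eta => fourier f (eta - c) * expi (2 * pi * y t * eta)).
    apply: (@cintg_le _ _ _ kZ) => //.
      apply: cmeasM; last by apply: cmeas_expi; exact: measurable_funM.
      by apply: cmeas_comp (fourier_meas sf); exact: measurable_funB.
    by move=> eta _; rewrite cabsM cabs_expi mulr1 /kZ mul1r; exact: fourier_bound.
  rewrite /kern -(fourier_inversion_modulation N (y t) sf) -/c.
  transitivity (((\1_D t)%:C%C / t%:C%C * expi (be * t + ga * t ^+ 2)) * cintegral setT (fun eta => fourier f (eta - c) * expi (2 * pi * y t * eta))).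
    rewrite -cintM//; apply: cint_eq => eta _; rewrite /G /Z.
    have e2 : ph eta t + 2 * pi * x * eta = (be * t + ga * t ^+ 2) + 2 * pi * y t * eta.
      rewrite /ph /y; have : (2 * pi : R) != 0 by rewrite gt_eqF// mulr_gt0// pi_gt0.
      move: (2 * pi : R) => P P0; by field.
    have e3 : expi (ph eta t) * expi (2 * pi * x * eta) = expi (be * t + ga * t ^+ 2) * expi (2 * pi * y t * eta) :> C.
      by rewrite -!expiD e2.
    move: e3; move: (expi (ph eta t)) (expi (2 * pi * x * eta)) (expi (be * t + _)) (expi (2 * pi * y t * eta)) => a1 a2 a3 a4 e3.
    transitivity ((\1_D t)%:C%C / t%:C%C * fourier f (eta - c) * (a1 * a2)); first by ring.
    by rewrite e3; ring.
  by ring.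
rewrite -cint_mkcond -(@cint_pvint _ true _ _ _ (2 * K))//.
- exact: kern_meas.
- exact: kern_bound.
- by rewrite (le_trans e1)// invf_ge1.
Qed.

(** Dominated convergence in $\eta$: the bound 84 of [m2t_bound] is uniform in the truncation and
    the frequencies, and the transform of $f$ is integrable. *)
Lemma kern_mult_cvg : ccvg \oo (fun n => pvint (n.+1%:R^-1) (n.+1%:R^-1)^-1 kern) kern_mult.
Proof.
have e0 n : 0 < n.+1%:R^-1 :> R by rewrite invr_gt0.
have e1 n : n.+1%:R^-1 <= 1 :> R by rewrite invf_le1// ler1n.
have -> : (fun n : nat => pvint (n.+1%:R^-1) (n.+1%:R^-1)^-1 kern) =
  (fun n => cintegral setT (fun eta => m2t (n.+1%:R^-1) (al * eta + be) (de * eta + ga) * Z eta)).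
  by apply/funext => n; rewrite m2t_fubini.
have cv eta : ccvg \oo (fun n => m2t (n.+1%:R^-1) (al * eta + be) (de * eta + ga)) (m2 (al * eta + be) (de * eta + ga)).
  have [/cvg_at_rightP h1 /cvg_at_rightP h2] := m2_cvg (al * eta + be) (de * eta + ga).
  by split; [apply: h1|apply: h2]; split => //; exact: cvg_harmonic.
apply: (@cint_dominated _ _ _ (fun eta => 84 * kZ eta)).
- by move=> n; apply: cmeasM => //; exact: m2t_meas.
- apply: cmeasM => //; apply: cmeas_lim cv => n; exact: m2t_meas.
- by move=> eta; apply: ccvgMr; exact: cv.
- by move=> n eta; rewrite cabsM; apply: ler_pM => //; [exact: cabs_ge0|exact: cabs_ge0|exact: m2t_bound].
- rewrite /comp; under eq_fun do rewrite EFinM.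
  by apply: integrableZl => //; exact: kZ_int.
Qed.
End KernelRepresentation.

Section MultopKernel.
Context {R : realType}.
Local Notation C := R[i].

Lemma multop_fin (f : R -> C) (a b N x : R) :
  multop a%:E b (fun y => expi (N * y) * f y) x = kern_mult f N x a b 1 0.
Proof.
apply: cint_eq => eta _; rewrite fourier_modulation /= mul1r addr0 -mulrA; congr (_ * (_ * expi _)).
Qed.

Lemma multop_pinfty (f : R -> C) (b N x : R) :
  multop +oo%E b (fun y => expi (N * y) * f y) x = kern_mult f N x 1 0 0 b.
Proof.
apply: cint_eq => eta _; rewrite fourier_modulation /= mul1r mul0r addr0 add0r -mulrA; congr (_ * (_ * expi _)).
Qed.
End MultopKernel.

(** * The maximal operators with bounded truncation *)

Section PrincipalValue.
Context {R : realType}.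
Local Notation C := R[i].
Local Notation Re := (@complex.Re R).
Local Notation Im := (@complex.Im R).
Local Notation mu := (@lebesgue_measure R).
Implicit Types (H : R -> C) (B L r e : R).

Lemma cvg_cabs (T : Type) (Fil : set_system T) {PF : ProperFilter Fil} (u : T -> C) l :
  ccvg Fil u l -> cabs (u t) @[t --> Fil] --> cabs l.
Proof.
move=> [h1 h2].
have -> : (fun t => cabs (u t)) = (fun t => Num.sqrt (Re (u t) * Re (u t) + Im (u t) * Im (u t))).
  by apply/funext => t; rewrite /cabs -!expr2; case: (u t).
have -> : cabs l = Num.sqrt (Re l * Re l + Im l * Im l) by rewrite /cabs -!expr2; case: l {h1 h2}.
apply: continuous_cvg; first exact: sqrt_continuous.
by apply: cvgD; apply: cvgM.
Qed.

Lemma ccvgB (T : Type) (Fil : set_system T) {PF : ProperFilter Fil} (u v : T -> C) l m :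
  ccvg Fil u l -> ccvg Fil v m -> ccvg Fil (fun t => u t - v t) (l - m).
Proof.
move=> [h1 h2] [h3 h4]; split.
  by under eq_fun do rewrite ReD ReN; rewrite ReD ReN; exact: cvgB.
by under eq_fun do rewrite ImD ImN; rewrite ImD ImN; exact: cvgB.
Qed.

Lemma ccvg_cst (T : Type) (Fil : set_system T) {PF : ProperFilter Fil} (l : C) : ccvg Fil (fun=> l) l.
Proof. by split; exact: cvg_cst. Qed.

Lemma ccvg_le (T : Type) (Fil : set_system T) {PF : ProperFilter Fil} (u : T -> C) l k :
  ccvg Fil u l -> (\forall t \near Fil, cabs (u t) <= k) -> cabs l <= k.
Proof.
move=> cu uk; exact: (cvgr_to_le (cvg_cabs cu) uk).
Qed.

Lemma eq_near_ccvg (T : Type) (Fil : set_system T) {PF : ProperFilter Fil} (u v : T -> C) l :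
  (\forall t \near Fil, u t = v t) -> ccvg Fil u l -> ccvg Fil v l.
Proof.
move=> uv [h1 h2]; split.
  by apply: cvg_trans h1; apply: near_eq_cvg; apply: filterS uv => t ->.
by apply: cvg_trans h2; apply: near_eq_cvg; apply: filterS uv => t ->.
Qed.

Definition pv r H : C := clim0 (fun e => cintegral [set t | e < `|t| <= r] (fun t => H t / t%:C%C)).

(** Conditions that give a principal value at 0 with a quantitative rate. The range $|t| \le 1/2$
    stays away from $t = -1$, where the bracket is not Lipschitz. *)
Definition pv_regular H B L := [/\ cmeas H, forall t, cabs (H t) <= B, 0 <= L &
  forall t, 0 < t -> t <= 2^-1 -> cabs (H t - H (- t)) <= L * t].

Lemma cint_pv_pvint r H B L e : pv_regular H B L -> 0 < e -> e <= r ->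
  cintegral [set t | e < `|t| <= r] (fun t => H t / t%:C%C) = pvint e r H.
Proof.
move=> [mH HB _ _] e0 er; rewrite -(@cint_pvint _ false _ _ _ B)//.
Qed.

Lemma pvint_cauchy r H B L e e' : pv_regular H B L -> 0 < e -> e <= e' -> e' <= r -> e' <= 2^-1 ->
  cabs (pvint e r H - pvint e' r H) <= 2 * L * e'.
Proof.
move=> [mH HB L0 HL] e0 ee' er e2; rewrite (pvint_chasles mH HB e0 ee' er) addrK.
apply: (@le_trans _ _ (2 * (L * (e' - e)))).
  by apply: pvint_small => // t t0 te; apply: HL => //; exact: le_trans e2.
rewrite -mulrA; apply: ler_wpM2l => //; apply: ler_wpM2l => //; lra.
Qed.

Lemma pv_cvg0 r H B L : pv_regular H B L -> 0 < r ->
  ccvg 0^'+ (fun e => cintegral [set t | e < `|t| <= r] (fun t => H t / t%:C%C)) (pv r H).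
Proof.
move=> PR r0.
suff Hc e e' : 0 < e -> e <= e' -> e' < Num.min r 2^-1 ->
    cabs (cintegral [set t | e < `|t| <= r] (fun t => H t / t%:C%C) - cintegral [set t | e' < `|t| <= r] (fun t => H t / t%:C%C)) <= 2 * L * e'.
  have m0 : 0 < Num.min r 2^-1 by rewrite lt_min r0 invr_gt0/=.
  split.
    apply: (@cvg0_cauchy _ (fun e => Re (cintegral [set t | e < `|t| <= r] (fun t => H t / t%:C%C))) (2 * L) (Num.min r 2^-1)) => // e e' e0 ee' em.
    by rewrite -ReN -ReD (le_trans (Re_le_cabs _))// Hc.
  apply: (@cvg0_cauchy _ (fun e => Im (cintegral [set t | e < `|t| <= r] (fun t => H t / t%:C%C))) (2 * L) (Num.min r 2^-1)) => // e e' e0 ee' em.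
  by rewrite -ImN -ImD (le_trans (Im_le_cabs _))// Hc.
move=> e0 ee'; rewrite lt_min => /andP[/ltW er /ltW e2].
rewrite !(cint_pv_pvint PR)//.
- exact: pvint_cauchy PR _ _ _ _.
- exact: lt_le_trans ee'.
- exact: le_trans er.
Qed.

Lemma pv_cvg r H B L : pv_regular H B L -> 0 < r -> ccvg 0^'+ (fun e => pvint e r H) (pv r H).
Proof.
move=> PR r0; apply: eq_near_ccvg (pv_cvg0 PR r0).
near=> e; apply: (cint_pv_pvint PR).
  by near: e; exact: nbhs_right_gt.
by near: e; exact: nbhs_right_le.
Unshelve. all: by end_near.
Qed.

Lemma pv_near r H B L e : pv_regular H B L -> 0 < e -> e <= r -> e <= 2^-1 ->
  cabs (pv r H - pvint e r H) <= 2 * L * e.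
Proof.
move=> PR e0 er e2; have r0 : 0 < r by exact: lt_le_trans er.
apply: (ccvg_le (ccvgB (pv_cvg PR r0) (ccvg_cst (pvint e r H)))).
near=> e'; apply: (pvint_cauchy PR) => //.
by near: e'; exact: nbhs_right_le.
Unshelve. all: by end_near.
Qed.

Lemma pvintB e r H H' B B' : 0 < e -> cmeas H -> (forall t, cabs (H t) <= B) -> cmeas H' -> (forall t, cabs (H' t) <= B') ->
  pvint e r (fun t => H t - H' t) = pvint e r H - pvint e r H'.
Proof.
move=> e0 mH HB mH' HB'; rewrite /pvint -cintB//.
- by apply: cint_eq => t _; rewrite -mulrBl; congr (_ / _); ring.
- exact: cintg_fold HB e0.
- exact: cintg_fold HB' e0.
Qed.

(** The split at $\min(r, 1/2)$ uses $L''$ below and $B''$ above. The bound is linear in the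
    constants of the difference, so that constants proportional to $|x - y|$ give a Lipschitz
    estimate in $x$. *)
Lemma pv_dist r H H' B L B' L' B'' L'' : 0 < r -> pv_regular H B L -> pv_regular H' B' L' ->
  pv_regular (fun t => H t - H' t) B'' L'' ->
  cabs (pv r H - pv r H') <= (4 * (r + 1) / Num.min r 2^-1 + 2) * (B'' + L'').
Proof.
move=> r0 PR PR' PD; have [mD DB L0 DL] := PD.
pose e := Num.min r 2^-1; have e0 : 0 < e by rewrite /e lt_min r0 invr_gt0/=.
have er : e <= r by rewrite /e ge_min lexx.
have e2 : e <= 2^-1 by rewrite /e ge_min lexx orbT.
have B0 : 0 <= B'' by apply: le_trans (DB 0); exact: cabs_ge0.
apply: (ccvg_le (ccvgB (pv_cvg PR r0) (pv_cvg PR' r0))).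
near=> e'.
have e'0 : 0 < e' by near: e'; exact: nbhs_right_gt.
have e'e : e' <= e by near: e'; exact: nbhs_right_le.
have [mH HB _ _] := PR; have [mH' HB' _ _] := PR'.
rewrite -(pvintB r e'0 mH HB mH' HB') (pvint_chasles mD DB e'0 e'e er).
apply: (le_trans (cabsD _ _)).
have h1 : cabs (pvint e' e (fun t => H t - H' t)) <= 2 * L''.
  apply: (@le_trans _ _ (2 * (L'' * (e - e')))).
    by apply: pvint_small => // t t0 te; apply: DL => //; exact: le_trans e2.
  apply: ler_wpM2l => //; rewrite ler_piMr//.
  have : (2^-1 : R) <= 1 by rewrite invf_le1// ler1n.
  lra.
have h2 : cabs (pvint e r (fun t => H t - H' t)) <= 2 * ((B'' + B'') / e * (r - e)).
  apply: cint_bnd => //; first exact: cmeas_fold.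
    by rewrite divr_ge0 ?addr_ge0// ltW.
  move=> t; rewrite /= in_itv/= => /andP[et tr]; have t0 : 0 < t by exact: lt_le_trans et.
  rewrite cabs_div (gtr0_norm t0); apply: ler_pM; first exact: cabs_ge0.
  - by rewrite invr_ge0 ltW.
  - by apply: (le_trans (cabsB _ _)); apply: lerD.
  - by rewrite lef_pV2.
rewrite addrC; apply: (le_trans (lerD h2 h1)); rewrite -/e.
have h3 : (B'' + B'') / e * (r - e) <= (B'' + B'') / e * (r + 1).
  by apply: ler_wpM2l; [rewrite divr_ge0 ?addr_ge0// ltW|lra].
have h4 : 0 <= 4 * (r + 1) / e * L'' by rewrite !mulr_ge0 ?invr_ge0 ?addr_ge0// ltW.
have -> : (4 * (r + 1) / e + 2) * (B'' + L'') = 2 * ((B'' + B'') / e * (r + 1)) + 2 * B'' + 4 * (r + 1) / e * L'' + 2 * L'' by ring.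
lra.
Unshelve. all: by end_near.
Qed.
End PrincipalValue.

(** * The hypothesis operators: regularity of the kernel and measurability *)

Section FrakC.
Context {R : realType}.
Local Notation C := R[i].
Local Notation Re := (@complex.Re R).
Local Notation Im := (@complex.Im R).
Local Notation mu := (@lebesgue_measure R).
Implicit Types (f : R -> C) (K N b t x y : R) (s : bool).

(** Since [Num.sqrt] vanishes on negative numbers, the signed bracket is a difference of continuous
    functions; this form avoids the discontinuity of the sign at 0. *)
Lemma bracket_sqrtT (u : R) : bracket_sqrt true u = Num.sqrt u - Num.sqrt (- u).
Proof.
rewrite /bracket_sqrt; have [u0|u0|<-] := ltgtP 0 u.
- by rewrite gtr0_sg// mul1r gtr0_norm// (ler0_sqrtr (_ : - u <= 0)) ?subr0// oppr_le0 ltW.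
- by rewrite ltr0_sg// mulN1r ltr0_norm// (ler0_sqrtr (ltW u0)) sub0r.
- by rewrite sgr0 mul0r oppr0 subrr.
Qed.

Lemma bracket_sqrt_pos s (u : R) : 0 <= u -> bracket_sqrt s u = Num.sqrt u.
Proof.
move=> u0; case: s; first by rewrite bracket_sqrtT (ler0_sqrtr (_ : - u <= 0)) ?subr0// oppr_le0.
by rewrite /bracket_sqrt ger0_norm.
Qed.

Lemma bracket_sqrt_neg (u : R) : u <= 0 -> bracket_sqrt true u = - bracket_sqrt false u.
Proof.
by move=> u0; rewrite bracket_sqrtT (ler0_sqrtr u0) sub0r /bracket_sqrt ler0_norm.
Qed.

Lemma bracket_sqrt_continuous s : continuous (@bracket_sqrt R s).
Proof.
case: s => u.
  have -> : bracket_sqrt true = (fun u : R => Num.sqrt u - Num.sqrt (- u)) by apply/funext => v; exact: bracket_sqrtT.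
  apply: continuousB; first exact: sqrt_continuous.
  apply: (@continuous_comp _ _ _ -%R (@Num.sqrt R)); [exact: opp_continuous|exact: sqrt_continuous].
apply: (@continuous_comp _ _ _ (fun v : R => `|v|) (@Num.sqrt R)); [exact: norm_continuous|exact: sqrt_continuous].
Qed.

Definition ckern s N b t : C := expi (N * t) * expi (b * bracket_sqrt s (t + 1)).

Lemma cabs_ckern s N b t : cabs (ckern s N b t) = 1.
Proof. by rewrite cabsM !cabs_expi mulr1. Qed.

Lemma ckern_meas s N b : cmeas (ckern s N b).
Proof.
apply: cmeasM; apply: cmeas_expi; apply: measurable_funM => //.
apply: (@measurable_pair_comp _ _ _ (bracket_sqrt s) (fun t : R => t + 1)); first exact: bracket_sqrt_continuous.
exact: measurable_funD.
Qed.

Lemma sqrt_lip (u v : R) : 2^-1 <= u -> 2^-1 <= v -> `|Num.sqrt u - Num.sqrt v| <= `|u - v|.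
Proof.
have h (w : R) : 2^-1 <= w -> 2^-1 <= Num.sqrt w.
  move=> hw; have w0 : 0 <= w by apply: le_trans hw; rewrite invr_ge0.
  rewrite -[leLHS]ger0_norm ?invr_ge0// -sqrtr_sqr ler_sqrt//; apply: le_trans hw.
  by rewrite expr2 ler_piMr ?invr_ge0// invf_le1// ler1n.
move=> hu hv; have u0 : 0 <= u by apply: le_trans hu; rewrite invr_ge0.
have v0 : 0 <= v by apply: le_trans hv; rewrite invr_ge0.
have -> : u - v = (Num.sqrt u - Num.sqrt v) * (Num.sqrt u + Num.sqrt v).
  by rewrite -subr_sqr !sqr_sqrtr.
rewrite normrM ler_peMr//; have := h _ hu; have := h _ hv => h1 h2.
rewrite ger0_norm; first by lra.
by rewrite addr_ge0// sqrtr_ge0.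
Qed.

Lemma ckern_fold s N b t : 0 < t -> t <= 2^-1 -> cabs (ckern s N b t - ckern s N b (- t)) <= (4 * `|N| + 4 * `|b|) * t.
Proof.
move=> t0 t2; rewrite /ckern -!expiD; apply: (le_trans (cabs_expiB _ _)).
have -> : N * t + b * bracket_sqrt s (t + 1) - (N * - t + b * bracket_sqrt s (- t + 1)) =
  2 * (N * t) + b * (bracket_sqrt s (t + 1) - bracket_sqrt s (- t + 1)) by ring.
have h1 : 2^-1 <= t + 1 by lra.
have h2 : 2^-1 <= - t + 1 by lra.
rewrite !bracket_sqrt_pos; [|by apply: le_trans h2; rewrite invr_ge0|by apply: le_trans h1; rewrite invr_ge0].
have := sqrt_lip h1 h2; have -> : t + 1 - (- t + 1) = 2 * t by ring.
rewrite [X in _ <= X -> _]normrM (gtr0_norm t0) (ger0_norm (ler0n _ 2)) => h3.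
have h4 : `|b * (Num.sqrt (t + 1) - Num.sqrt (- t + 1))| <= `|b| * (2 * t) by rewrite normrM ler_wpM2l.
have h5 : `|2 * (N * t)| = 2 * (`|N| * t) by rewrite !normrM (gtr0_norm t0) ger0_norm.
have := ler_normD (2 * (N * t)) (b * (Num.sqrt (t + 1) - Num.sqrt (- t + 1))).
rewrite h5 mulrDl; move: h4; move: `|b * _| `|N| `|b| `|_ + _| => u w1 w2 w; lra.
Qed.

Lemma pv_regularM (q : R -> C) s N b B L : cmeas q -> (forall t, cabs (q t) <= B) -> 0 <= L ->
  (forall t, 0 < t -> t <= 2^-1 -> cabs (q t - q (- t)) <= L * t) ->
  pv_regular (fun t => q t * ckern s N b t) B (L + B * (4 * `|N| + 4 * `|b|)).
Proof.
move=> mq qB L0 qL; have B0 : 0 <= B by apply: le_trans (qB 0); exact: cabs_ge0.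
split.
- by apply: cmeasM => //; exact: ckern_meas.
- by move=> t; rewrite cabsM cabs_ckern mulr1.
- by rewrite addr_ge0// mulr_ge0// addr_ge0// mulr_ge0.
- move=> t t0 t2.
  have -> : q t * ckern s N b t - q (- t) * ckern s N b (- t) =
    (q t - q (- t)) * ckern s N b t + q (- t) * (ckern s N b t - ckern s N b (- t)) by ring.
  apply: (le_trans (cabsD _ _)); rewrite (cabsM (_ - _)) cabs_ckern mulr1 (cabsM _ (_ - _)) mulrDl; apply: lerD; first exact: qL.
  rewrite -mulrA; apply: ler_pM; [exact: cabs_ge0|exact: cabs_ge0|exact: qB|exact: ckern_fold].
Qed.

Lemma shift_meas f x : cmeas f -> cmeas (fun t : R => f (x - t)).
Proof. by move=> mf; apply: cmeas_comp mf; apply: measurable_funB. Qed.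

Lemma shift_regular f K s N b x : csmooth f K ->
  pv_regular (fun t => f (x - t) * ckern s N b t) (2 * K) (4 * K + 2 * K * (4 * `|N| + 4 * `|b|)).
Proof.
move=> sf; have K0 := csmooth_gt0 sf; apply: (@pv_regularM (fun t => f (x - t))).
- exact: shift_meas (csmooth_meas sf).
- by move=> t; exact: csmooth_bound1.
- by rewrite mulr_ge0// ltW.
- move=> t t0 _; apply: (le_trans (csmooth_lip _ _ sf)).
  have -> : x - t - (x - - t) = - (2 * t) by ring.
  by rewrite normrN normrM (gtr0_norm t0) ger0_norm//; lra.
Qed.

Lemma shift_regularB f K s N b x y : csmooth f K ->
  pv_regular (fun t => f (x - t) * ckern s N b t - f (y - t) * ckern s N b t)
    (2 * K * `|x - y|) (4 * K * `|x - y| + 2 * K * `|x - y| * (4 * `|N| + 4 * `|b|)).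
Proof.
move=> sf; have K0 := csmooth_gt0 sf.
have -> : (fun t => f (x - t) * ckern s N b t - f (y - t) * ckern s N b t) = (fun t => (f (x - t) - f (y - t)) * ckern s N b t).
  by apply/funext => t; rewrite mulrBl.
apply: (@pv_regularM (fun t => f (x - t) - f (y - t))).
- by apply: cmeasB; exact: shift_meas (csmooth_meas sf).
- move=> t; apply: (le_trans (csmooth_lip _ _ sf)).
  by rewrite (_ : x - t - (y - t) = x - y)//; ring.
- by rewrite !mulr_ge0// ltW.
- move=> t t0 _; apply: (le_trans (csmooth_lip2 _ _ _ _ sf)).
  have -> : t - - t = 2 * t by ring.
  by rewrite normrM (gtr0_norm t0) (ger0_norm (ler0n _ 2)); lra.
Qed.

Definition frakT s r f N b x : C := pv r (fun t => f (x - t) * ckern s N b t).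

Lemma frakCE s r f x : frakC s r f x = ereal_sup (range (fun Nb : R * R => (cabs (frakT s r f Nb.1 Nb.2 x))%:E)).
Proof.
have E N b : clim0 (fun e => cintegral [set t | e < `|t| <= r]
    (fun t => f (x - t) * expi (N * t) * expi (b * bracket_sqrt s (t + 1)) / t%:C%C)) = frakT s r f N b x.
  rewrite /frakT /pv; apply: (congr1 clim0); apply/funext => e.
  by apply: cint_eq => t _; rewrite /ckern mulrA.
apply: (congr1 (fun G : R * R -> \bar R => ereal_sup (range G))); apply/funext => Nb.
by rewrite E.
Qed.

Lemma frakC_ge s r f N b x : ((cabs (frakT s r f N b x))%:E <= frakC s r f x)%E.
Proof. by rewrite frakCE; apply: ereal_sup_ubound; exists (N, b). Qed.

Lemma frakC_ge0 s r f x : (0 <= frakC s r f x)%E.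
Proof. by apply: le_trans (frakC_ge s r f 0 0 x); rewrite lee_fin cabs_ge0. Qed.

(** The constant depends on $N$ and $b$. This is enough, because each member of the supremum only
    has to be continuous in $x$. *)
Lemma frakT_lip s r f K N b : 0 < r -> csmooth f K ->
  exists k, forall x y, `|cabs (frakT s r f N b x) - cabs (frakT s r f N b y)| <= k * `|x - y|.
Proof.
move=> r0 sf; exists ((4 * (r + 1) / Num.min r 2^-1 + 2) * (2 * K + (4 * K + 2 * K * (4 * `|N| + 4 * `|b|)))) => x y.
have H z w : cabs (frakT s r f N b z) - cabs (frakT s r f N b w) <= (4 * (r + 1) / Num.min r 2^-1 + 2) * (2 * K + (4 * K + 2 * K * (4 * `|N| + 4 * `|b|))) * `|z - w|.
  have h1 := cabs_distl (frakT s r f N b z) (frakT s r f N b w).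
  have h2 := pv_dist r0 (shift_regular s N b z sf) (shift_regular s N b w sf) (shift_regularB s N b z w sf).
  apply: (@le_trans _ _ (cabs (frakT s r f N b z - frakT s r f N b w))); first by rewrite lerBlDl.
  apply: (le_trans h2); rewrite -[leRHS]mulrA; rewrite le_eqVlt; apply/orP; left; apply/eqP; congr (_ * _).
  by ring.
rewrite ler_norml; apply/andP; split; last exact: H.
by rewrite lerNl opprB distrC; exact: H.
Qed.

(* A supremum of Lipschitz functions is lower semicontinuous. *)
Lemma measurable_frakC s r f K : 0 < r -> csmooth f K -> measurable_fun setT (frakC s r f).
Proof.
move=> r0 sf; apply: lower_semicontinuous_measurable; apply/lower_semicontinuousP => a.
have -> : [set x | (a%:E < frakC s r f x)%E] = \bigcup_(Nb in [set: R * R]) [set x | a < cabs (frakT s r f Nb.1 Nb.2 x)].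
  apply/seteqP; split => x /=.
    rewrite frakCE => /ereal_sup_gt[_ [[N b] _ <-]] /=; rewrite lte_fin => h.
    by exists (N, b).
  move=> [[N b] _ /= h]; apply: lt_le_trans (frakC_ge s r f N b x).
  by rewrite lte_fin.
apply: bigcup_open => -[N b] _ /=.
have [k H] := frakT_lip s N b r0 sf.
have /continuousP cc : continuous (fun x => cabs (frakT s r f N b x)) by exact: lip_continuous H.
have -> : [set x | a < cabs (frakT s r f N b x)] = (fun x => cabs (frakT s r f N b x)) @^-1` [set z | a < z] by [].
by apply: cc; exact: open_gt.
Qed.
End FrakC.

(** * The quadratic change of variables *)

Section Substitution.
Context {R : realType}.
Local Notation C := R[i].
Local Notation Re := (@complex.Re R).
Local Notation Im := (@complex.Im R).
Local Notation mu := (@lebesgue_measure R).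
Implicit Types (F G : R -> C) (t : R).

Definition ccont_at F t := {for t, continuous (fun u => Re (F u))} /\ {for t, continuous (fun u => Im (F u))}.

Lemma ccont_atM F G t : ccont_at F t -> ccont_at G t -> ccont_at (fun u => F u * G u) t.
Proof.
move=> [f1 f2] [g1 g2]; split.
  have -> : (fun u => Re (F u * G u)) = (fun u => Re (F u) * Re (G u) - Im (F u) * Im (G u)) by apply/funext => u; exact: ReM.
  exact: (continuousB (continuousM f1 g1) (continuousM f2 g2)).
have -> : (fun u => Im (F u * G u)) = (fun u => Re (F u) * Im (G u) + Im (F u) * Re (G u)) by apply/funext => u; exact: ImM.
exact: (continuousD (continuousM f1 g2) (continuousM f2 g1)).
Qed.

Lemma ccont_at_expi (f : R -> R) t : {for t, continuous f} -> ccont_at (fun u => expi (f u)) t.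
Proof.
move=> cf; split => /=.
  by apply: (@continuous_comp _ _ _ f cos) => //; exact: continuous_cos.
by apply: (@continuous_comp _ _ _ f sin) => //; exact: continuous_sin.
Qed.

Lemma ccont_at_comp F (f : R -> R) t : {for t, continuous f} -> ccont_at F (f t) -> ccont_at (fun u => F (f u)) t.
Proof.
move=> cf [h1 h2]; split.
  exact: (@continuous_comp _ _ _ f (fun u => Re (F u))).
exact: (@continuous_comp _ _ _ f (fun u => Im (F u))).
Qed.

Lemma ccont_at_div F t : t != 0 -> ccont_at F t -> ccont_at (fun u => F u / u%:C%C) t.
Proof.
move=> t0 [h1 h2]; have cV : {for t, continuous (fun u : R => u^-1)} by exact: inv_continuous.
split.
  have -> : (fun u => Re (F u / u%:C%C)) = (fun u => Re (F u) * u^-1) by apply/funext => u; rewrite cdivr.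
  exact: (continuousM h1 cV).
have -> : (fun u => Im (F u / u%:C%C)) = (fun u => Im (F u) * u^-1) by apply/funext => u; rewrite cdivr.
exact: (continuousM h2 cV).
Qed.

Lemma cint_substitution (u u' : R -> R) G a b : a <= b ->
  (forall x, is_derive x (1 : R) u (u' x)) -> continuous u' ->
  {in `[a, b] &, {homo u : x y / x < y}} ->
  (forall v, u a <= v <= u b -> ccont_at G v) ->
  cintegral `[u a, u b] G = cintegral `[a, b] (fun s => G (u s) * (u' s)%:C%C).
Proof.
move=> ab du cu' mono cG.
have u'E : derive1 u = u' by apply/funext => x; rewrite derive1E; exact: (@derive_val _ _ _ _ _ _ _ (du x)).
have cu x : {for x, continuous u} by exact: is_derive_cont (du x).
have S (g : R -> R) : (forall v, u a <= v <= u b -> {for v, continuous g}) ->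
    \int[mu]_(x in `[u a, u b]) g x = \int[mu]_(x in `[a, b]) (g (u x) * u' x).
  move=> cg; rewrite /Rintegral integration_by_substitution_increasing// ?u'E//.
  - by apply/cvg_ex; exists (u' a); apply: cvg_at_right_filter; exact: cu'.
  - by apply/cvg_ex; exists (u' b); apply: cvg_at_left_filter; exact: cu'.
  - split.
    + by move=> x _; exact: (@ex_derive _ _ _ _ _ _ _ (du x)).
    + by apply: cvg_at_right_filter; exact: cu.
    + by apply: cvg_at_left_filter; exact: cu.
  - exact: continuous_itv_within.
apply/eqP; rewrite eq_complex; apply/andP; split; apply/eqP; rewrite /cintegral/=.
  rewrite S; last by move=> v /cG[].
  by apply: eq_Rintegral => x _; rewrite ReM/= mulr0 subr0.
rewrite S; last by move=> v /cG[].
by apply: eq_Rintegral => x _; rewrite ImM/= mulr0 add0r.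
Qed.
End Substitution.

(** * The substitution $v = 4(s + s^2)$ and the decomposition of the kernel $ds/s$ *)

Section Parabola.
Context {R : realType}.
Local Notation C := R[i].
Local Notation mu := (@lebesgue_measure R).
Variables (q : R -> C) (B A : R).
Hypothesis mq : cmeas q.
Hypothesis cq : forall t, ccont_at q t.
Hypothesis qB : forall t, cabs (q t) <= B.
Hypothesis iq : mu.-integrable setT (EFin \o (fun v => cabs (q v))).
Hypothesis qA : \int[mu]_v cabs (q v) <= A.

(* For v = parab s one has v + 1 = (1 + 2 s)^2 and dv / v = (1 / s + 1 / (1 + s)) ds,
   so on s >= -1/2 the phase b (1 + 2 s) of wkern is the phase of bkern at v. *)
Definition parab (s : R) : R := 4 * (s + s ^+ 2).
Definition bkern sg b v : C := q v * expi (b * bracket_sqrt sg (v + 1)).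
Definition wkern b (s : R) : C := expi (b * (1 + 2 * s)) * q (parab s).
(** Every piece whose kernel in $s$ is $O(1/(1+s^2))$ is controlled by this average, which no longer
    involves the frequency $b$. *)
Definition parab_avg : R := \int[mu]_s (wgt s * cabs (q (parab s))).
Definition wint b (k : R -> R) (c d : R) : C := cintegral `[c, d] (fun s => wkern b s * (k s)%:C%C).
Definition bint sg b (c d : R) : C := cintegral `[c, d] (fun v => bkern sg b v / v%:C%C).
Definition adm (k : R -> R) (c d : R) := measurable_fun setT k /\ exists k0, forall s, c <= s <= d -> `|k s| <= k0.

Let B0 : 0 <= B. Proof. by apply: le_trans (qB 0); exact: cabs_ge0. Qed.

Lemma cabs_wkern b s : cabs (wkern b s) = cabs (q (parab s)).
Proof. by rewrite cabsM cabs_expi mul1r. Qed.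

Lemma cabs_bkern sg b v : cabs (bkern sg b v) = cabs (q v).
Proof. by rewrite cabsM cabs_expi mulr1. Qed.

Lemma wkern_bound b s : cabs (wkern b s) <= B.
Proof. by rewrite cabs_wkern. Qed.

Lemma bkern_bound sg b s : cabs (bkern sg b s) <= B.
Proof. by rewrite cabs_bkern. Qed.

Lemma parab_meas : measurable_fun setT parab.
Proof. by apply: measurable_funM => //; apply: measurable_funD => //; exact: measurable_funX. Qed.

Lemma wkern_meas b : cmeas (wkern b).
Proof.
apply: cmeasM; last by apply: cmeas_comp mq; exact: parab_meas.
by apply: cmeas_expi; apply: measurable_funM => //; apply: measurable_funD => //; exact: measurable_funM.
Qed.

Lemma bkern_meas sg b : cmeas (bkern sg b).
Proof.
apply: cmeasM => //; apply: cmeas_expi; apply: measurable_funM => //.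
apply: (@measurable_pair_comp _ _ _ (bracket_sqrt sg) (fun t : R => t + 1)); first exact: bracket_sqrt_continuous.
exact: measurable_funD.
Qed.

Let wk_meas b (k : R -> R) : measurable_fun setT k -> cmeas (fun s => wkern b s * (k s)%:C%C).
Proof. by move=> mk; apply: cmeasM; [exact: wkern_meas|exact: cmeas_real]. Qed.

Let cabs_wk b k s : cabs (wkern b s * (k s)%:C%C) = cabs (q (parab s)) * `|k s|.
Proof. by rewrite cabsM cabs_wkern cabs_real. Qed.

Lemma wint_cintg b k c d : adm k c d -> cintg `[c, d] (fun s => wkern b s * (k s)%:C%C).
Proof.
move=> [mk [k0 hk]]; apply: (@cintg_bnd _ _ _ c d (B * k0)) => //; first exact: wk_meas.
move=> s; rewrite /= in_itv/= => /hk h; rewrite cabs_wk.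
by apply: ler_pM => //; exact: cabs_ge0.
Qed.

Lemma wint_chasles b k c m d : c <= m -> m <= d -> adm k c d -> wint b k c d = wint b k c m + wint b k m d.
Proof. by move=> cm md ak; apply: cint_chasles => //; exact: wint_cintg. Qed.

Lemma wintD b k1 k2 c d : adm k1 c d -> adm k2 c d ->
  wint b (fun s => k1 s + k2 s) c d = wint b k1 c d + wint b k2 c d.
Proof.
move=> a1 a2; rewrite -cintD//; [|exact: wint_cintg|exact: wint_cintg].
by apply: cint_eq => s _; rewrite rmorphD mulrDr.
Qed.

Lemma wintB b k1 k2 c d : adm k1 c d -> adm k2 c d ->
  wint b (fun s => k1 s - k2 s) c d = wint b k1 c d - wint b k2 c d.
Proof.
move=> a1 a2; rewrite -cintB//; [|exact: wint_cintg|exact: wint_cintg].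
by apply: cint_eq => s _; rewrite rmorphB mulrBr.
Qed.

Lemma parab_avg_integrable : mu.-integrable setT (EFin \o (fun s => wgt s * cabs (q (parab s)))).
Proof.
apply: (@integrable_decay _ _ B).
  apply: measurable_funM; first exact: measurable_wgt.
  by apply: (@measurable_cabs _ _ _ (fun s => q (parab s))); apply: cmeas_comp mq; exact: parab_meas.
move=> s; rewrite ger0_norm ?mulr_ge0 ?wgt_ge0 ?cabs_ge0// mulrC.
by apply: ler_wpM2r => //; exact: wgt_ge0.
Qed.

Lemma wint_rem b (k : R -> R) (c d m : R) : measurable_fun setT k -> 0 <= m ->
  (forall s, c <= s <= d -> `|k s| <= m * wgt s) -> cabs (wint b k c d) <= 2 * (m * parab_avg).
Proof.
move=> mk m0 hk; rewrite /wint cint_mkcond.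
have -> : m * parab_avg = \int[mu]_s (m * (wgt s * cabs (q (parab s)))) by rewrite RintegralZl//; exact: parab_avg_integrable.
apply: cint_le => //.
- apply: cmeasM; last exact: wk_meas.
  by apply: cmeas_real; exact: measurable_indic.
- rewrite /comp; under eq_fun do rewrite EFinM.
  by apply: integrableZl => //; exact: parab_avg_integrable.
- move=> s _; rewrite cabsM cabs_real indicE; have [|_] := boolP (s \in _); last first.
    by rewrite normr0 mul0r !mulr_ge0 ?wgt_ge0 ?cabs_ge0.
  rewrite inE /= in_itv/= normr1 mul1r cabs_wk => /hk h.
  by rewrite mulrA mulrC; apply: ler_wpM2r => //; exact: cabs_ge0.
Qed.

Lemma bkern_cont sg b v : ccont_at (bkern sg b) v.
Proof.
apply: ccont_atM => //; apply: ccont_at_expi.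
have c1 : {for v, continuous (fun u : R => bracket_sqrt sg (u + 1))}.
  apply: (@continuous_comp _ _ _ (fun u : R => u + 1) (bracket_sqrt sg)).
    exact: is_derive_cont (der_add (der_id v) (der_cst 1 v)).
  exact: bracket_sqrt_continuous.
exact: (continuousM (@cst_continuous _ _ b _) c1).
Qed.

Definition kinv (s : R) : R := s^-1.
Definition kinv1 (s : R) : R := (1 + s)^-1.

(** For $s \ge -1/2$ the map is increasing and $\sqrt{v+1} = 1 + 2s$ for either bracket; the last
    condition keeps $v = 0$ out of the interval. *)
Lemma wint_subst sg b c d : - 2^-1 <= c -> c <= d -> 0 < c \/ d < 0 ->
  bint sg b (parab c) (parab d) = wint b (fun s => kinv s + kinv1 s) c d.
Proof.
move=> hc cd hcd.
have dV s : is_derive s (1 : R) parab (4 * (1 + 2 * s)).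
  have dX : is_derive s (1 : R) (fun s : R => s ^+ 2) (2 * s).
    have -> : (fun s : R => s ^+ 2) = (fun s => s * s) by apply/funext => t; rewrite expr2.
    by apply: is_derive_eq (der_mul (der_id s) (der_id s)) _; ring.
  by apply: is_derive_eq (der_scale 4 (der_add (der_id s) dX)) _; ring.
rewrite /bint (cint_substitution cd dV)//.
- apply: cint_eq => s; rewrite inE /= in_itv/= => /andP[cs sd].
  have s0 : s != 0 by case: hcd => h; [rewrite gt_eqF//; lra|rewrite lt_eqF//; lra].
  have s1 : 1 + s != 0 by rewrite gt_eqF//; lra.
  have E1 : bkern sg b (parab s) = wkern b s.
    rewrite /bkern /wkern mulrC; congr (expi _ * _).
    have -> : parab s + 1 = (1 + 2 * s) ^+ 2 by rewrite /parab; ring.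
    by rewrite bracket_sqrt_pos ?sqr_ge0// sqrtr_sqr ger0_norm//; lra.
  rewrite E1 -mulrA; congr (_ * _).
  rewrite -(@fmorphV _ _ (real_complex R)) -rmorphM; congr (real_complex R _).
  have -> : parab s = 4 * (s * (1 + s)) by rewrite /parab; ring.
  by rewrite /kinv /kinv1; field; rewrite s0 s1.
- move=> s; apply: is_derive_cont (der_scale 4 (der_add (der_cst 1 s) (der_scale 2 (der_id s)))).
- move=> x y; rewrite !in_itv/= => /andP[cx xd] /andP[cy yd] xy; rewrite /parab.
  have : 0 < (y - x) * (1 + x + y) by apply: mulr_gt0; lra.
  nra.
- move=> v /andP[cv vd]; apply: ccont_at_div; last exact: bkern_cont.
  case: hcd => [c0|d0].
    rewrite gt_eqF//; apply: lt_le_trans cv; rewrite /parab; nra.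
  rewrite lt_eqF//; apply: (le_lt_trans vd); rewrite /parab.
  have : 0 < - d * (1 + d) by apply: mulr_gt0; lra.
  nra.
Qed.

Lemma adm_kinv c d : 0 < c \/ d < 0 -> adm kinv c d.
Proof.
move=> hcd; split; first exact: measurable_inv.
case: hcd => h; [exists c^-1|exists (- d)^-1] => s /andP[cs sd]; rewrite /kinv normfV.
  by rewrite gtr0_norm ?lef_pV2 ?posrE ?(lt_le_trans h cs).
by rewrite ltr0_norm ?lef_pV2 ?posrE ?oppr_gt0 ?lerN2 ?(le_lt_trans sd h).
Qed.

Lemma adm_kinv1 c d : -1 < c -> adm kinv1 c d.
Proof.
move=> h; split; first by apply: measurable_funV; exact: measurable_funD.
exists (1 + c)^-1 => s /andP[cs _]; rewrite /kinv1 normfV.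
by rewrite gtr0_norm ?lef_pV2 ?posrE ?lerD2l//; lra.
Qed.

Lemma pvint_wkern b e M : 0 < e -> pvint e M (wkern b) = wint b kinv e M + wint b kinv (- M) (- e).
Proof.
move=> e0; rewrite (pvint_split M (wkern_meas b) (wkern_bound b) e0).
by congr (_ + _); apply: cint_eq => s _; rewrite /kinv -(@fmorphV _ _ (real_complex R)).
Qed.

(** The symmetry $s \mapsto -1 - s$ of the parabola fixes $v$, changes the sign of $1 + 2s$ and
    sends $1/s$ to $-1/(1+s)$. The left branch thus becomes an integral over the right branch with
    frequency $-b$. *)
Lemma wint_reflect b M : 2^-1 <= M -> wint b kinv (- M) (- 2^-1) = - wint (- b) kinv1 (- 2^-1) (M - 1).
Proof.
move=> M2; have h2 : 2 * 2^-1 = 1 :> R by rewrite mulfV.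
have a1 : adm kinv (- M) (- 2^-1) by apply: adm_kinv; right; lra.
have := @cint_reflect _ (-1) (- 2^-1) (M - 1) (fun s => wkern b s * (kinv s)%:C%C).
have -> : -1 - (M - 1) = - M by ring.
have -> : -1 - - 2^-1 = - 2^-1 :> R by lra.
move=> /(_ (wint_cintg b a1)); rewrite -/(wint b kinv (- M) (- 2^-1)) => <-.
have a2 : adm kinv1 (- 2^-1) (M - 1) by apply: adm_kinv1; lra.
rewrite -[RHS]mulN1r -cintM//; last exact: wint_cintg.
apply: cint_eq => s _; have -> : wkern b (-1 - s) = wkern (- b) s.
  by rewrite /wkern; congr (expi _ * q _); rewrite /parab; ring.
by rewrite /kinv (_ : -1 - s = - (1 + s)) ?invrN -/(kinv1 s); [rewrite rmorphN; ring|ring].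
Qed.

(** The point of the right branch with $v = 1$, that is $1 + 2s = \sqrt 2$. *)
Definition cut : R := (Num.sqrt 2 - 1) / 2.

Lemma cut_parab : parab cut = 1.
Proof.
have h : Num.sqrt (2 : R) ^+ 2 = 2 by rewrite sqr_sqrtr.
rewrite /parab /cut; have -> : 4 * ((Num.sqrt 2 - 1) / 2 + ((Num.sqrt 2 - 1) / 2) ^+ 2) = Num.sqrt (2 : R) ^+ 2 - 1 by field.
by rewrite h; ring.
Qed.

Lemma cut_bnd : 8^-1 <= cut /\ cut <= 4^-1.
Proof.
have h : Num.sqrt (2 : R) ^+ 2 = 2 by rewrite sqr_sqrtr.
have h0 : 0 <= Num.sqrt (2 : R) by exact: sqrtr_ge0.
rewrite /cut; move: (Num.sqrt 2) h h0 => w h h0.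
split; nra.
Qed.

(** It equals $1/(s(1+s))$, integrable at infinity, whereas [kap] below is the density of $dv/v$. *)
Definition krem (s : R) : R := kinv s - kinv1 s.
Definition kap (s : R) : R := kinv s + kinv1 s.

(** After reflection the integrand on the right branch is $w_b/s - w_{-b}/(1+s)$. Up to [cut], $1/s$
    is replaced by [kap] minus $1/(1+s)$, the latter being bounded. Beyond it, $1/s$ and $1/(1+s)$
    are the half sum and half difference of [kap] and [krem], so that [kap] carries $(w_b -
    w_{-b})/2$ and [krem] carries $(w_b + w_{-b})/2$. The piece $[M-1, M]$ remains because the
    reflection moves the end $-M$ to $M - 1$. *)
Lemma pvint_wkern_decomp b e M : 0 < e -> e <= 16^-1 -> 2 <= M ->
  pvint e M (wkern b) =
  (bint false b (-1) (parab (- e)) + bint false b (parab e) 1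
   + (bint false b 1 (parab (M - 1)) - bint false (- b) 1 (parab (M - 1))) / 2)
  + (- wint b kinv1 (- 2^-1) (- e) - wint b kinv1 e cut - wint (- b) kinv1 (- 2^-1) cut
     + (wint b krem cut (M - 1) + wint (- b) krem cut (M - 1)) / 2)
  + wint b kinv (M - 1) M.
Proof.
move=> e0 e1 M2; have [c1 c2] := cut_bnd; have cV := cut_parab.
have V1 : parab (- 2^-1) = -1 by rewrite /parab; field.
have S1 : bint false b (-1) (parab (- e)) = wint b kap (- 2^-1) (- e).
  by rewrite -V1 wint_subst//; [lra|right; lra].
have S2 : bint false b (parab e) 1 = wint b kap e cut.
  by rewrite -[X in bint _ _ _ X]cV wint_subst//; [lra|lra|left].
have S3 b' : bint false b' 1 (parab (M - 1)) = wint b' kap cut (M - 1).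
  by rewrite -[X in bint _ _ X]cV wint_subst//; [lra|lra|left; lra].
rewrite S1 S2 !S3 (pvint_wkern b M e0).
rewrite (wint_chasles b (c := e) (m := cut) (d := M)); [|lra|lra|by apply: adm_kinv; left].
rewrite (wint_chasles b (c := cut) (m := M - 1) (d := M)); [|lra|lra|by apply: adm_kinv; left; lra].
rewrite (wint_chasles b (c := - M) (m := - 2^-1) (d := - e)); [|lra|lra|by apply: adm_kinv; right; lra].
rewrite wint_reflect; last by lra.
rewrite (wint_chasles (- b) (c := - 2^-1) (m := cut) (d := M - 1)); [|lra|lra|by apply: adm_kinv1; lra].
have D c d b' : 0 < c \/ d < 0 -> -1 < c -> wint b' kap c d = wint b' kinv c d + wint b' kinv1 c d.
  by move=> h h'; apply: wintD; [exact: adm_kinv|exact: adm_kinv1].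
have D' c d b' : 0 < c \/ d < 0 -> -1 < c -> wint b' krem c d = wint b' kinv c d - wint b' kinv1 c d.
  by move=> h h'; apply: wintB; [exact: adm_kinv|exact: adm_kinv1].
rewrite !D ?D'; [|left; lra|lra|left; lra|lra|left; lra|lra|left; lra|lra|left; lra|lra|right; lra|lra].
move: (wint b kinv e cut) (wint b kinv cut (M - 1)) (wint b kinv (M - 1) M) (wint b kinv (- 2^-1) (- e)).
move: (wint b kinv1 e cut) (wint b kinv1 cut (M - 1)) (wint b kinv1 (- 2^-1) (- e)).
move: (wint (- b) kinv1 (- 2^-1) cut) (wint (- b) kinv1 cut (M - 1)) (wint (- b) kinv cut (M - 1)).
by move=> w1 w2 w3 w4 w5 w6 w7 w8 w9 w10; field.
Qed.

(** The image of $(-e, e)$ is $(-4e + 4e^2, 4e + 4e^2)$, not symmetric about 0. The mismatch has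
    length $8e^2$ and lies in $|v| \ge 2e$, where the integrand is at most $B/(2e)$; with the factor
    2 of [cint_bnd] this is $8Be$. *)
Lemma bint_pv_near b e : 0 < e -> e <= 16^-1 ->
  cabs (bint false b (-1) (parab (- e)) + bint false b (parab e) 1)
    <= cabs (pvint (parab e) 1 (bkern false b)) + 8 * B * e.
Proof.
move=> e0 e1; have h16 : 16 * 16^-1 = 1 :> R by rewrite mulfV.
have ee : e * e <= 16^-1 * e by rewrite ler_wpM2r// ltW.
have ee0 : 0 < e * e by exact: mulr_gt0.
have V1 : parab e = 4 * e + 4 * (e * e) by rewrite /parab; ring.
have V2 : parab (- e) = - 4 * e + 4 * (e * e) by rewrite /parab; ring.
have Ve0 : 0 < parab e by rewrite V1; lra.
have i1 : cintg `[-1, parab (- e)] (fun v => bkern false b v / v%:C%C).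
  rewrite -[X in `[_, X]]opprK; apply: cintg_div_neg; [exact: bkern_meas|exact: bkern_bound|].
  by rewrite V2; lra.
have E1 : bint false b (-1) (parab (- e)) = bint false b (-1) (- parab e) + bint false b (- parab e) (parab (- e)).
  by apply: cint_chasles => //; rewrite ?V1 ?V2; lra.
have E2 : pvint (parab e) 1 (bkern false b) = bint false b (parab e) 1 + bint false b (-1) (- parab e).
  exact: (pvint_split 1 (bkern_meas false b) (bkern_bound false b) Ve0).
have E3 : cabs (bint false b (- parab e) (parab (- e))) <= 8 * B * e.
  apply: (@le_trans _ _ (2 * (B / (2 * e) * (parab (- e) - - parab e)))).
    apply: cint_bnd => //.
    - by rewrite V1 V2; lra.
    - by apply: cmeas_divid; exact: bkern_meas.
    - by rewrite divr_ge0// mulr_ge0// ltW.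
    - move=> v; rewrite /= in_itv/= => /andP[_ hv]; rewrite cabs_div.
      have v0 : v <= - (2 * e) by apply: (le_trans hv); rewrite V2; lra.
      have v1 : v < 0 by apply: (le_lt_trans v0); lra.
      apply: ler_pM; [exact: cabs_ge0|by rewrite invr_ge0|exact: bkern_bound|].
      by rewrite ltr0_norm// lef_pV2 ?posrE ?mulr_gt0 ?oppr_gt0// lerNr.
  have -> : parab (- e) - - parab e = 8 * (e * e) by rewrite V1 V2; ring.
  have en : e != 0 by rewrite gt_eqF.
  by rewrite le_eqVlt; apply/orP; left; apply/eqP; field.
rewrite E1 E2; apply: le_trans (lerD (lexx _) E3).
have -> : bint false b (-1) (- parab e) + bint false b (- parab e) (parab (- e)) + bint false b (parab e) 1 =
  (bint false b (parab e) 1 + bint false b (-1) (- parab e)) + bint false b (- parab e) (parab (- e)) by ring.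
exact: cabsD.
Qed.

(** Beyond $r$ only $1/v \le 1/r$ is used. This is where the $L^1$ norm enters, and the bound is
    uniform in $W$. *)
Lemma bint_tail sg b (r W : R) : 0 < r -> cabs (bint sg b r W) <= 2 * (A / r).
Proof.
move=> r0; rewrite /bint cint_mkcond.
apply: (@le_trans _ _ (2 * \int[mu]_v (r^-1 * cabs (q v)))).
  apply: cint_le => //.
  - apply: cmeasM; last by apply: cmeas_divid; exact: bkern_meas.
    by apply: cmeas_real; exact: measurable_indic.
  - by rewrite /comp; under eq_fun do rewrite EFinM; exact: integrableZl.
  - move=> v _; rewrite cabsM cabs_real indicE; have [|_] := boolP (v \in _); last first.
      by rewrite normr0 mul0r mulr_ge0 ?cabs_ge0// invr_ge0 ltW.
    rewrite inE /= in_itv/= normr1 mul1r cabs_div cabs_bkern => /andP[rv _].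
    have v0 : 0 < v by exact: lt_le_trans rv.
    by rewrite mulrC; apply: ler_wpM2r; [exact: cabs_ge0|rewrite gtr0_norm// lef_pV2].
rewrite RintegralZl// mulrC [leRHS]mulrC; apply: ler_wpM2r => //; rewrite mulrC.
by apply: ler_wpM2r => //; rewrite invr_ge0 ltW.
Qed.

Hypothesis PR : forall sg b, exists L, pv_regular (bkern sg b) B L.

Lemma pv_chasles sg b r : 1 <= r ->
  pv r (bkern sg b) - pv 1 (bkern sg b) = bint sg b 1 r + bint sg b (- r) (-1).
Proof.
move=> r1; have [L P] := PR sg b; have r0 : 0 < r by exact: lt_le_trans r1.
rewrite -[RHS](pvint_split r (bkern_meas sg b) (bkern_bound sg b) ltr01).
(* The claim is brought to the form $pv_r - pvint_{1,r} = pv_1$, where both sides are limits of the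
   integrals over $e \le |v| \le 1$. *)
rewrite -[RHS](addrK (pv 1 (bkern sg b))) (addrC (pvint _ _ _)) -[LHS]addr0 -[RHS]addr0.
congr (_ - _ + _); apply/eqP; rewrite -subr_eq; apply/eqP.
have c1 : ccvg 0^'+ (fun e => pvint e 1 (bkern sg b)) (pv r (bkern sg b) - pvint 1 r (bkern sg b)).
  apply: eq_near_ccvg (ccvgB (pv_cvg P r0) (ccvg_cst (pvint 1 r (bkern sg b)))).
  near=> e; rewrite (pvint_chasles (bkern_meas sg b) (bkern_bound sg b) (b := 1)) ?addrK//.
  by near: e; exact: nbhs_right_le.
exact: (ccvg_unique _ c1 (pv_cvg P ltr01)).
Unshelve. all: by end_near.
Qed.

Lemma bint_bracket_pos b c d : 0 <= c -> bint true b c d = bint false b c d.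
Proof.
move=> c0; apply: cint_eq => v; rewrite inE /= in_itv/= => /andP[cv _].
by rewrite /bkern !bracket_sqrt_pos//; lra.
Qed.

Lemma bint_bracket_neg b c d : d <= -1 -> bint true b c d = bint false (- b) c d.
Proof.
move=> d1; apply: cint_eq => v; rewrite inE /= in_itv/= => /andP[_ vd].
by rewrite /bkern bracket_sqrt_neg ?mulrN ?mulNr//; lra.
Qed.

(* Summing over the two brackets cancels the part of the kernel with v <= -1,
   where they differ by a sign. *)
Lemma bint_pv_sum b r : 1 <= r ->
  2 * (bint false b 1 r - bint false (- b) 1 r) =
    (pv r (bkern false b) - pv 1 (bkern false b)) - (pv r (bkern false (- b)) - pv 1 (bkern false (- b)))
    + ((pv r (bkern true b) - pv 1 (bkern true b)) - (pv r (bkern true (- b)) - pv 1 (bkern true (- b)))).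
Proof.
move=> r1; have := pv_chasles false b r1; have := pv_chasles false (- b) r1.
have := pv_chasles true b r1; have := pv_chasles true (- b) r1.
rewrite (@bint_bracket_pos b) // (@bint_bracket_pos (- b))// (@bint_bracket_neg b)// (@bint_bracket_neg (- b))// opprK.
move: (bint false b 1 r) (bint false (- b) 1 r) (bint false b (- r) (-1)) (bint false (- b) (- r) (-1)) => x1 x2 x3 x4.
move: (pv r (bkern true (- b))) (pv 1 (bkern true (- b))) (pv r (bkern true b)) (pv 1 (bkern true b)).
move: (pv r (bkern false (- b))) (pv 1 (bkern false (- b))) (pv r (bkern false b)) (pv 1 (bkern false b)).
by move=> y1 y2 y3 y4 y5 y6 y7 y8 -> -> -> ->; ring.
Qed.

Definition pvsum b r : R :=
  cabs (pv r (bkern false b)) + cabs (pv 1 (bkern false b)) + (cabs (pv r (bkern false (- b))) + cabs (pv 1 (bkern false (- b))))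
  + (cabs (pv r (bkern true b)) + cabs (pv 1 (bkern true b)) + (cabs (pv r (bkern true (- b))) + cabs (pv 1 (bkern true (- b))))).

(** The upper end $W$ moves with the truncation, so the principal values are taken at a fixed $r$
    and $[r, W]$ is left to [bint_tail]. The quarter comes from the factor 2 in [bint_pv_sum] and
    from the division by 2 here. *)
Lemma bint_diff_bound b r W : 1 <= r -> r <= W ->
  cabs ((bint false b 1 W - bint false (- b) 1 W) / 2) <= pvsum b r / 4 + 2 * (A / r).
Proof.
move=> r1 rW; have r0 : 0 < r by exact: lt_le_trans r1.
have S b' : bint false b' 1 W = bint false b' 1 r + bint false b' r W.
  by apply: cint_chasles => //; apply: cintg_div_pos; [exact: bkern_meas|exact: bkern_bound|].
have t1 := bint_tail false b W r0; have t2 := bint_tail false (- b) W r0.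
have M : cabs (bint false b 1 r - bint false (- b) 1 r) <= pvsum b r / 2.
  have -> : bint false b 1 r - bint false (- b) 1 r = (2 * (bint false b 1 r - bint false (- b) 1 r)) / 2.
    by rewrite [2 * _]mulrC mulfK// pnatr_eq0.
  rewrite cabs_half bint_pv_sum//; apply: ler_wpM2r => //.
  apply: (le_trans (cabsD _ _)); apply: lerD.
    by apply: (le_trans (cabsB _ _)); apply: lerD; exact: cabsB.
  by apply: (le_trans (cabsB _ _)); apply: lerD; exact: cabsB.
rewrite cabs_half !S; have -> : bint false b 1 r + bint false b r W - (bint false (- b) 1 r + bint false (- b) r W) =
  (bint false b 1 r - bint false (- b) 1 r) + (bint false b r W - bint false (- b) r W) by ring.
have h1 := cabsD (bint false b 1 r - bint false (- b) 1 r) (bint false b r W - bint false (- b) r W).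
have h2 := cabsB (bint false b r W) (bint false (- b) r W).
lra.
Qed.

Lemma wint_kinv1_bound b c d : - 2^-1 <= c -> d <= 4^-1 -> cabs (wint b kinv1 c d) <= 2 * (4 * parab_avg).
Proof.
move=> hc hd; apply: wint_rem => //; first by apply: measurable_funV; exact: measurable_funD.
move=> s /andP[cs sd]; have h2 : 2 * 2^-1 = 1 :> R by rewrite mulfV.
have h4 : 4 * 4^-1 = 1 :> R by rewrite mulfV.
have s1 : 0 < 1 + s by lra.
rewrite /kinv1 /wgt gtr0_norm ?invr_gt0// ler_pdivlMr ?ltr_pwDl ?sqr_ge0// mulrC ler_pdivrMr//; nra.
Qed.

Lemma wint_krem_bound b c d : 8^-1 <= c -> cabs (wint b krem c d) <= 2 * (8 * parab_avg).
Proof.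
move=> hc; apply: wint_rem => //.
  apply: measurable_funB; first exact: measurable_inv.
  by apply: measurable_funV; exact: measurable_funD.
move=> s /andP[cs sd]; have h8 : 8 * 8^-1 = 1 :> R by rewrite mulfV.
have s0 : 0 < s by lra.
have s1 : 0 < 1 + s by lra.
have -> : krem s = (s * (1 + s))^-1 by rewrite /krem /kinv /kinv1; field; rewrite !gt_eqF.
rewrite /wgt gtr0_norm ?invr_gt0 ?mulr_gt0// ler_pdivlMr ?ltr_pwDl ?sqr_ge0// mulrC ler_pdivrMr ?mulr_gt0//; nra.
Qed.

(** The constant 40 is $3 \cdot 8$ from the pieces with $1/(1+s)$ plus $(16+16)/2$ from [krem]. The
    last bracket collects the errors that vanish as $e \to 0$ and $M \to \infty$: $10 L e$ from $2L
    \cdot 5e$, $8Be$ from the asymmetric hole, and the piece $[M-1, M]$. *)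
Lemma pvint_wkern_bound b r e M L : pv_regular (bkern false b) B L ->
  1 <= r -> 0 < e -> e <= 16^-1 -> 2 <= M -> r <= M - 1 ->
  cabs (pvint e M (wkern b)) <=
    cabs (pv 1 (bkern false b)) + pvsum b r / 4 + 2 * (A / r) + 40 * parab_avg
    + ((10 * L + 8 * B) * e + 2 * (B / (M - 1))).
Proof.
move=> P r1 e0 e1 M2 rM; have [_ _ L0 _] := P.
have [c1 c2] := cut_bnd.
have h2 : 2 * 2^-1 = 1 :> R by rewrite mulfV.
have h4 : 4 * 4^-1 = 1 :> R by rewrite mulfV.
have h8 : 8 * 8^-1 = 1 :> R by rewrite mulfV.
have h16 : 16 * 16^-1 = 1 :> R by rewrite mulfV.
have ee : e * e <= 16^-1 * e by rewrite ler_wpM2r// ltW.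
have ee0 : 0 < e * e by exact: mulr_gt0.
have V1 : parab e = 4 * e + 4 * (e * e) by rewrite /parab; ring.
have Ve : parab e <= 5 * e by rewrite V1; lra.
have Ve0 : 0 < parab e by rewrite V1; lra.
rewrite pvint_wkern_decomp//.
have b1 := bint_pv_near b e0 e1.
have b2 : cabs (pvint (parab e) 1 (bkern false b)) <= cabs (pv 1 (bkern false b)) + 10 * L * e.
  have p1 : cabs (pv 1 (bkern false b) - pvint (parab e) 1 (bkern false b)) <= 2 * L * parab e.
    by apply: (pv_near P) => //; lra.
  have p2 := cabs_distl (pvint (parab e) 1 (bkern false b)) (pv 1 (bkern false b)).
  have p3 : 2 * L * parab e <= 2 * L * (5 * e) by apply: ler_wpM2l => //; rewrite mulr_ge0.
  have p4 := cabsN (pv 1 (bkern false b) - pvint (parab e) 1 (bkern false b)); rewrite opprB in p4; lra.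
have rW : r <= parab (M - 1) by apply: (le_trans rM); rewrite /parab; nra.
have b3 := bint_diff_bound b r1 rW.
have k1 := @wint_kinv1_bound b (- 2^-1) (- e) (lexx _) ltac:(lra).
have k2 := @wint_kinv1_bound b e cut ltac:(lra) c2.
have k3 := @wint_kinv1_bound (- b) (- 2^-1) cut (lexx _) c2.
have k4 := @wint_krem_bound b cut (M - 1) c1.
have k5 := @wint_krem_bound (- b) cut (M - 1) c1.
have M0 : 0 < M - 1 by rewrite subr_gt0 (lt_le_trans _ M2)// ltr1n.
have k6 : cabs (wint b kinv (M - 1) M) <= 2 * (B / (M - 1)).
  apply: (@le_trans _ _ (2 * (B / (M - 1) * (M - (M - 1))))); last first.
    by rewrite (_ : M - (M - 1) = 1) ?mulr1//; ring.
  apply: cint_bnd; [by []|exact: subset_refl|by rewrite lerBlDr lerDl| | |].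
  - by apply: cmeasM; [exact: wkern_meas|apply: cmeas_real; exact: measurable_inv].
  - by rewrite divr_ge0 ?B0 ?ltW.
  - move=> s; rewrite /= in_itv/= => /andP[Ms _]; rewrite cabsM cabs_real cabs_wkern.
    have s0 : 0 < s by exact: lt_le_trans Ms.
    apply: ler_pM => //; first exact: cabs_ge0.
    by rewrite /kinv normfV gtr0_norm// lef_pV2.
have tri (x x3 y1 y2 y3 z1 z2 w : C) : cabs (x + x3 + (- y1 - y2 - y3 + (z1 + z2) / 2) + w) <=
    cabs x + cabs x3 + (cabs y1 + cabs y2 + cabs y3 + (cabs z1 + cabs z2) / 2) + cabs w.
  apply: (le_trans (cabsD _ _)); apply: lerD => //; apply: (le_trans (cabsD _ _)); apply: lerD; first exact: cabsD.
  apply: (le_trans (cabsD _ _)); apply: lerD.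
    by do 2! [apply: (le_trans (cabsB _ _)); apply: lerD => //]; rewrite cabsN.
  by rewrite cabs_half; apply: ler_wpM2r => //; exact: cabsD.
apply: (le_trans (tri _ _ _ _ _ _ _ _)).
move: b1 b2 b3 k1 k2 k3 k4 k5 k6; rewrite cabs_half.
do 8! [move: (cabs (_ + _)) || move: (cabs (wint _ _ _ _))].
move=> w1 w2 w3 w4 w5 w6 w7 w8; clear -e0.
move: (cabs (pvint _ _ _)) (cabs (pv _ _)) (pvsum b r) (A / r) parab_avg (B / (M - 1)) => z1 z2 z3 z4 z5 z6; lra.
Qed.

Lemma wkern_limit b r (a : R) l : a != 0 -> 1 <= r ->
  ccvg \oo (fun n => pvint (n.+1%:R^-1 / `|a|) ((n.+1%:R^-1)^-1 / `|a|) (wkern b)) l ->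
  cabs l <= cabs (pv 1 (bkern false b)) + pvsum b r / 4 + 2 * (A / r) + 40 * parab_avg.
Proof.
move=> a0 r1 cl; have [L P] := PR false b; have [_ _ L0 _] := P.
have h16 : 16 * 16^-1 = 1 :> R by rewrite mulfV.
have ap : 0 < `|a| by rewrite normr_gt0.
have aV : 0 < `|a|^-1 by rewrite invr_gt0.
apply/ler_addgt0Pr => eta eta0; apply: (ccvg_le cl).
(* Thresholds for $n + 1$: [X1] gives $e \le 1/16$, [X3] gives $r \le M - 1$ and so $M \ge 2$, while
   [X2] and [X4] make each of the two error terms at most half of [eta]. *)
pose X1 := 16 * `|a|^-1; pose X2 := 2 * ((10 * L + 8 * B) * `|a|^-1) / eta.
pose X3 := `|a| * (1 + r); pose X4 := `|a| * (1 + 4 * B / eta).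
near=> n; have nX X : X <= n%:R -> X <= n.+1%:R by move=> h; rewrite (le_trans h)// ler_nat.
have n1 : X1 <= n.+1%:R by apply: nX; near: n; exact: nbhs_infty_ger.
have n2 : X2 <= n.+1%:R by apply: nX; near: n; exact: nbhs_infty_ger.
have n3 : X3 <= n.+1%:R by apply: nX; near: n; exact: nbhs_infty_ger.
have n4 : X4 <= n.+1%:R by apply: nX; near: n; exact: nbhs_infty_ger.
move: n1 n2 n3 n4; rewrite invrK; move: (n.+1%:R : R) (ltr0Sn R n) => X X0 n1 n2 n3 n4.
have M1 : 1 + r <= X / `|a| by rewrite ler_pdivlMr// mulrC.
have M2 : 1 + 4 * B / eta <= X / `|a| by rewrite ler_pdivlMr// mulrC.
have e0 : 0 < X^-1 / `|a| by rewrite divr_gt0 ?invr_gt0.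
have e1 : X^-1 / `|a| <= 16^-1.
  have -> : X^-1 / `|a| = `|a|^-1 / X by rewrite mulrC.
  rewrite ler_pdivrMr//; move: n1; rewrite /X1; lra.
have M3 : 2 <= X / `|a| by lra.
have M4 : r <= X / `|a| - 1 by lra.
apply: (le_trans (pvint_wkern_bound P r1 e0 e1 M3 M4)); rewrite lerD2l.
have t1 : (10 * L + 8 * B) * (X^-1 / `|a|) <= eta / 2.
  have -> : (10 * L + 8 * B) * (X^-1 / `|a|) = ((10 * L + 8 * B) * `|a|^-1) / X by rewrite [X^-1 / _]mulrC mulrA.
  rewrite ler_pdivrMr//; move: n2; rewrite /X2 ler_pdivrMr//; move: (_ * `|a|^-1) => u hu.
  have -> : eta / 2 * X = (X * eta) / 2 by ring.
  by rewrite ler_pdivlMr// mulrC.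
have t2 : 2 * (B / (X / `|a| - 1)) <= eta / 2.
  have M0 : 0 < X / `|a| - 1 by lra.
  rewrite mulrA ler_pdivrMr//.
  have : 4 * B / eta <= X / `|a| - 1 by lra.
  rewrite ler_pdivrMr//; move: (X / `|a| - 1) => u hu; lra.
lra.
Unshelve. all: by end_near.
Qed.
End Parabola.

(** * Pointwise majorant for a nonzero finite slope *)

Section FiniteSlope.
Context {R : realType}.
Local Notation C := R[i].
Local Notation Re := (@complex.Re R).
Local Notation Im := (@complex.Im R).
Local Notation mu := (@lebesgue_measure R).
Implicit Types (f g : R -> C) (K N a b x y r : R).

Definition L1 g : R := \int[mu]_v cabs (g v).
Definition parab_mean g y : R := \int[mu]_s (wgt s * cabs (g (y - parab s))).

(** The estimate gives the weights 3/2, 1/2, 1/2, 1/2 for the four operators, since [pvsum] over 4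
    counts each of them twice, for $b$ and $-b$. They are rounded up to integers. *)
Definition majorant r g y : \bar R :=
  (frakC false 1 g y + frakC false 1 g y + frakC true 1 g y + frakC false r g y + frakC true r g y
   + (40 * parab_mean g y)%:E)%E.

Lemma csmooth_ccont f K t : csmooth f K -> ccont_at f t.
Proof. by move=> [s1 s2]; split; [exact: (smooth2_cont s1)|exact: (smooth2_cont s2)]. Qed.

Lemma csmooth_cabs_int f K : csmooth f K -> mu.-integrable setT (EFin \o (fun v => cabs (f v))).
Proof.
move=> sf; apply: (@integrable_decay _ _ (2 * K)); first exact: measurable_cabs (csmooth_meas sf).
by move=> v; rewrite ger0_norm ?cabs_ge0//; exact: csmooth_bound.
Qed.

Lemma parab_limit_majorant g K N y b r a l : csmooth g K -> a != 0 -> 1 <= r ->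
  ccvg \oo (fun n => pvint (n.+1%:R^-1 / `|a|) ((n.+1%:R^-1)^-1 / `|a|)
    (wkern (fun v => g (y - v) * expi (N * v)) b)) l ->
  ((cabs l)%:E <= majorant r g y + (2 * (L1 g / r))%:E)%E.
Proof.
move=> sg a0 r1 cl; pose q v : C := g (y - v) * expi (N * v).
have m10 : -1 != 0 :> R by rewrite oppr_eq0 oner_neq0.
have real_bound (c u1 v1 u2 v2 u3 v3 u4 v4 n1 n2 n3 n4 z1 z2 : R) :
    c <= u1 + (u3 + u1 + (v3 + v1) + (u4 + u2 + (v4 + v2))) / 4 + z1 + z2 ->
    u1 <= n1 -> v1 <= n1 -> u2 <= n2 -> v2 <= n2 -> u3 <= n3 -> v3 <= n3 -> u4 <= n4 -> v4 <= n4 ->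
    0 <= u1 -> 0 <= u2 -> 0 <= u3 -> 0 <= u4 -> c <= n1 + n1 + n2 + n3 + n4 + z2 + z1.
  by clear; lra.
have qE v : cabs (q v) = cabs (g (y - v)) by rewrite cabsM cabs_expi mulr1.
have dm t : is_derive t (1 : R) (fun u : R => y - u) (-1).
  by apply: is_derive_eq (der_add (der_cst y t) (der_opp (der_id t))) _; rewrite add0r.
have mq : cmeas q.
  by apply: cmeasM; [exact: shift_meas (csmooth_meas sg)|apply: cmeas_expi; exact: measurable_funM].
have cq t : ccont_at q t.
  apply: ccont_atM; last by apply: ccont_at_expi; exact: is_derive_cont (der_scale N (der_id t)).
  apply: (@ccont_at_comp _ g (fun u : R => y - u)); last exact: csmooth_ccont sg.
  exact: is_derive_cont (dm t).
have qB t : cabs (q t) <= 2 * K by rewrite qE; exact: csmooth_bound1.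
have iq : mu.-integrable setT (EFin \o (fun v => cabs (q v))).
  have := @integrable_affine _ (-1) y _ m10 (csmooth_cabs_int sg).
  by apply: eq_integrable => // v _; rewrite /= qE mulN1r addrC.
have qA : \int[mu]_v cabs (q v) <= L1 g.
  have := Rintegral_affine y m10 (csmooth_cabs_int sg); rewrite normrN1 invr1 mul1r /L1 => <-.
  by rewrite le_eqVlt; apply/orP; left; apply/eqP; apply: eq_Rintegral => v _; rewrite qE mulN1r addrC.
have bE sb b' : bkern q sb b' = (fun t => g (y - t) * ckern sb N b' t).
  by apply/funext => t; rewrite /bkern /q /ckern mulrA.
have PR sb b' : exists L, pv_regular (bkern q sb b') (2 * K) L.
  by rewrite bE; eexists; exact: shift_regular.
have := wkern_limit mq cq qB iq qA PR a0 r1 cl.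
rewrite /pvsum !bE -!/(frakT _ _ _ _ _ _).
have -> : parab_avg q = parab_mean g y by apply: eq_Rintegral => s _; rewrite qE.
have F sb r' b' : ((cabs (frakT sb r' g N b' y))%:E <= frakC sb r' g y)%E by exact: frakC_ge.
(* The values of [frakC] may be infinite; a real number between the terms for $b$, $-b$ and the
   supremum keeps the arithmetic in the reals. *)
have aux (u v : R) (X : \bar R) : (u%:E <= X)%E -> (v%:E <= X)%E -> exists2 m : R, (m%:E <= X)%E & u <= m /\ v <= m.
  move=> hu hv; exists (Num.max u v); last by rewrite !le_max !lexx orbT.
  by rewrite EFin_max ge_max hu.
have M2 sb r' := aux _ _ _ (F sb r' b) (F sb r' (- b)).
have [m1 h1 [p1 p1']] := M2 false 1; have [m2 h2 [p2 p2']] := M2 true 1.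
have [m3 h3 [p3 p3']] := M2 false r; have [m4 h4 [p4 p4']] := M2 true r.
move=> hl; rewrite /majorant.
apply: (@le_trans _ _ (m1%:E + m1%:E + m2%:E + m3%:E + m4%:E + (40 * parab_mean g y)%:E + (2 * (L1 g / r))%:E)%E); last first.
  exact: (leeD (leeD (leeD (leeD (leeD (leeD h1 h1) h2) h3) h4) (lexx _)) (lexx _)).
rewrite -!EFinD lee_fin.
exact: (real_bound _ _ _ _ _ _ _ _ _ _ _ _ _ _ _ hl p1 p1' p2 p2' p3 p3' p4 p4' (cabs_ge0 _) (cabs_ge0 _) (cabs_ge0 _) (cabs_ge0 _)).
Qed.

Lemma pvintZ (z : C) e M (H : R -> C) B : cmeas H -> (forall t, cabs (H t) <= B) -> 0 < e ->
  pvint e M (fun t => z * H t) = z * pvint e M H.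
Proof.
move=> mH HB e0; rewrite -cintM//; last exact: cintg_fold HB e0.
by apply: cint_eq => t _; rewrite -mulrBr mulrA.
Qed.

(** The measure $dt/t$ is invariant under positive dilations. The folded integrand is even, so a
    negative $c$ costs only a sign. *)
Lemma pvint_scale (c : R) e M (H : R -> C) B : cmeas H -> (forall t, cabs (H t) <= B) -> 0 < e -> c != 0 ->
  pvint (e / `|c|) (M / `|c|) (fun s => H (c * s)) = (Num.sg c)%:C%C * pvint e M H.
Proof.
move=> mH HB e0 c0; have c1 : 0 < `|c| by rewrite normr_gt0.
pose G t : C := (H t - H (- t)) / t%:C%C.
have iG : cintg `[`|c| * (e / `|c|) + 0, `|c| * (M / `|c|) + 0] G.
  apply: cintg_fold HB _ => //; rewrite addr0 mulrC divfK ?normr_eq0//.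
have := cint_affine_itv c1 iG; rewrite !addr0 ![`|c| * (_ / _)]mulrC !divfK ?normr_eq0// => E.
have GE s : (H (c * s) - H (c * - s)) / s%:C%C = (c%:C%C) * G (`|c| * s + 0).
  have Geven t : G (- t) = G t by rewrite /G opprK rmorphN invrN mulrN -mulNr opprB.
  have -> : G (`|c| * s + 0) = G (c * s).
    rewrite addr0; have [c2|c2] := leP 0 c; first by rewrite ger0_norm.
    by rewrite ltr0_norm// mulNr Geven.
  have aux (w u v : C) : w != 0 -> v * u = w * (v * (w^-1 * u)).
    by move=> w0; rewrite [in RHS]mulrCA mulVKf.
  rewrite /G rmorphM invfM -mulrN; apply: aux.
  by rewrite -(rmorph0 (real_complex R)) (inj_eq (@complexI R)).
transitivity (c%:C%C * cintegral `[e / `|c|, M / `|c|] (fun s => G (`|c| * s + 0))).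
  rewrite -cintM//; last first.
    have mH' : cmeas (fun s => H (c * s)) by apply: cmeas_comp mH; exact: measurable_funM.
    have e1 : 0 < e / `|c| by rewrite divr_gt0.
    apply: (@cintg_eq _ _ (fun s => (c^-1)%:C%C * ((H (c * s) - H (c * - s)) / s%:C%C))) => //.
      by move=> s _; rewrite GE mulrA -rmorphM mulVf// mul1r.
    by apply: cintgM => //; exact: (cintg_fold _ mH' (fun s => HB (c * s)) e1).
  by apply: cint_eq => s _; rewrite GE.
rewrite E mulrA -rmorphM; congr (_%:C%C * _).
by rewrite {1}[c]numEsg -mulrA mulfV ?normr_eq0// mulr1.
Qed.

Definition dilate (c : R) f (z : R) : C := f (c * z).

(** With $t = a s$ the argument $x + (at + t^2)/(2\pi)$ becomes $x + la\, v$. Dilation by $-la$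
    writes it as $y - v$ with $y = -x/la$, the convolution form of [frakC]. The linear phase $b a s$
    is $be(1 + 2s)$ up to a constant, with $be = ba/2$, and $N$ becomes $N la$; constant phases and
    the sign of $a$ go into the unimodular factor [z]. *)
Lemma multop_fin_majorant f K K' a b N x r la : a != 0 -> la = a ^+ 2 / (8 * pi) -> csmooth f K ->
  csmooth (dilate (- la) f) K' -> 1 <= r ->
  ((cabs (multop (a%:E) b (fun y => expi (N * y) * f y) x))%:E <=
    majorant r (dilate (- la) f) (- la^-1 * x)%R + (2 * (L1 (dilate (- la) f) / r))%:E)%E.
Proof.
move=> a0 laE sf sg r1; pose be := b * a / 2.
have la0 : la != 0 by rewrite laE mulf_neq0 ?expf_neq0// invr_eq0 mulf_neq0// gt_eqF// pi_gt0.
pose z : C := expi (be - N * x) * (Num.sg a)%:C%C.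
have kE s : wkern (fun v => dilate (- la) f (- la^-1 * x - v) * expi (N * la * v)) be s =
    expi (be - N * x) * kern f N x a b 1 0 (a * s).
  pose Y := x + la * parab s.
  have Y1 : x + (a * (a * s) + 1 * (a * s) ^+ 2) / (2 * pi) = Y.
    rewrite /Y laE /parab; have := @pi_gt0 R; move: (@pi R) => P P0.
    by field; rewrite gt_eqF.
  have Y2 : - la * (- la^-1 * x - parab s) = Y.
    by rewrite /Y; field.
  rewrite /wkern /kern Y1 /dilate Y2 !mulrA mulrAC -!expiD; congr (expi _ * _).
  by rewrite /Y /be /parab; field.
have cz : cabs z = 1 by rewrite cabsM cabs_expi mul1r cabs_real normr_sg a0.
have cv := ccvgMr z (kern_mult_cvg N x a b 1 0 sf).
rewrite multop_fin.
have -> : cabs (kern_mult f N x a b 1 0) = cabs (kern_mult f N x a b 1 0 * z) by rewrite cabsM cz mulr1.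
apply: (parab_limit_majorant sg a0 r1 (N := N * la) (b := be)).
have <- : (fun n : nat => pvint n.+1%:R^-1 n.+1%:R^-1^-1 (kern f N x a b 1 0) * z) = (fun n => pvint (n.+1%:R^-1 / `|a|) (n.+1%:R^-1^-1 / `|a|)
    (wkern (fun v => dilate (- la) f (- la^-1 * x - v) * expi (N * la * v)) be)); last exact: cv.
apply/funext => n.
have -> : wkern (fun v => dilate (- la) f (- la^-1 * x - v) * expi (N * la * v)) be = (fun s => expi (be - N * x) * kern f N x a b 1 0 (a * s)).
  by apply/funext => s; exact: kE.
have n0 : 0 < n.+1%:R^-1 :> R by rewrite invr_gt0.
have km := kern_meas N x a b 1 0 sf; have kb t := kern_bound N x a b 1 0 sf t.
rewrite (@pvintZ _ _ _ (fun s => kern f N x a b 1 0 (a * s)) (2 * K)).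
- by rewrite (pvint_scale _ km kb n0 a0) mulrC mulrA.
- by apply: cmeas_comp km; exact: measurable_funM.
- by move=> t; exact: kb.
- by rewrite divr_gt0// normr_gt0.
Qed.
End FiniteSlope.

(** * The slopes 0 and +oo *)

Section LimitSlopes.
Context {R : realType}.
Local Notation C := R[i].
Local Notation mu := (@lebesgue_measure R).
Implicit Types (f g : R -> C) (K N b x y r e M : R).

Lemma pvint_dist_near (H H' : R -> C) B B' A1 e M : cmeas H -> (forall t, cabs (H t) <= B) ->
  cmeas H' -> (forall t, cabs (H' t) <= B') -> 0 < e -> e <= M -> 0 <= A1 ->
  (forall t, `|t| <= M -> cabs (H t - H' t) <= A1 * `|t|) ->
  cabs (pvint e M H - pvint e M H') <= 4 * (A1 * M).
Proof.
move=> mH HB mH' HB' e0 eM A0 hA; rewrite -(pvintB M e0 mH HB mH' HB').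
apply: (@le_trans _ _ (2 * ((2 * A1) * (M - e)))).
  apply: pvint_small => //; [exact: cmeasB|by rewrite mulr_ge0|].
  move=> t t0 tM; have tn : `|t| = t by rewrite gtr0_norm.
  have := hA t; rewrite tn => /(_ tM) h1.
  have := hA (- t); rewrite normrN tn => /(_ tM) h2.
  by apply: (le_trans (cabsB _ _)); lra.
have -> : 2 * (2 * A1 * (M - e)) = 4 * (A1 * (M - e)) by ring.
by apply: ler_wpM2l => //; apply: ler_wpM2l => //; lra.
Qed.

Lemma pvint_tail_bound (H : R -> C) A2 e M : cmeas H -> 1 <= e -> 0 <= A2 ->
  (forall t, e <= `|t| -> cabs (H t) <= A2 / t ^+ 2) -> cabs (pvint e M H) <= 8 * pi * A2 / e.
Proof.
move=> mH e1 A0 hA; have e0 : 0 < e by exact: lt_le_trans e1.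
rewrite /pvint cint_mkcond; have -> : 8 * pi * A2 / e = 2 * ((4 * A2 / e) * pi) by ring.
rewrite -Rintegral_Zwgt; apply: cint_le => //.
- apply: cmeasM; last exact: cmeas_fold.
  by apply: cmeas_real; exact: measurable_indic.
- exact: integrable_Zwgt.
move=> t _; rewrite cabsM cabs_real indicE; have [|_] := boolP (t \in _); last first.
  by rewrite normr0 mul0r !mulr_ge0 ?wgt_ge0 ?invr_ge0// ltW.
rewrite inE /= in_itv/= normr1 mul1r cabs_div => /andP[et _].
have t0 : 0 < t by exact: lt_le_trans et.
have t1 : 1 <= t by exact: le_trans et.
have tn : `|t| = t by rewrite gtr0_norm.
have h1 : cabs (H t) <= A2 / t ^+ 2 by apply: hA; rewrite tn.
have h2 : cabs (H (- t)) <= A2 / t ^+ 2 by rewrite -sqrrN; apply: hA; rewrite normrN tn.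
have h3 : cabs (H t - H (- t)) <= 2 * (A2 / t ^+ 2) by apply: (le_trans (cabsB _ _)); lra.
have w2 : (t ^+ 2)^-1 <= 2 * wgt t.
  rewrite /wgt ler_pdivlMr ?ltr_pwDl ?sqr_ge0// mulrC ler_pdivrMr ?exprn_gt0//.
  have : 1 <= t ^+ 2 by rewrite exprn_ege1.
  lra.
rewrite tn; apply: (@le_trans _ _ (2 * (A2 / t ^+ 2) * e^-1)).
  by apply: ler_pM => //; [exact: cabs_ge0|rewrite invr_ge0 ltW|rewrite lef_pV2].
have -> : 2 * (A2 / t ^+ 2) * e^-1 = (2 * A2 / e) * (t ^+ 2)^-1 by ring.
have -> : 4 * A2 / e * wgt t = (2 * A2 / e) * (2 * wgt t) by ring.
by apply: ler_wpM2l => //; rewrite divr_ge0 ?mulr_ge0// ltW.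
Qed.

Lemma wgt_abs_bound y : (1 + `|y|) ^+ 2 * wgt y <= 2.
Proof.
rewrite /wgt ler_pdivrMr ?ltr_pwDl ?sqr_ge0// -(real_normK (num_real y)).
move: (`|y|) => u; have := sqr_ge0 (1 - u); lra.
Qed.

Lemma modulation_lip f K N (u v : R) : csmooth f K ->
  cabs (expi (N * u) * f u - expi (N * v) * f v) <= (2 * K + 4 * K * `|N|) * `|u - v|.
Proof.
move=> sf.
have -> : expi (N * u) * f u - expi (N * v) * f v = expi (N * u) * (f u - f v) + (expi (N * u) - expi (N * v)) * f v by ring.
apply: (le_trans (cabsD _ _)); rewrite !(cabsM _ (_ - _)) (cabsM (_ - _)) cabs_expi mul1r mulrDl.
apply: lerD; first exact: csmooth_lip.
have -> : 4 * K * `|N| * `|u - v| = (2 * `|N * u - N * v|) * (2 * K) by rewrite -mulrBr normrM; ring.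
by apply: ler_pM; [exact: cabs_ge0|exact: cabs_ge0|exact: cabs_expiB|exact: csmooth_bound1].
Qed.

(** The decay of $f$ along the curve becomes decay in $t$ as soon as $t$ is controlled by the
    distance travelled; $(1+|y|)^2$ is absorbed by [wgt y] at the cost of a factor 2. *)
Lemma kern_tail f K N x al be de ga (t c : R) : csmooth f K -> 0 <= c -> 
  t ^+ 2 <= c * (1 + `|x + (al * t + de * t ^+ 2) / (2 * pi)|) ^+ 2 -> t != 0 ->
  cabs (kern f N x al be de ga t) <= 4 * K * c / t ^+ 2.
Proof.
move=> sf c0; rewrite /kern !cabsM !cabs_expi !mul1r; move: (x + _) => y ht t0.
have K0 := csmooth_gt0 sf.
rewrite ler_pdivlMr ?exprn_even_gt0 ?t0//.
apply: (@le_trans _ _ (2 * K * wgt y * (c * (1 + `|y|) ^+ 2))).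
  by apply: ler_pM; [exact: cabs_ge0|exact: sqr_ge0|exact: csmooth_bound|].
have -> : 2 * K * wgt y * (c * (1 + `|y|) ^+ 2) = 2 * K * c * ((1 + `|y|) ^+ 2 * wgt y) by ring.
have -> : 4 * K * c = 2 * K * c * 2 by ring.
by apply: ler_wpM2l; [rewrite !mulr_ge0// ltW|exact: wgt_abs_bound].
Qed.

Lemma ccvg_near_le (u v : nat -> C) (l l' : C) k : ccvg \oo u l -> ccvg \oo v l' ->
  (\forall n \near \oo, cabs (u n - v n) <= k) -> cabs (l - l') <= k.
Proof. by move=> cu cv; exact: (ccvg_le (ccvgB cu cv)). Qed.

(** With $m = n+1$ and slope $al = 1/(2m^2)$, the kernels differ by $O(al\,|t|)$ on $|t| \le m$,
    which integrates to $O(al\, m) = O(1/m)$. For $|t| \ge m$ each kernel is treated separately: its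
    slope is at most 1/2, so the quadratic term dominates and [kern_tail] gives $O(1/m)$. *)
Lemma multop_zero_slope f K b N x : csmooth f K -> exists c, forall n : nat,
  cabs (multop 0%:E b (fun y => expi (N * y) * f y) x) <=
  cabs (multop ((2 * n.+1%:R ^+ 2)^-1)%:E b (fun y => expi (N * y) * f y) x) + c / n.+1%:R.
Proof.
move=> sf; have K0 := csmooth_gt0 sf.
pose Lf := 2 * K + 4 * K * `|N|; pose cx := 4 * pi * (1 + `|x|); pose A2 := 4 * K * cx.
have L0 : 0 <= Lf by rewrite addr_ge0// !mulr_ge0// ltW.
have P0 := @pi_gt0 R; have cx0 : 0 <= cx by rewrite !mulr_ge0 ?pi_ge0 ?addr_ge0.
have A0 : 0 <= A2 by rewrite !mulr_ge0// ltW.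
exists (4 * Lf + 16 * pi * A2) => n; rewrite !multop_fin.
have : 1 <= n.+1%:R :> R by rewrite ler1n.
move: (n.+1%:R : R) => m m1.
have m0 : 0 < m by exact: lt_le_trans m1.
set al := (2 * m ^+ 2)^-1.
have al0 : 0 <= al by rewrite invr_ge0 mulr_ge0// sqr_ge0.
have mm : 1 <= m ^+ 2 by rewrite exprn_ege1.
have al2 : al <= 2^-1 by rewrite lef_pV2 ?posrE ?mulr_gt0 ?exprn_gt0//; lra.
have ale : al * m = (2 * m)^-1 by rewrite /al; field; rewrite gt_eqF.
have half0 : 0 <= 2^-1 :> R by rewrite invr_ge0.
have tailk a' t : 0 <= a' -> a' <= 2^-1 -> m <= `|t| -> cabs (kern f N x a' b 1 0 t) <= A2 / t ^+ 2.
  move=> a0 a2 mt; have t0 : t != 0 by rewrite -normr_gt0 (lt_le_trans m0).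
  apply: kern_tail => //; rewrite mul1r; set Y := x + _.
  have YE : a' * t + t ^+ 2 = 2 * pi * (Y - x).
    by rewrite /Y; move: (@pi R) P0 => P P0; field; rewrite gt_eqF.
  have T1 : t ^+ 2 <= 2 * `|a' * t + t ^+ 2|.
    have t1 : 1 <= `|t| by exact: le_trans mt.
    have := lerB_normD (t ^+ 2) (a' * t); rewrite addrC [in X in _ <= X -> _]addrC.
    rewrite -(real_normK (num_real t)) normrX normr_id (normrM a') (ger0_norm a0).
    have : a' * `|t| <= 2^-1 * (`|t| ^+ 2).
      by apply: ler_pM => //; rewrite expr2 ler_peMr.
    lra.
  rewrite YE normrM (gtr0_norm (mulr_gt0 (ltr0Sn R 1) P0)) in T1.
  apply: (le_trans T1); have := ler_normB Y x => T2.
  rewrite /cx; have -> : 4 * pi * (1 + `|x|) * (1 + `|Y|) ^+ 2 = 2 * (2 * pi * ((1 + `|x|) * (1 + `|Y|) ^+ 2)) by ring.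
  apply: ler_wpM2l => //; apply: ler_wpM2l; first by rewrite mulr_ge0// ltW.
  apply: (le_trans T2); have := normr_ge0 x; have := normr_ge0 Y.
  move: (`|x|) (`|Y|) => u v v0 u0; nra.
have d (k0 kal : C) c : cabs (kal - k0) <= c -> cabs k0 <= cabs kal + c.
  by move=> h; apply: (le_trans (cabs_distl k0 kal)); rewrite lerD2l -cabsN opprB.
apply: d; apply: (ccvg_near_le (kern_mult_cvg N x al b 1 0 sf) (kern_mult_cvg N x 0 b 1 0 sf)).
near=> j.
have j1 : m <= j.+1%:R.
  have : m <= j%:R by near: j; exact: nbhs_infty_ger.
  by move=> h; rewrite (le_trans h)// ler_nat.
rewrite invrK; move: (j.+1%:R : R) j1 => M mM.
have M0 : 0 < M by exact: lt_le_trans mM.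
have e0 : 0 < M^-1 by rewrite invr_gt0.
have e1 : M^-1 <= m by rewrite (le_trans _ m1)// invf_le1// (le_trans m1).
have k1 := kern_meas N x al b 1 0 sf; have k2 := kern_meas N x 0 b 1 0 sf.
have b1 := kern_bound N x al b 1 0 sf; have b2 := kern_bound N x 0 b 1 0 sf.
rewrite (pvint_chasles k1 b1 e0 e1 mM) (pvint_chasles k2 b2 e0 e1 mM).
have nearb : cabs (pvint M^-1 m (kern f N x al b 1 0) - pvint M^-1 m (kern f N x 0 b 1 0)) <= 4 * (Lf * al * m).
  apply: (pvint_dist_near k1 b1 k2 b2) => //; first exact: mulr_ge0.
  move=> t _; rewrite /kern -mulrBr cabsM cabs_expi mul1r.
  apply: (le_trans (modulation_lip _ _ _ sf)); rewrite -/Lf -mulrA; apply: ler_wpM2l => //.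
  have -> : x + (al * t + 1 * t ^+ 2) / (2 * pi) - (x + (0 * t + 1 * t ^+ 2) / (2 * pi)) = al * t / (2 * pi) by ring.
  have p2 : 1 <= 2 * @pi R by have := @pi_ge2 R; lra.
  rewrite normrM normrV ?unitfE ?gt_eqF//; last by lra.
  rewrite normrM (ger0_norm al0) (ger0_norm (le_trans ler01 p2)) ler_pdivrMr; last by lra.
  by apply: ler_peMr => //; exact: mulr_ge0.
have t1 := pvint_tail_bound M k1 m1 A0 (fun t => tailk al t al0 al2).
have t2 := pvint_tail_bound M k2 m1 A0 (fun t => tailk 0 t (lexx _) half0).
have tri (z1 z2 w1 w2 : C) : cabs (z1 + z2 - (w1 + w2)) <= cabs (z1 - w1) + (cabs z2 + cabs w2).
  have -> : z1 + z2 - (w1 + w2) = (z1 - w1) + (z2 - w2) by ring.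
  by apply: (le_trans (cabsD _ _)); rewrite lerD2l cabsB.
apply: (le_trans (tri _ _ _ _)); apply: (le_trans (lerD nearb (lerD t1 t2))).
have -> : 4 * (Lf * al * m) = 2 * (Lf / m) by rewrite -(mulrA Lf) ale; field; rewrite gt_eqF.
have iv0 : 0 <= m^-1 by rewrite invr_ge0 ltW.
have -> : (4 * Lf + 16 * pi * A2) / m = 4 * (Lf / m) + 2 * (8 * pi * A2 / m) by ring.
have := mulr_ge0 L0 iv0.
move: (Lf / m) (8 * pi * A2 / m) => u v; lra.
Unshelve. all: by end_near.
Qed.

(* With w = sqrt (1 + v), the left-hand side equals |w - 1|^3 (w + 3) / 8. *)
Lemma sqrt_taylor (v : R) : -1 <= v -> `|Num.sqrt (v + 1) - 1 - v / 2 + v ^+ 2 / 8| <= `|v| ^+ 3.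
Proof.
move=> v1; have v0 : 0 <= v + 1 by lra.
have := sqr_sqrtr v0; have := sqrtr_ge0 (v + 1); move: (Num.sqrt _) => w w0 wE.
have -> : v = (w - 1) * (w + 1) by rewrite -[LHS](addrK 1) -wE; ring.
have -> : w - 1 - (w - 1) * (w + 1) / 2 + ((w - 1) * (w + 1)) ^+ 2 / 8 = (w - 1) ^+ 3 * ((w + 3) / 8) by field.
rewrite normrM normrX (normrM (w - 1)) exprMn; apply: ler_wpM2l; first exact: exprn_ge0.
have w1 : 0 <= w + 1 by lra.
have w2 : 0 <= (w + 3) / 8 by lra.
rewrite (ger0_norm w1) (ger0_norm w2).
have : 0 <= w ^+ 3 /\ 0 <= w ^+ 2 by split; exact: exprn_ge0.
have -> : (w + 1) ^+ 3 = w ^+ 3 + 3 * w ^+ 2 + 3 * w + 1 by ring.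
move=> [h1 h2]; lra.
Qed.

(* In the variable v = t / m^4 the frequency -8 b m^8 of the bracket is the one for
   which the quadratic Taylor term of sqrt (1 + v) reproduces the phase b t^2. *)
Lemma multop_pinfty_bound f K K' b N x (n : nat) ka : csmooth f K ->
  ka = n.+1%:R ^+ 4 / (2 * pi) -> csmooth (dilate (- ka) f) K' ->
  ((cabs (multop +oo%E b (fun y => expi (N * y) * f y) x))%:E <=
   frakC false ((n.+1%:R ^+ 3)^-1) (dilate (- ka) f) (- ka^-1 * x)%R +
   ((128 * K * `|b| + 128 * pi ^+ 3 * K * (1 + `|x|) ^+ 2) / n.+1%:R)%:E)%E.
Proof.
move=> sf; have K0 := csmooth_gt0 sf; have P0 := @pi_gt0 R.
have : 1 <= n.+1%:R :> R by rewrite ler1n.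
move: (n.+1%:R : R) => m m1 kaE sg.
have m0 : 0 < m by exact: lt_le_trans m1.
(* The exponents satisfy two demands: $la\, r = m \to \infty$, so that in $t$ the truncation
   disappears, and $la^2 r^3 = 1/m \to 0$, so that the cubic Taylor error does. *)
pose la := m ^+ 4; have la0 : 0 < la by exact: exprn_gt0.
have ka0 : ka != 0 by rewrite kaE mulf_neq0 ?invr_eq0 ?mulf_neq0 ?gt_eqF// exprn_gt0.
set r := (m ^+ 3)^-1; have r0 : 0 < r by rewrite invr_gt0 exprn_gt0.
have r1 : r <= 1 by rewrite invf_le1 ?exprn_gt0// exprn_ege1.
have lar : la * r = m by rewrite /la /r; field; rewrite gt_eqF.
(* The summand $4 b\, la^2$ cancels the linear Taylor term of the bracket, and the phase of [z]
   cancels the constant one. *)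
pose N' := N * ka + 4 * b * la ^+ 2; pose be := - 8 * b * la ^+ 2.
pose Q v : C := dilate (- ka) f (- ka^-1 * x - v) * ckern false N' be v.
pose z : C := expi (N * x + 8 * b * la ^+ 2).
have cz : cabs z = 1 by exact: cabs_expi.
pose k := kern f N x 1 0 0 b.
have mk : cmeas k by exact: kern_meas sf.
have bk t : cabs (k t) <= 2 * K by exact: kern_bound sf t.
have PQ : pv_regular Q _ _ := shift_regular false N' be (- ka^-1 * x) sg.
have [mQ bQ _ _] := PQ.
pose Qa t : C := z * Q (la^-1 * t).
have mQa : cmeas Qa.
  apply: cmeasM; first exact: cmeas_cst.
  by apply: cmeas_comp mQ; exact: measurable_funM.
have bQa t : cabs (Qa t) <= 2 * K' by rewrite /Qa cabsM cz mul1r.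
have nearb t : `|t| <= m -> cabs (k t - Qa t) <= (32 * K * `|b| / m ^+ 2) * `|t|.
  move=> tm; pose v := la^-1 * t.
  have tv : t = la * v by rewrite /v mulVKf// gt_eqF.
  have vr : `|v| <= r.
    rewrite /v normrM normfV (gtr0_norm la0) mulrC ler_pdivrMr//.
    by rewrite mulrC lar.
  have v1 : -1 <= v by move: vr; rewrite ler_norml => /andP[h _]; lra.
  have Y1 : x + (1 * t + 0 * t ^+ 2) / (2 * pi) = x + ka * v.
    rewrite tv kaE -/la; move: (@pi R) P0 (la) => P P0 la'; field; rewrite gt_eqF//.
  have Y2 : - ka * (- ka^-1 * x - v) = x + ka * v by field.
  rewrite /k /kern Y1 /Qa -/v /Q /dilate Y2 /ckern /z.
  have -> : expi (N * x + 8 * b * la ^+ 2) * (f (x + ka * v) * (expi (N' * v) * expi (be * bracket_sqrt false (v + 1)))) =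
    expi (N * x + 8 * b * la ^+ 2 + N' * v + be * bracket_sqrt false (v + 1)) * f (x + ka * v) :> C.
    by rewrite !expiD; ring.
  rewrite mulrA -expiD -mulrBl cabsM.
  have ph : cabs (expi (0 * t + b * t ^+ 2 + N * (x + ka * v)) - expi (N * x + 8 * b * la ^+ 2 + N' * v + be * bracket_sqrt false (v + 1)) : C) <= 16 * `|b| / m ^+ 2 * `|t|.
    apply: (le_trans (cabs_expiB _ _)).
    have v0 : 0 <= v + 1 by lra.
    rewrite (bracket_sqrt_pos _ v0).
    have -> : 0 * t + b * t ^+ 2 + N * (x + ka * v) - (N * x + 8 * b * la ^+ 2 + N' * v + be * Num.sqrt (v + 1)) =
      8 * (b * la ^+ 2) * (Num.sqrt (v + 1) - 1 - v / 2 + v ^+ 2 / 8).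
      by rewrite /N' /be tv; field.
    have := sqrt_taylor v1; move: (Num.sqrt _ - _ - _ + _) => S hS.
    rewrite (normrM (8 * _)) (normrM 8) (normrM b) (ger0_norm (sqr_ge0 la)) (ger0_norm (ler0n R 8)).
    have h3 : la ^+ 2 * `|v| ^+ 3 <= `|t| / m ^+ 2.
      have vn : `|v| = `|t| / la by rewrite /v normrM normfV (gtr0_norm la0) mulrC.
      have -> : la ^+ 2 * `|v| ^+ 3 = `|t| ^+ 3 / m ^+ 4 by rewrite vn -/la; field; rewrite gt_eqF.
      rewrite ler_pdivrMr ?exprn_gt0//.
      have -> : `|t| / m ^+ 2 * m ^+ 4 = `|t| * (m * m) by field; rewrite gt_eqF.
      by rewrite exprS expr2; apply: ler_wpM2l => //; apply: ler_pM.
    have h4 : la ^+ 2 * `|S| <= `|t| / m ^+ 2.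
      by apply: le_trans h3; apply: ler_wpM2l => //; exact: sqr_ge0.
    have -> : 2 * (8 * (`|b| * la ^+ 2) * `|S|) = 16 * `|b| * (la ^+ 2 * `|S|) by ring.
    have -> : 16 * `|b| / m ^+ 2 * `|t| = 16 * `|b| * (`|t| / m ^+ 2) by ring.
    by apply: ler_wpM2l => //; exact: mulr_ge0.
  have -> : 32 * K * `|b| / m ^+ 2 * `|t| = (16 * `|b| / m ^+ 2 * `|t|) * (2 * K) by ring.
  by apply: ler_pM; [exact: cabs_ge0|exact: cabs_ge0|exact: ph|exact: csmooth_bound1].
have tailb t : m <= `|t| -> cabs (k t) <= (16 * pi ^+ 2 * K * (1 + `|x|) ^+ 2) / t ^+ 2.
  move=> mt; have t0 : t != 0 by rewrite -normr_gt0 (lt_le_trans m0).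
  have -> : 16 * pi ^+ 2 * K * (1 + `|x|) ^+ 2 = 4 * K * (4 * pi ^+ 2 * (1 + `|x|) ^+ 2) by ring.
  apply: kern_tail => //; first by apply: mulr_ge0; [apply: mulr_ge0|]; rewrite ?sqr_ge0.
  set Y := x + _; have -> : t = 2 * pi * (Y - x).
    by rewrite /Y; move: (@pi R) P0 => P P0; field; rewrite gt_eqF.
  have -> : (2 * pi * (Y - x)) ^+ 2 = 4 * pi ^+ 2 * (Y - x) ^+ 2 by ring.
  rewrite -[leRHS]mulrA; apply: ler_wpM2l; first by rewrite mulr_ge0 ?sqr_ge0.
  rewrite -exprMn -(real_normK (num_real (Y - x))).
  have := ler_normB Y x; have := normr_ge0 (Y - x); have := normr_ge0 x; have := normr_ge0 Y.
  rewrite !expr2; move: (`|x|) (`|Y|) (`|Y - x|) => u1 u2 u3 h1 h2 h3 h4.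
  by apply: ler_pM => //; nra.
rewrite multop_pinfty.
have cQ : ccvg \oo (fun j : nat => pvint j.+1%:R^-1 m Qa) (z * frakT false r (dilate (- ka) f) N' be (- ka^-1 * x)).
  have [/cvg_at_rightP h1 /cvg_at_rightP h2] := pv_cvg PQ r0.
  have cs : ccvg \oo (fun j : nat => pvint (la^-1 / j.+1%:R) r Q) (pv r Q).
    have c0 : (fun j : nat => la^-1 / j.+1%:R) @ \oo --> (0 : R).
      by rewrite -[X in _ --> X](mulr0 la^-1); apply: cvgMr; exact: cvg_harmonic.
    by split; [apply: h1|apply: h2]; split => // j; rewrite divr_gt0 ?invr_gt0.
  have jE (j : nat) : pvint j.+1%:R^-1 m Qa = pvint (la^-1 / j.+1%:R) r Q * z.
    have j0 : 0 < j.+1%:R^-1 :> R by rewrite invr_gt0.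
    have c0 : la^-1 != 0 by rewrite invr_eq0 gt_eqF.
    have e0 : 0 < la^-1 / j.+1%:R by rewrite divr_gt0 ?invr_gt0.
    rewrite (@pvintZ _ z _ _ (fun t => Q (la^-1 * t)) (2 * K'))//.
      have n1 : `|la^-1| = la^-1 by rewrite gtr0_norm ?invr_gt0.
      have E1 : la^-1 / j.+1%:R / `|la^-1| = j.+1%:R^-1 by rewrite n1 -mulrA mulrC divfK.
      have E2 : r / `|la^-1| = m by rewrite n1 invrK mulrC.
      have s1 : Num.sg la^-1 = 1 by rewrite gtr0_sg ?invr_gt0.
      by have := pvint_scale r mQ bQ e0 c0; rewrite E1 E2 s1 => ->; rewrite mul1r mulrC.
    by apply: cmeas_comp mQ; exact: measurable_funM.
  by rewrite mulrC (funext jE); exact: ccvgMr.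
have dist : cabs (kern_mult f N x 1 0 0 b - z * frakT false r (dilate (- ka) f) N' be (- ka^-1 * x)) <=
    (128 * K * `|b| + 128 * pi ^+ 3 * K * (1 + `|x|) ^+ 2) / m.
  apply: (ccvg_near_le (kern_mult_cvg N x 1 0 0 b sf) cQ).
  near=> j.
  have j1 : m <= j.+1%:R.
    have : m <= j%:R by near: j; exact: nbhs_infty_ger.
    by move=> h; rewrite (le_trans h)// ler_nat.
  rewrite invrK; move: (j.+1%:R : R) j1 => M mM.
  have M0 : 0 < M by exact: lt_le_trans mM.
  have e0 : 0 < M^-1 by rewrite invr_gt0.
  have e1 : M^-1 <= m by rewrite (le_trans _ m1)// invf_le1// (le_trans m1).
  rewrite (pvint_chasles mk bk e0 e1 mM) addrAC; apply: (le_trans (cabsD _ _)).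
  have A10 : 0 <= 32 * K * `|b| / m ^+ 2 by rewrite !mulr_ge0 ?invr_ge0 ?sqr_ge0// ltW.
  have A20 : 0 <= 16 * pi ^+ 2 * K * (1 + `|x|) ^+ 2 by rewrite !mulr_ge0 ?sqr_ge0// ltW.
  have h1 := pvint_dist_near mk bk mQa bQa e0 e1 A10 nearb.
  have h2 := pvint_tail_bound M mk m1 A20 tailb.
  apply: (le_trans (lerD h1 h2)).
  have -> : 4 * (32 * K * `|b| / m ^+ 2 * m) = 128 * K * `|b| / m by field; rewrite gt_eqF.
  have -> : 8 * pi * (16 * pi ^+ 2 * K * (1 + `|x|) ^+ 2) / m = 128 * pi ^+ 3 * K * (1 + `|x|) ^+ 2 / m by ring.
  by rewrite -mulrDl.
have hz := cabs_distl (kern_mult f N x 1 0 0 b) (z * frakT false r (dilate (- ka) f) N' be (- ka^-1 * x)).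
rewrite cabsM cz mul1r in hz.
have hF := frakC_ge false r (dilate (- ka) f) N' be (- ka^-1 * x).
apply: le_trans (leeD hF (lexx _)); rewrite -EFinD lee_fin; apply: (le_trans hz).
by rewrite lerD2l.
Unshelve. all: by end_near.
Qed.
End LimitSlopes.

(** * Bounds in L^p *)

Section LpIntegral.
Context {R : realType}.
Local Notation C := R[i].
Local Notation mu := (@lebesgue_measure R).
Local Open Scope ereal_scope.
Implicit Types (h : R -> \bar R) (p c : R).

(** The $p$-th power of the norm, the form in which Fatou, Tonelli and dilations act directly. *)
Definition Lpint p h := \int[mu]_x (`|h x| `^ p).

Lemma Lpint_ge0 p h : 0 <= Lpint p h.
Proof. by apply: integral_ge0 => x _; exact: poweR_ge0. Qed.

Lemma le_poweR (r : R) (x y : \bar R) : (0 <= r)%R -> 0 <= x -> x <= y -> x `^ r <= y `^ r.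
Proof.
move=> r0 x0 xy; apply: gt0_ler_poweR => //; rewrite in_itv/= leey ?x0//.
by rewrite (le_trans x0 xy).
Qed.

Lemma normLp_le p c h h' : (0 < p)%R -> (0 <= c)%R ->
  normLp p h <= c%:E * normLp p h' <-> Lpint p h <= (c `^ p)%:E * Lpint p h'.
Proof.
move=> p0 c0; have pn : p != 0%R by rewrite gt_eqF.
have N0 g : 0 <= normLp p g by exact: Lnorm_ge0.
split => H.
  rewrite /Lpint -!(poweR_Lnorm mu _ pn) -poweR_EFin -poweRM ?lee_fin//; last exact: N0.
  by apply: le_poweR (ltW p0) (N0 h) H.
rewrite /normLp unlock.
have -> : c%:E = ((c `^ p)%:E) `^ p^-1 by rewrite -poweR_EFin -poweRrM mulfV// poweRe1.
rewrite -poweRM ?lee_fin ?powR_ge0//; last exact: Lpint_ge0.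
by apply: le_poweR => //; [rewrite invr_ge0 ltW|exact: Lpint_ge0].
Qed.

(* [sup_calC a f] need not be measurable, whence no measurability hypothesis on [f]. *)
Lemma ge0_le_integral_nonmeasurable (f g : R -> \bar R) : (forall x, 0 <= f x) -> (forall x, f x <= g x) ->
  \int[mu]_x f x <= \int[mu]_x g x.
Proof.
move=> f0 fg; have g0 x : 0 <= g x by exact: le_trans (fg x).
rewrite !ge0_integralTE//; apply: ereal_sup_le => _ [k kf <-]; exists k => // x.
exact: le_trans (kf x) (fg x).
Qed.

Lemma measurable_pow p h : measurable_fun setT h -> measurable_fun setT (fun x => `|h x| `^ p).
Proof.
move=> mh; apply: (@measurableT_comp _ _ _ _ _ _ (fun x : \bar R => x `^ p)); first exact: measurable_poweR.
exact: measurableT_comp.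
Qed.

Lemma Lpint_add p h h' : (0 < p)%R -> measurable_fun setT h -> measurable_fun setT h' ->
  (forall x, 0 <= h x) -> (forall x, 0 <= h' x) ->
  Lpint p (fun x => h x + h' x) <= (2 `^ p)%:E * (Lpint p h + Lpint p h').
Proof.
move=> p0 mh mh' h0 h0'; have c0 : 0 <= (2 `^ p)%:E by rewrite lee_fin powR_ge0.
rewrite /Lpint -ge0_integralD//; first last.
- exact: measurable_pow.
- by move=> x _; exact: poweR_ge0.
- exact: measurable_pow.
- by move=> x _; exact: poweR_ge0.
rewrite -ge0_integralZl//; first last.
- by move=> x _; rewrite adde_ge0// poweR_ge0.
- by apply: emeasurable_funD; exact: measurable_pow.
apply: ge0_le_integral_nonmeasurable => x; first exact: poweR_ge0.
rewrite !gee0_abs ?adde_ge0//; move: (h x) (h' x) (h0 x) (h0' x) => a b a0 b0.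
(* The crude inequality $(a+b)^p \le (2\max(a,b))^p \le 2^p(a^p + b^p)$ stands in for
   Minkowski's. *)
wlog ab : a b a0 b0 / a <= b.
  move=> W; case: (leP a b) => [|/ltW] ab; first exact: W.
  by rewrite addeC (addeC (a `^ p)); exact: W.
apply: (@le_trans _ _ ((2%:E * b) `^ p)).
  apply: le_poweR; [exact: ltW|exact: adde_ge0|].
  have -> : 2%:E = 1 + 1 :> \bar R by rewrite -EFinD.
  by rewrite ge0_muleDl// mul1e; apply: leeD.
rewrite poweRM// poweR_EFin; apply: lee_wpmul2l => //.
by apply: leeDr; exact: poweR_ge0.
Qed.

Lemma Lpint_dilate p (c : R) h : (c != 0)%R -> measurable_fun setT h ->
  Lpint p (fun x => h (c * x)%R) = (`|c|^-1)%:E * Lpint p h.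
Proof.
move=> c0 mh; have := @ge0_integral_affine R c 0 (fun x => `|h x| `^ p) c0 (measurable_pow p mh) (fun x => poweR_ge0 _ _).
by under eq_integral do rewrite addr0.
Qed.
End LpIntegral.

(** * The average along the parabola is bounded on $L^p$ *)

Section ParabolicMean.
Context {R : realType}.
Local Notation C := R[i].
Local Notation mu := (@lebesgue_measure R).
Implicit Types (g : R -> C) (K p y : R).

Lemma measurable_shear g : cmeas g -> measurable_fun setT (fun z : R * R => cabs (g (z.1 - parab z.2))).
Proof.
move=> mg; apply: (@measurable_cabs _ _ _ (fun z : R * R => g (z.1 - parab z.2))); apply: cmeas_comp mg.
apply: measurable_funB; first exact: mfst.
by apply: (@measurableT_comp _ _ _ _ _ _ (@parab R)); [exact: parab_meas|exact: msnd].
Qed.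

Lemma parab_meanE g K y : csmooth g K ->
  (parab_mean g y)%:E = (\int[mu]_s (wgt s * cabs (g (y - parab s)))%:E)%E.
Proof.
move=> sg; rewrite /parab_mean /Rintegral fineK//; apply: integrable_fin_num => //.
apply: (@integrable_decay _ _ (2 * K)).
  apply: measurable_funM; first exact: measurable_wgt.
  apply: (@measurable_cabs _ _ _ (fun s : R => g (y - parab s))); apply: cmeas_comp (csmooth_meas sg).
  by apply: measurable_funB => //; exact: parab_meas.
move=> s; rewrite ger0_norm ?mulr_ge0 ?wgt_ge0 ?cabs_ge0// mulrC.
by apply: ler_wpM2r; [exact: wgt_ge0|exact: csmooth_bound1].
Qed.

Lemma measurable_parab_mean g K : csmooth g K -> measurable_fun setT (fun y => (parab_mean g y)%:E).
Proof.
move=> sg; under eq_fun do rewrite (parab_meanE _ sg).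
apply: (@measurable_fun_fubini_tonelli_F _ _ _ _ _ mu (fun z : R * R => (wgt z.2 * cabs (g (z.1 - parab z.2)))%:E)).
  apply/measurable_EFinP; apply: measurable_funM; last exact: measurable_shear (csmooth_meas sg).
  by apply: (@measurableT_comp _ _ _ _ _ _ (@wgt R)); [exact: measurable_wgt|exact: msnd].
by move=> z; rewrite lee_fin mulr_ge0 ?wgt_ge0 ?cabs_ge0.
Qed.

Lemma parab_mean_ge0 g y : 0 <= parab_mean g y.
Proof. by apply: Rintegral_ge0 => s _; rewrite mulr_ge0 ?wgt_ge0 ?cabs_ge0. Qed.

(* Jensen's inequality for the measure wgt s ds, of total mass pi. *)
Lemma parab_mean_powR g K p y : 1 < p -> csmooth g K ->
  (((parab_mean g y) `^ p)%:E <= (pi `^ (p - 1))%:E * \int[mu]_s (wgt s * cabs (g (y - parab s)) `^ p)%:E)%E.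
Proof.
move=> p1 sg; have p0 : 0 < p by exact: lt_trans p1.
pose q := p / (p - 1); have q0 : 0 < q by rewrite divr_gt0// subr_gt0.
have pq : p^-1 + q^-1 = 1 by rewrite /q invf_div; field; rewrite gt_eqF.
(* Hölder's inequality with the weight shared between the factors as $wgt = wgt^{1/p}\,
   wgt^{1/q}$. *)
pose u s := wgt s `^ p^-1 * cabs (g (y - parab s)); pose v s : R := wgt s `^ q^-1.
have mphi : measurable_fun setT (fun s : R => cabs (g (y - parab s))).
  apply: (@measurable_cabs _ _ _ (fun s : R => g (y - parab s))); apply: cmeas_comp (csmooth_meas sg).
  by apply: measurable_funB => //; exact: parab_meas.
have mw r : measurable_fun setT (fun s : R => wgt s `^ r).
  apply: (@measurableT_comp _ _ _ _ _ _ (fun x : R => x `^ r)); first exact: measurable_powR.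
  exact: measurable_wgt.
have mu_ : measurable_fun setT u by exact: measurable_funM.
have := hoelder mu mu_ (mw q^-1) p0 q0 pq.
have -> : ('N[mu]_1[EFin \o (u \* v)%R] = (parab_mean g y)%:E)%E.
  rewrite Lnorm1 (parab_meanE _ sg); apply: eq_integral => s _ /=.
  rewrite /u /v mulrAC -powRD ?pq ?oner_eq0// powRr1 ?wgt_ge0// ger0_norm//.
  by rewrite mulr_ge0 ?wgt_ge0 ?cabs_ge0.
have -> : ('N[mu]_q%:E[EFin \o (fun s : R => (wgt s `^ q^-1)%R)] = (pi `^ q^-1)%:E)%E.
  rewrite unlock -poweR_EFin -integral_wgt; congr (_ `^ _)%E; apply: eq_integral => s _ /=.
  by rewrite ger0_norm ?powR_ge0// -powRrM mulVf ?gt_eqF// powRr1 ?wgt_ge0.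
have Nu : ('N[mu]_p%:E[EFin \o u] `^ p = \int[mu]_s (wgt s * cabs (g (y - parab s)) `^ p)%:E)%E.
  rewrite poweR_Lnorm ?gt_eqF//; apply: eq_integral => s _ /=.
  rewrite /u ger0_norm ?mulr_ge0 ?powR_ge0 ?cabs_ge0// powRM ?powR_ge0 ?cabs_ge0// -powRrM mulVf ?gt_eqF//.
  by rewrite powRr1 ?wgt_ge0.
move=> H; rewrite -Nu -poweR_EFin.
have -> : (pi `^ (p - 1))%:E = ((pi `^ q^-1)%:E `^ p)%E :> \bar R.
  rewrite poweR_EFin -powRrM; congr (_ `^ _)%:E; rewrite /q; field.
  by rewrite gt_eqF ?subr_gt0// gt_eqF.
rewrite -poweRM ?lee_fin ?powR_ge0//.
  by apply: le_poweR; rewrite ?lee_fin ?parab_mean_ge0//; [exact: ltW|rewrite muleC].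
exact: Lnorm_ge0.
Qed.

(** Tonelli after the pointwise Jensen bound: for each $s$ the translation by [parab s] preserves
    the $L^p$ norm, and the remaining mass of [wgt] turns $\pi^{p-1}$ into $\pi^p$. *)
Lemma Lpint_parab_mean g K p : 1 < p -> csmooth g K ->
  (Lpint p (fun y => (parab_mean g y)%:E) <= (pi `^ p)%:E * Lpint p (abs_fun g))%E.
Proof.
move=> p1 sg; have p0 : 0 < p by exact: lt_trans p1.
pose F (z : R * R) : \bar R := (wgt z.2 * cabs (g (z.1 - parab z.2)) `^ p)%:E.
have F0 z : (0 <= F z)%E by rewrite lee_fin mulr_ge0 ?wgt_ge0 ?powR_ge0.
have mF : measurable_fun setT F.
  apply/measurable_EFinP; apply: measurable_funM.
    by apply: (@measurableT_comp _ _ _ _ _ _ (@wgt R)); [exact: measurable_wgt|exact: msnd].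
  apply: (@measurableT_comp _ _ _ _ _ _ (fun x : R => x `^ p)); first exact: measurable_powR.
  exact: measurable_shear (csmooth_meas sg).
have mg : measurable_fun setT (fun x => (cabs (g x) `^ p)%:E).
  apply/measurable_EFinP; apply: (@measurableT_comp _ _ _ _ _ _ (fun x : R => x `^ p)); first exact: measurable_powR.
  exact: measurable_cabs (csmooth_meas sg).
apply: (@le_trans _ _ (\int[mu]_y ((pi `^ (p - 1))%:E * \int[mu]_s F (y, s)))%E).
  apply: ge0_le_integral_nonmeasurable => y; first exact: poweR_ge0.
  rewrite gee0_abs ?lee_fin ?parab_mean_ge0// poweR_EFin; exact: parab_mean_powR p1 sg.
rewrite ge0_integralZl; first last.
- by rewrite lee_fin powR_ge0.
- by move=> y _; exact: integral_ge0.
- exact: (@measurable_fun_fubini_tonelli_F _ _ _ _ _ mu F mF F0).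
- exact: measurableT.
rewrite fubini_tonelli//.
have E s : (\int[mu]_y F (y, s) = (wgt s)%:E * Lpint p (abs_fun g))%E.
  transitivity (\int[mu]_y ((wgt s)%:E * (cabs (g (1 * y + - parab s)) `^ p)%:E))%E.
    by apply: eq_integral => y _; rewrite /F /= mul1r EFinM.
  rewrite ge0_integralZl; first last.
  - by rewrite lee_fin wgt_ge0.
  - by move=> y _; rewrite lee_fin powR_ge0.
  - exact: (measurableT_comp mg (measurable_affine 1 (- parab s))).
  - exact: measurableT.
  rewrite (@ge0_integral_affine R 1 (- parab s) (fun x => (cabs (g x) `^ p)%:E))//; last by move=> x; rewrite lee_fin powR_ge0.
  rewrite normr1 invr1 mul1e; congr (_ * _)%E; apply: eq_integral => x _.
  by rewrite /abs_fun gee0_abs ?lee_fin ?cabs_ge0.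
under eq_integral do rewrite E.
rewrite ge0_integralZr//; first last.
- exact: Lpint_ge0.
- by move=> s _; rewrite lee_fin wgt_ge0.
- by apply/measurable_EFinP; exact: measurable_wgt.
rewrite integral_wgt muleA -EFinM; apply: lee_wpmul2r; first exact: Lpint_ge0.
rewrite lee_fin -[X in _ * X](@powRr1 _ pi) ?pi_ge0// -powRD ?subrK//.
by rewrite gt_eqF ?pi_gt0// implybT.
Qed.
End ParabolicMean.

(** * Behaviour under dilations *)

Section Dilation.
Context {R : realType}.
Local Notation C := R[i].
Local Notation mu := (@lebesgue_measure R).
Implicit Types (f : R -> C) (g : R -> R) (c p : R).

Lemma real_schwartz_dilate g c : c != 0 -> real_schwartz g -> real_schwartz (fun z => g (c * z)).
Proof.
move=> c0 [dg bg].
have dE n : derive1n n (fun z => g (c * z)) = (fun z => c ^+ n * derive1n n g (c * z)).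
  elim: n => [|n IH]; first by apply/funext => z; rewrite expr0 mul1r.
  apply/funext => z; rewrite derive1nS IH derive1E.
  have d1 : is_derive (c * z) (1 : R) (derive1n n g) (derive1n n.+1 g (c * z)).
    by rewrite derive1nS derive1E; apply: derivableP; exact: dg.
  have d2 : is_derive z (1 : R) (fun z => c * z) c by apply: is_derive_eq (der_scale c (der_id z)) _; ring.
  have d3 := der_scale (c ^+ n) (der_comp d1 d2).
  by rewrite (@derive_val _ _ _ _ _ _ _ d3) exprSr; ring.
split=> [n x|m n].
  rewrite dE; have d1 : is_derive (c * x) (1 : R) (derive1n n g) ('D_1 (derive1n n g) (c * x)).
    by apply: derivableP; exact: dg.
  have d2 : is_derive x (1 : R) (fun z => c * z) c by apply: is_derive_eq (der_scale c (der_id x)) _; ring.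
  exact: (@ex_derive _ _ _ _ _ _ _ (der_scale (c ^+ n) (der_comp d1 d2))).
have [K hK] := bg m n; exists (`|c| ^+ n / `|c| ^+ m * K) => x; rewrite dE.
have cm : `|c| ^+ m != 0 by rewrite expf_neq0// normr_eq0.
have -> : `|x| ^+ m * `|c ^+ n * derive1n n g (c * x)| =
   `|c| ^+ n / `|c| ^+ m * (`|c * x| ^+ m * `|derive1n n g (c * x)|).
  by rewrite !normrM normrX exprMn; field.
by apply: ler_wpM2l => //; rewrite divr_ge0// exprn_ge0.
Qed.

Lemma schwartz_dilate f c : c != 0 -> schwartz f -> schwartz (dilate c f).
Proof. by move=> c0 [s1 s2]; split; [exact: (real_schwartz_dilate c0 s1)|exact: (real_schwartz_dilate c0 s2)]. Qed.

Lemma measurable_abs_fun f : cmeas f -> measurable_fun setT (abs_fun f).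
Proof. by move=> mf; apply/measurable_EFinP; exact: measurable_cabs. Qed.

(** The Jacobians of $c$ and $c^{-1}$ cancel. Thus the constant does not see the dilation, which is
    the source of uniformity in the slope. *)
Lemma Lpint_rescale p f c M (h : R -> \bar R) : c != 0 -> cmeas f -> measurable_fun setT h ->
  (Lpint p h <= M%:E * Lpint p (abs_fun (dilate c f)))%E ->
  (Lpint p (fun x => h (c^-1 * x)%R) <= M%:E * Lpint p (abs_fun f))%E.
Proof.
move=> c0 mf mh H; have c1 : c^-1 != 0 by rewrite invr_eq0.
rewrite (Lpint_dilate p c1 mh).
have E : Lpint p (abs_fun (dilate c f)) = ((`|c|^-1)%:E * Lpint p (abs_fun f))%E.
  exact: (Lpint_dilate p c0 (measurable_abs_fun mf)).
rewrite E in H; have n0 : (0 <= (`|c^-1|^-1)%:E :> \bar R)%E by rewrite lee_fin invr_ge0.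
apply: (le_trans (lee_wpmul2l n0 H)); rewrite normfV invrK muleCA [X in (_ * X <= _)%E]muleA -EFinM mulfV ?normr_eq0//.
by rewrite mul1e.
Qed.

Lemma Lpint_scale p (k : R) (h : R -> \bar R) : 0 <= k -> measurable_fun setT h -> (forall x, 0 <= h x)%E ->
  Lpint p (fun x => k%:E * h x)%E = ((k `^ p)%:E * Lpint p h)%E.
Proof.
move=> k0 mh h0; rewrite /Lpint -ge0_integralZl; first last.
- by rewrite lee_fin powR_ge0.
- by move=> x _; exact: poweR_ge0.
- exact: measurable_pow.
- exact: measurableT.
by apply: eq_integral => x _; rewrite !gee0_abs ?mule_ge0 ?lee_fin// poweRM ?lee_fin.
Qed.
End Dilation.

(** * From pointwise lower limits to operator norms *)

Section Liminf.
Context {R : realType}.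
Local Notation mu := (@lebesgue_measure R).
Local Open Scope ereal_scope.
Implicit Types (u : nat -> \bar R).

Lemma einfs_le_limn_einf u n : einfs u n <= limn_einf u.
Proof.
rewrite limn_einf_lim (cvg_lim _ (ereal_nondecreasing_cvgn (@nondecreasing_einfs _ u)))//.
by apply: ereal_sup_ubound; exists n.
Qed.

Lemma le_limn_einf_cst u M : (forall n, u n <= M) -> limn_einf u <= M.
Proof.
move=> uM; rewrite limn_einf_lim (cvg_lim _ (ereal_nondecreasing_cvgn (@nondecreasing_einfs _ u)))//.
apply: ge_ereal_sup => _ [n _ <-]; apply: le_trans (uM n).
by apply: ereal_inf_lbound; exists n => /=.
Qed.

(** The constant $k$ is absent from the conclusion. It may therefore depend on $b$ and $N$, over
    which the supremum is taken only afterwards. *)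
Lemma limn_einf_power (c k p : R) u : (0 < p)%R -> (forall n, 0 <= u n) ->
  (forall n, c%:E <= u n + (k / n.+1%:R)%:E) ->
  c%:E <= (limn_einf (fun n => u n `^ p)) `^ p^-1.
Proof.
move=> p0 u0 H; apply/lee_addgt0Pr => d d0.
have [cd|dc] := leP (c - d)%R 0%R.
  apply: (@le_trans _ _ (0 + d%:E)); first by rewrite add0e lee_fin; lra.
  by apply: leeD => //; exact: poweR_ge0.
rewrite -leeBlDr// -EFinB.
have [n0 hn0] : exists n0 : nat, forall n, (n0 <= n)%N -> (k / n.+1%:R <= d)%R.
  exists (Num.truncn (`|k| / d)) => n hn; rewrite ler_pdivrMr// mulrC.
  apply: (le_trans (ler_norm k)); rewrite -ler_pdivrMr//.
  have h := Num.Theory.truncnS_gt (`|k| / d).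
  by apply: ltW; apply: (lt_le_trans h); rewrite ler_nat.
have e1 : (((c - d) `^ p)%R)%:E <= limn_einf (fun n => u n `^ p).
  apply: le_trans (einfs_le_limn_einf _ n0); apply: le_ereal_inf_tmp => _ [n /= hn <-].
  rewrite -poweR_EFin; apply: le_poweR; [exact: ltW|by rewrite lee_fin ltW|].
  rewrite EFinB leeBlDr//; apply: (le_trans (H n)); apply: leeD => //.
  by rewrite lee_fin; exact: hn0.
have -> : (c - d)%:E = (((c - d) `^ p)%R)%:E `^ p^-1.
  by rewrite poweR_EFin -powRrM mulfV ?gt_eqF// powRr1// ltW.
apply: le_poweR => //; first by rewrite invr_ge0 ltW.
by rewrite lee_fin powR_ge0.
Qed.

(** Fatou's lemma for the measurable functions $|G_n|^p$. For [T f] itself only monotonicity of the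
    integral is used, which holds without measurability. *)
Lemma opnorm_le (p M : R) (T : (R -> R[i]) -> R -> \bar R) : (1 < p)%R -> (0 <= M)%R ->
  (forall f x, schwartz f -> 0 <= T f x) ->
  (forall f, schwartz f -> exists G : nat -> R -> \bar R,
    [/\ forall n, measurable_fun setT (G n), forall n, Lpint p (G n) <= M%:E * Lpint p (abs_fun f) &
        forall x, T f x <= (limn_einf (fun n => `|G n x| `^ p)) `^ p^-1]) ->
  opnorm p T <= (M `^ p^-1)%:E.
Proof.
move=> p1 M0 T0 H; have p0 : (0 < p)%R by exact: lt_trans p1.
apply: ereal_inf_lbound; exists (M `^ p^-1)%R => //; split; first exact: powR_ge0.
move=> f sf; have [G [mG IG TG]] := H f sf.
apply/normLp_le => //; first exact: powR_ge0.
have -> : ((M `^ p^-1) `^ p = M)%R by rewrite -powRrM mulVf ?gt_eqF// powRr1.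
apply: (@le_trans _ _ (\int[mu]_x limn_einf (fun n => `|G n x| `^ p))).
  apply: ge0_le_integral_nonmeasurable => x; first exact: poweR_ge0.
  rewrite gee0_abs; last exact: T0.
  have L0 : 0 <= limn_einf (fun n => `|G n x| `^ p).
    apply: le_trans (einfs_le_limn_einf _ 0%N); apply: le_ereal_inf_tmp => _ [n /= _ <-].
    exact: poweR_ge0.
  have -> : limn_einf (fun n => `|G n x| `^ p) = ((limn_einf (fun n => `|G n x| `^ p)) `^ p^-1) `^ p.
    by rewrite -poweRrM mulVf ?gt_eqF// poweRe1.
  by apply: le_poweR (ltW p0) (T0 f x sf) (TG x).
apply: (le_trans (fatou mu measurableT (fun n => measurable_pow p (mG n)) (fun n x _ => poweR_ge0 _ _))).
by apply: le_limn_einf_cst => n; exact: IG.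
Qed.
End Liminf.

(** * Assembly of the three cases of the slope *)

Section Conclusion.
Context {R : realType}.
Local Notation C := R[i].
Local Notation mu := (@lebesgue_measure R).
Variable p : R.
Hypothesis p1 : 1 < p.
Hypothesis frakC_bounded : forall s, exists D : R, forall (r : R) (f : R -> C), 0 < r -> schwartz f ->
  (normLp p (frakC s r f) <= D%:E * normLp p (abs_fun f))%E.

Let p0 : 0 < p. Proof. exact: lt_trans p1. Qed.

Lemma Lpint_frakC : exists2 D : R, 0 <= D & forall s (r : R) (f : R -> C), 0 < r -> schwartz f ->
  (Lpint p (frakC s r f) <= D%:E * Lpint p (abs_fun f))%E.
Proof.
have [D1 H1] := frakC_bounded false; have [D2 H2] := frakC_bounded true.
(* The hypothesis does not state the sign of its constants; the sum of absolute values is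
   nonnegative and covers both brackets. *)
exists ((`|D1| + `|D2|) `^ p); first exact: powR_ge0.
move=> s r f r0 sf; apply/(normLp_le _ _ p0 (addr_ge0 (normr_ge0 D1) (normr_ge0 D2))).
have N0 : (0 <= normLp p (abs_fun f))%E by exact: Lnorm_ge0.
case: s; [apply: (le_trans (H2 r f r0 sf))|apply: (le_trans (H1 r f r0 sf))]; apply: lee_wpmul2r => //; rewrite lee_fin.
  by apply: (le_trans (ler_norm D2)); rewrite lerDr.
by apply: (le_trans (ler_norm D1)); rewrite lerDl.
Qed.

Lemma Lpint_add_le (a b : R) (X : \bar R) (h h' : R -> \bar R) : measurable_fun setT h -> measurable_fun setT h' ->
  (forall x, 0 <= h x)%E -> (forall x, 0 <= h' x)%E -> (0 <= X)%E -> 0 <= a -> 0 <= b ->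
  (Lpint p h <= a%:E * X)%E -> (Lpint p h' <= b%:E * X)%E ->
  (Lpint p (fun x => h x + h' x) <= (2 `^ p * (a + b))%:E * X)%E.
Proof.
move=> mh mh' h0 h0' X0 a0 b0 ha hb; apply: (le_trans (Lpint_add p0 mh mh' h0 h0')).
rewrite EFinM -muleA; apply: lee_wpmul2l; first by rewrite lee_fin powR_ge0.
by rewrite EFinD ge0_muleDl ?lee_fin//; exact: leeD.
Qed.

Lemma schwartz_majorant_measurable (r : R) (g : R -> C) K : 0 < r -> csmooth g K -> measurable_fun setT (majorant r g).
Proof.
move=> r0 sg; have mF s r' (r0' : 0 < r') := @measurable_frakC _ s r' g K r0' sg.
apply: emeasurable_funD.
  apply: emeasurable_funD; [apply: emeasurable_funD; [apply: emeasurable_funD; [apply: emeasurable_funD|]|]|]; exact: mF.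
apply: (eq_measurable_fun (fun y => 40%:E * (parab_mean g y)%:E)%E) => //.
by apply: emeasurable_funM => //; exact: measurable_parab_mean sg.
Qed.

Lemma majorant_ge0 (r : R) (g : R -> C) y : (0 <= majorant r g y)%E.
Proof.
by rewrite /majorant !adde_ge0 ?frakC_ge0// lee_fin mulr_ge0// parab_mean_ge0.
Qed.

(** Each of the five additions in [majorant] costs a factor $2^p$, whence the recursion [M2] to
    [M6]. The second estimate is for slope $+\infty$, where $\mathfrak{C}^r$ alone is the main term;
    the constant [M6 + D] serves both. *)
Lemma Lpint_majorant : exists2 M : R, 0 <= M & forall (r : R) (g : R -> C), 0 < r -> schwartz g ->
  (Lpint p (majorant r g) <= M%:E * Lpint p (abs_fun g))%E /\
  (Lpint p (frakC false r g) <= M%:E * Lpint p (abs_fun g))%E.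
Proof.
have [D D0 HD] := Lpint_frakC.
pose P := 2 `^ p; pose M2 := P * (D + D); pose M3 := P * (M2 + D); pose M4 := P * (M3 + D); pose M5 := P * (M4 + D).
pose M6 := P * (M5 + 40 `^ p * pi `^ p).
have P0 : 0 <= P by exact: powR_ge0.
have M20 : 0 <= M2 by rewrite mulr_ge0// addr_ge0.
have M30 : 0 <= M3 by rewrite mulr_ge0// addr_ge0.
have M40 : 0 <= M4 by rewrite mulr_ge0// addr_ge0.
have M50 : 0 <= M5 by rewrite mulr_ge0// addr_ge0.
have Q0 : 0 <= 40 `^ p * pi `^ p :> R by rewrite mulr_ge0// powR_ge0.
have M60 : 0 <= M6 by rewrite mulr_ge0// addr_ge0.
exists (M6 + D); first exact: addr_ge0.
move=> r g r0 sg; have [K sK] := schwartz_csmooth sg.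
have X0 : (0 <= Lpint p (abs_fun g))%E by exact: Lpint_ge0.
have up (a : R) (Y : \bar R) : a <= M6 + D -> (Y <= a%:E * Lpint p (abs_fun g))%E -> (Y <= (M6 + D)%:E * Lpint p (abs_fun g))%E.
  by move=> h H; apply: (le_trans H); apply: lee_wpmul2r.
split; last by apply: (up D) (HD _ _ _ r0 sg); rewrite lerDr.
apply: (up M6); first by rewrite lerDl.
have mF s r' (r0' : 0 < r') := @measurable_frakC _ s r' g K r0' sK.
have F0 s r' x := @frakC_ge0 _ s r' g x.
have L2 := Lpint_add_le (mF false 1 ltr01) (mF false 1 ltr01) (F0 _ _) (F0 _ _) X0 D0 D0 (HD _ _ _ ltr01 sg) (HD _ _ _ ltr01 sg).
have m2 := emeasurable_funD (mF false 1 ltr01) (mF false 1 ltr01).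
have p2 x : (0 <= frakC false 1 g x + frakC false 1 g x)%E by rewrite adde_ge0.
have L3 := Lpint_add_le m2 (mF true 1 ltr01) p2 (F0 _ _) X0 M20 D0 L2 (HD _ _ _ ltr01 sg).
have m3 := emeasurable_funD m2 (mF true 1 ltr01).
have p3 x : (0 <= frakC false 1 g x + frakC false 1 g x + frakC true 1 g x)%E by rewrite adde_ge0.
have L4 := Lpint_add_le m3 (mF false r r0) p3 (F0 _ _) X0 M30 D0 L3 (HD _ _ _ r0 sg).
have m4 := emeasurable_funD m3 (mF false r r0).
have p4 x : (0 <= frakC false 1 g x + frakC false 1 g x + frakC true 1 g x + frakC false r g x)%E by rewrite adde_ge0.
have L5 := Lpint_add_le m4 (mF true r r0) p4 (F0 _ _) X0 M40 D0 L4 (HD _ _ _ r0 sg).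
have m5 := emeasurable_funD m4 (mF true r r0).
have p5 x : (0 <= frakC false 1 g x + frakC false 1 g x + frakC true 1 g x + frakC false r g x + frakC true r g x)%E by rewrite adde_ge0.
have mm := measurable_parab_mean sK.
have pm x : (0 <= (parab_mean g x)%:E)%E by rewrite lee_fin parab_mean_ge0.
have k0 : 0 <= 40 :> R by [].
have Lm : (Lpint p (fun y => 40%:E * (parab_mean g y)%:E) <= (40 `^ p * pi `^ p)%:E * Lpint p (abs_fun g))%E.
  rewrite (Lpint_scale p k0 mm pm) EFinM -muleA; apply: lee_wpmul2l; first by rewrite lee_fin powR_ge0.
  exact: Lpint_parab_mean p1 sK.
have m6 : measurable_fun setT (fun y => 40%:E * (parab_mean g y)%:E)%E by apply: emeasurable_funM.
have p6 x : (0 <= 40%:E * (parab_mean g x)%:E)%E by rewrite mule_ge0// lee_fin.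
exact: (Lpint_add_le m5 m6 p5 p6 X0 M50 Q0 L5 Lm).
Qed.

Lemma sup_calC_ge0 (a : \bar R) (f : R -> C) x : (0 <= sup_calC a f x)%E.
Proof.
apply: (@le_trans _ _ (calC a 0 f x)); last by apply: ereal_sup_ubound; exists 0.
apply: (@le_trans _ _ (cabs (multop a 0 (fun y => expi (0 * y) * f y) x))%:E); first by rewrite lee_fin cabs_ge0.
by apply: ereal_sup_ubound; exists 0.
Qed.

Lemma sup_calC_le (a : \bar R) (f : R -> C) x U :
  (forall b N, ((cabs (multop a b (fun y => expi (N * y) * f y) x))%:E <= U)%E) -> (sup_calC a f x <= U)%E.
Proof.
move=> H; apply: ge_ereal_sup => _ [b _ <-]; apply: ge_ereal_sup => _ [N _ <-]; exact: H.
Qed.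

(** Common frame of the three cases: main terms [G n] applied to a dilation of $f$ and free of $b$
    and $N$, with one constant [M] for all dilations, and an error $k/(n+1)$ that may depend on $x$,
    $b$ and $N$. *)
Lemma opnorm_sup_calC (a : \bar R) (M : R) : 0 <= M ->
  (forall f, schwartz f -> exists (c : nat -> R) (G : nat -> (R -> C) -> R -> \bar R),
    [/\ forall n, c n != 0,
        forall n, measurable_fun setT (G n (dilate (c n) f)) /\ (forall x, 0 <= G n (dilate (c n) f) x)%E,
        forall n, (Lpint p (G n (dilate (c n) f)) <= M%:E * Lpint p (abs_fun (dilate (c n) f)))%E &
        forall x b N, exists k : R, forall n,
          ((cabs (multop a b (fun y => expi (N * y) * f y) x))%:E <=
            G n (dilate (c n) f) ((c n)^-1 * x)%R + (k / n.+1%:R)%:E)%E]) ->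
  (opnorm p (sup_calC a) <= (M `^ p^-1)%:E)%E.
Proof.
move=> M0 H; apply: opnorm_le => //; first by move=> f x _; exact: sup_calC_ge0.
move=> f sf; have [c [G [c0 mG LG HG]]] := H f sf.
have [K sK] := schwartz_csmooth sf.
exists (fun n x => G n (dilate (c n) f) ((c n)^-1 * x)); split.
- move=> n; have [m1 _] := mG n.
  by apply: (measurableT_comp m1); exact: measurable_funM.
- move=> n; have [m1 _] := mG n; exact: (Lpint_rescale (c0 n) (csmooth_meas sK) m1 (LG n)).
- move=> x; apply: sup_calC_le => b N; have [k hk] := HG x b N.
  have -> : (fun n => `|G n (dilate (c n) f) ((c n)^-1 * x)%R| `^ p)%E = (fun n => G n (dilate (c n) f) ((c n)^-1 * x)%R `^ p)%E.
    by apply/funext => n; rewrite gee0_abs//; have [_] := mG n; exact.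
  apply: limn_einf_power hk => // n; have [_] := mG n; exact.
Qed.

Lemma opnorm_sup_calC_bounded : exists2 M : R, 0 <= M & forall a : \bar R, a != -oo%E ->
  (opnorm p (sup_calC a) <= (M `^ p^-1)%:E)%E.
Proof.
have [M M0 HM] := Lpint_majorant; exists M => // a aNy.
have pi8 : 8 * pi != 0 :> R by rewrite mulf_neq0// gt_eqF// pi_gt0.
apply: opnorm_sup_calC => // f sf; have [K sK] := schwartz_csmooth sf.
have sd c : c != 0 -> exists K', csmooth (dilate c f) K'.
  by move=> c0; exact: schwartz_csmooth (schwartz_dilate c0 sf).
have n0 (n : nat) : 0 < n.+1%:R :> R by [].
have n1 (n : nat) : 1 <= n.+1%:R :> R by rewrite ler1n.
case: a aNy => [a _|_|]; last by rewrite eqxx.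
- have [->|a0] := eqVneq a 0.
  + pose al n : R := (2 * n.+1%:R ^+ 2)^-1; pose la n := al n ^+ 2 / (8 * pi).
    have al0 n : al n != 0 by rewrite invr_eq0 mulf_neq0// expf_neq0// gt_eqF.
    have la0 n : - la n != 0 by rewrite oppr_eq0 mulf_neq0 ?expf_neq0// invr_eq0.
    (* As the slope tends to 0 the dilation varies, and with it the $L^1$ norm of the dilated
       function. The radius includes that norm, so that the tail $2 \|\cdot\|_1/r$ stays below
       $2/(n+1)$. *)
    pose r n := n.+1%:R * (1 + L1 (dilate (- la n) f)).
    have L0 g : 0 <= L1 g by apply: Rintegral_ge0 => v _; exact: cabs_ge0.
    have r1 n : 1 <= r n by apply: mulr_ege1; rewrite ?n1// lerDl L0.
    have r0 n : 0 < r n by exact: lt_le_trans (r1 n).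
    exists (fun n => - la n), (fun n => majorant (r n)); split => //.
    * move=> n; have [K' sK'] := sd _ (la0 n).
      by split; [exact: schwartz_majorant_measurable (r0 n) sK'|move=> x; exact: majorant_ge0].
    * by move=> n; have [] := HM (r n) _ (r0 n) (schwartz_dilate (la0 n) sf).
    * move=> x b N; have [c Hc] := multop_zero_slope b N x sK; exists (c + 2) => n.
      have [K' sK'] := sd _ (la0 n).
      have Hn := multop_fin_majorant b N x (al0 n) erefl sK sK' (r1 n).
      apply: (@le_trans _ _ ((cabs (multop (al n)%:E b (fun y => expi (N * y) * f y) x))%:E + (c / n.+1%:R)%:E)%E).
        by rewrite -EFinD lee_fin; exact: Hc.
      apply: (le_trans (leeD Hn (lexx _))); rewrite -addeA invrN; apply: leeD => //.
      rewrite -EFinD lee_fin (_ : (c + 2) / n.+1%:R = 2 / n.+1%:R + c / n.+1%:R); last by ring.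
      rewrite lerD2r -/(la n) /r invfM.
      have -> : 2 * (L1 (dilate (- la n) f) * (n.+1%:R^-1 * (1 + L1 (dilate (- la n) f))^-1)) =
        2 / n.+1%:R * (L1 (dilate (- la n) f) / (1 + L1 (dilate (- la n) f))) by ring.
      have Lp : 0 < 1 + L1 (dilate (- la n) f) by rewrite (lt_le_trans ltr01)// lerDl L0.
      apply: ler_piMr; first by rewrite divr_ge0.
      by rewrite ler_pdivrMr// mul1r lerDr.
  + pose la := a ^+ 2 / (8 * pi).
    have la0 : - la != 0 by rewrite oppr_eq0 mulf_neq0 ?expf_neq0// invr_eq0.
    have [K' sK'] := sd _ la0.
    (* For a fixed nonzero slope the dilation is fixed too, and radii $n+1$ suffice to make the tail
       vanish. *)
    exists (fun=> - la), (fun n => majorant n.+1%:R); split => //.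
    * by move=> n; split; [exact: schwartz_majorant_measurable (n0 n) sK'|move=> x; exact: majorant_ge0].
    * by move=> n; have [] := HM n.+1%:R _ (n0 n) (schwartz_dilate la0 sf).
    * move=> x b N; exists (2 * L1 (dilate (- la) f)) => n.
      by rewrite invrN -mulrA; exact: (multop_fin_majorant b N x a0 erefl sK sK' (n1 n)).
- pose ka (n : nat) : R := n.+1%:R ^+ 4 / (2 * pi).
  have ka0 n : - ka n != 0.
    by rewrite oppr_eq0 mulf_neq0 ?expf_neq0 ?gt_eqF// invr_gt0 mulr_gt0// pi_gt0.
  have r0 (n : nat) : 0 < (n.+1%:R ^+ 3)^-1 :> R by rewrite invr_gt0 exprn_gt0.
  exists (fun n => - ka n), (fun n => frakC false ((n.+1%:R ^+ 3)^-1)); split => //.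
  + move=> n; have [K' sK'] := sd _ (ka0 n).
    by split; [exact: measurable_frakC (r0 n) sK'|move=> x; exact: frakC_ge0].
  + by move=> n; have [] := HM ((n.+1%:R ^+ 3)^-1) _ (r0 n) (schwartz_dilate (ka0 n) sf).
  + move=> x b N; exists (128 * K * `|b| + 128 * pi ^+ 3 * K * (1 + `|x|) ^+ 2) => n.
    have [K' sK'] := sd _ (ka0 n).
    by rewrite invrN; exact: (multop_pinfty_bound b N x sK erefl sK').
Qed.
End Conclusion.

Theorem proposition1 (R : realType)
  (hC : forall (signed : bool) (p : R), 1 < p ->
    exists C : R, forall (r : R) (f : R -> R[i]), 0 < r -> schwartz f ->
      (normLp p (frakC signed r f) <= C%:E * normLp p (abs_fun f))%E) :
  forall p : R, 1 < p ->
    (ereal_sup [set opnorm p (sup_calC a) | a in [set a : \bar R | a != -oo%E]]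
       < +oo)%E.
Proof.
move=> p p1; have [M M0 HM] := opnorm_sup_calC_bounded p1 (fun s => hC s p p1).
apply: (@le_lt_trans _ _ (M `^ p^-1)%:E); last exact: ltry.
by apply: ge_ereal_sup => _ [a aNy <-]; exact: HM.
Qed.
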